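(* Let $r\ge 2$ be an integer and let $\gamma=(\gamma_1,\dots,\gamma_{r-1})\in\mathbb{R}^{r-1}$ satisfy $\gamma_k\ge -1+\frac{k}{r}$ for all $k\in\{1,\dots,r-1\}$. Let $\mathcal{L}$ be a continuous linear mapping from $\mathcal{H}_r(\mathbb{C})$ into itself. Then the following are equivalent: (i) $\mathcal{L}$ commutes with the operator $B_r$. (ii) $\mathcal{L}$ commutes with $T^\gamma_z$ for all $z\in\mathbb{C}$. (iii) There exists a unique $T\in\mathcal{H}'_r(\mathbb{C})$ such that $\mathcal{L}u=T\star_\gamma u$ for all $u\in\mathcal{H}_r(\mathbb{C})$. (iv) There exists $\Phi(z)=\sum_{n=0}^{+\infty}\frac{b_n}{\alpha_{rn}(\gamma)}z^{rn}\in\mathrm{Exp}_r(\mathbb{C})$ such that $\mathcal{L}=\Phi(B_r)$, that is, for every $u\in\mathcal{H}_r(\mathbb{C})$, $$\mathcal{L}(u)(z)=[\Phi(B_r)u](z)=\sum_{n=0}^{+\infty}\frac{b_n}{\alpha_{rn}(\gamma)}B_r^nu(z),\qquad z\in\mathbb{C};$$ moreover, this series converges in $\mathcal{H}_r(\mathbb{C})$.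
   Context: A function $u:\mathbb{C}\to\mathbb{C}$ is $r$-even if $u(\omega^k z)=u(z)$ for all $z\in\mathbb{C}$ and $k\in\{1,\dots,r-1\}$, where $\omega=e^{2i\pi/r}$. $\mathcal{H}_r(\mathbb{C})$ is the Fréchet space of all $r$-even entire functions with the topology of uniform convergence on compact subsets of $\mathbb{C}$; $\mathcal{H}'_r(\mathbb{C})$ is its dual. $\mathrm{Exp}_r(\mathbb{C})$ is the set of $u\in\mathcal{H}_r(\mathbb{C})$ such that $\sup_{z\in\mathbb{C}}|u(z)|e^{-a|z|}<\infty$ for some $a>0$. The hyper-Bessel operator is $B_r=\frac{1}{z^{r-1}}\prod_{i=1}^{r-1}\big(z\frac{d}{dz}+(r\gamma_i+1)\big)\frac{d}{dz}$. For $u\in\mathcal{H}_r(\mathbb{C})$, $B_ru$, defined for $z\ne0$, extends to an entire function, and $B_ru$ denotes this extension, which lies in $\mathcal{H}_r(\mathbb{C})$. With $\mathbb{N}=\{0,1,\dots\}$, $\alpha_{rn}(\gamma)=r^{rn}\,n!\prod_{i=1}^{r-1}\frac{\Gamma(\gamma_i+n+1)}{\Gamma(\gamma_i+1)}$, $n\in\mathbb{N}$. The generalized translations are $(T^\gamma_zu)(w)=\sum_{n=0}^{\infty}\frac{w^{rn}}{\alpha_{rn}(\gamma)}B_r^nu(z)$ for $z,w\in\mathbb{C}$, $u\in\mathcal{H}_r(\mathbb{C})$; they are continuous linear operators on $\mathcal{H}_r(\mathbb{C})$. For $T\in\mathcal{H}'_r(\mathbb{C})$ and $u\in\mathcal{H}_r(\mathbb{C})$,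 the generalized convolution is $(T\star_\gamma u)(z)=\langle T,T^\gamma_zu\rangle$, $z\in\mathbb{C}$. *)

(* Defs.v *)
From Stdlib Require Import Reals List Factorial.
From Stdlib Require Import ClassicalEpsilon FunctionalExtensionality ProofIrrelevance.
From Coquelicot Require Import Coquelicot.

Local Open Scope C_scope.

Definition entire (u : C -> C) : Prop :=
  forall z : C, ex_derive (K := C_AbsRing) (V := C_NormedModule) u z.

Definition omega (r : nat) : C :=
  (cos (2 * PI / INR r), sin (2 * PI / INR r))%R.

Definition even_order (r : nat) (u : C -> C) : Prop :=
  forall (k : nat) (z : C), (1 <= k <= r - 1)%nat -> u (omega r ^ k * z) = u z.

(** * The space of [r]-even entire functions *)

Record Hr (r : nat) : Type := mkHr {
  Hr_fun :> C -> C;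
  Hr_entire : entire Hr_fun;
  Hr_even : even_order r Hr_fun }.

Arguments mkHr {r} _ _ _.
Arguments Hr_fun {r} _ _.

Lemma Hr_ext (r : nat) (u v : Hr r) : (forall z, u z = v z) -> u = v.
Proof.
  destruct u as [u u1 u2], v as [v v1 v2]; simpl; intros H.
  assert (E : u = v) by (apply functional_extensionality; exact H).
  subst v.
  now rewrite (proof_irrelevance _ u1 v1), (proof_irrelevance _ u2 v2).
Qed.

Lemma entire_zero : entire (fun _ => 0).
Proof. intros z; exists zero; apply is_derive_const. Qed.

Lemma entire_plus (u v : C -> C) :
  entire u -> entire v -> entire (fun z => u z + v z).
Proof.
  intros Hu Hv z; destruct (Hu z) as [a Ha], (Hv z) as [b Hb].
  exists (plus a b).
  exact (is_derive_plus (K := C_AbsRing) (V := C_NormedModule) u v z a b Ha Hb).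
Qed.

Lemma entire_scal (c : C) (u : C -> C) :
  entire u -> entire (fun z => c * u z).
Proof.
  intros Hu z; destruct (Hu z) as [a Ha].
  exists (scal (K := C_Ring) (V := C_ModuleSpace) c a).
  pose proof (filterdiff_scal_r_fct (K := C_AbsRing)
                (U := AbsRing_NormedModule C_AbsRing) (V := C_NormedModule)
                c u _ Cmult_comm Ha) as H.
  refine (filterdiff_ext_lin _ _ _ H _).
  intros y; change (c * (y * a) = y * (c * a)); ring.
Qed.

Definition Hr_zero (r : nat) : Hr r :=
  mkHr (fun _ => 0) entire_zero (fun _ _ _ => eq_refl).

Lemma even_plus (r : nat) (u v : Hr r) : even_order r (fun z => u z + v z).
Proof. intros k z Hk; now rewrite !Hr_even. Qed.

Definition Hr_plus (r : nat) (u v : Hr r) : Hr r :=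
  mkHr _ (entire_plus u v (Hr_entire r u) (Hr_entire r v)) (even_plus r u v).

Lemma even_scal (r : nat) (c : C) (u : Hr r) : even_order r (fun z => c * u z).
Proof. intros k z Hk; now rewrite Hr_even. Qed.

Definition Hr_scal (r : nat) (c : C) (u : Hr r) : Hr r :=
  mkHr _ (entire_scal c u (Hr_entire r u)) (even_scal r c u).

Definition Hr_AbelianMonoid_mixin (r : nat) : AbelianMonoid.mixin_of (Hr r).
Proof.
  apply (AbelianMonoid.Mixin (Hr r) (Hr_plus r) (Hr_zero r));
    intros; apply Hr_ext; intros t; simpl; ring.
Defined.

Canonical Hr_AbelianMonoid (r : nat) : AbelianMonoid :=
  AbelianMonoid.Pack (Hr r) (Hr_AbelianMonoid_mixin r) (Hr r).

Definition Hr_AbelianGroup_mixin (r : nat) :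
  AbelianGroup.mixin_of (Hr_AbelianMonoid r).
Proof.
  apply (AbelianGroup.Mixin (Hr_AbelianMonoid r) (Hr_scal r (- (1)))).
  intros; apply Hr_ext; intros t; simpl; ring.
Defined.

Canonical Hr_AbelianGroup (r : nat) : AbelianGroup :=
  AbelianGroup.Pack (Hr r)
    (AbelianGroup.Class (Hr r) (Hr_AbelianMonoid_mixin r) (Hr_AbelianGroup_mixin r))
    (Hr r).

Definition Hr_ModuleSpace_mixin (r : nat) :
  ModuleSpace.mixin_of C_Ring (Hr_AbelianGroup r).
Proof.
  apply (ModuleSpace.Mixin C_Ring (Hr_AbelianGroup r) (Hr_scal r));
    intros; apply Hr_ext; intros t; simpl; unfold mult, plus, one; simpl; ring.
Defined.

Canonical Hr_ModuleSpace (r : nat) : ModuleSpace C_Ring :=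
  ModuleSpace.Pack C_Ring (Hr r)
    (ModuleSpace.Class C_Ring (Hr r) (AbelianGroup.class (Hr_AbelianGroup r))
       (Hr_ModuleSpace_mixin r))
    (Hr r).

(** * The topology of uniform convergence on compact sets *)

Definition compact_set {X : UniformSpace} (K : X -> Prop) : Prop :=
  forall (I : Type) (U : I -> X -> Prop),
    (forall i, open (U i)) ->
    (forall x, K x -> exists i, U i x) ->
    exists l : list I, forall x, K x -> exists i, In i l /\ U i x.

(** Neighbourhood filter of [u], to be used with [filterlim]. *)
Definition Hr_nbhs {r : nat} (u : Hr r) (P : Hr r -> Prop) : Prop :=
  exists K : C -> Prop, compact_set (X := C_UniformSpace) K /\
  exists eps : posreal,
    forall v : Hr r, (forall z, K z -> (Cmod (v z - u z) < eps)%R) -> P v.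

Definition linear_map {K : Ring} {U V : ModuleSpace K} (f : U -> V) : Prop :=
  (forall x y, f (plus x y) = plus (f x) (f y)) /\
  (forall k x, f (scal k x) = scal k (f x)).

Definition Hr_endo {r : nat} (L : Hr r -> Hr r) : Prop :=
  linear_map L /\ forall u, filterlim L (Hr_nbhs u) (Hr_nbhs (L u)).

Definition Hr_dual {r : nat} (T : Hr r -> C) : Prop :=
  linear_map (V := C_ModuleSpace) T /\
  forall u, filterlim T (Hr_nbhs u) (locally (T := C_UniformSpace) (T u)).

Definition commutes {X : Type} (A B : X -> X) : Prop :=
  forall x, A (B x) = B (A x).

Definition exp_type {r : nat} (u : Hr r) : Prop :=
  exists a M : R, (0 < a)%R /\
    forall z : C, (Cmod (u z) * exp (- (a * Cmod z)) <= M)%R.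

(** * Hyper-Bessel operator, generalized translations

    A vector [(gamma_1, ..., gamma_(r-1))] is encoded as [gamma : nat -> R];
    only its values at the indices [1, ..., r-1] are ever used. *)

(** Euler's integral; meaningful for [0 < x]. *)
Definition Gamma (x : R) : R :=
  RInt_gen (fun t : R => (Rpower t (x - 1) * exp (- t))%R)
    (at_right 0) (Rbar_locally p_infty).

(** [alpha r gamma n] is the number written alpha_(rn)(gamma). *)
Definition alpha (r : nat) (gamma : nat -> R) (n : nat) : R :=
  (INR r ^ (r * n) * INR (fact n) *
   fold_right Rmult 1
     (map (fun i => Gamma (gamma i + INR n + 1) / Gamma (gamma i + 1))
        (seq 1 (r - 1))))%R.

(** The operator [z d/dz + c]. *)
Definition euler_op (c : R) (f : C -> C) : C -> C :=
  fun z => z * C_derive f z + c * f z.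

Definition hyper_bessel_formula (r : nat) (gamma : nat -> R) (u : C -> C) : C -> C :=
  fun z =>
    / z ^ (r - 1) *
    fold_right (fun i f => euler_op (INR r * gamma i + 1)%R f) (C_derive u)
      (seq 1 (r - 1)) z.

(** The formula only makes sense off the origin: [hyper_bessel u] is the element
    of [Hr r] that extends it (there is exactly one). *)
Definition hyper_bessel (r : nat) (gamma : nat -> R) (u : Hr r) : Hr r :=
  epsilon (inhabits (Hr_zero r))
    (fun v : Hr r => forall z, z <> 0 -> v z = hyper_bessel_formula r gamma u z).

Definition hyper_bessel_iter (r : nat) (gamma : nat -> R) (n : nat) : Hr r -> Hr r :=
  Nat.iter n (hyper_bessel r gamma).

(** [translation r gamma z u] is the element of [Hr r] whose value at each [w] is
    the sum of the series. *)
Definition translation (r : nat) (gamma : nat -> R) (z : C) (u : Hr r) : Hr r :=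
  epsilon (inhabits (Hr_zero r))
    (fun v : Hr r => forall w : C,
       is_series (V := C_NormedModule)
         (fun n => w ^ (r * n) / alpha r gamma n * hyper_bessel_iter r gamma n u z)
         (v w)).

Definition gconvolution {r : nat} (gamma : nat -> R) (T : Hr r -> C) (u : Hr r) : C -> C :=
  fun z => T (translation r gamma z u).

(** [Phi] is an element of Exp_r with [Phi z = sum_n (b n / alpha_(rn)) z^(rn)]. *)
Definition exp_symbol {r : nat} (gamma : nat -> R) (b : nat -> C) (Phi : Hr r) : Prop :=
  exp_type Phi /\
  forall z : C,
    is_series (V := C_NormedModule)
      (fun n => b n / alpha r gamma n * z ^ (r * n)) (Phi z).

(** [L = Phi(B_r)], the series being summed pointwise. *)
Definition is_symbol_op {r : nat} (gamma : nat -> R) (b : nat -> C)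
    (L : Hr r -> Hr r) : Prop :=
  forall (u : Hr r) (z : C),
    is_series (V := C_NormedModule)
      (fun n => b n / alpha r gamma n * hyper_bessel_iter r gamma n u z) (L u z).

(* Main.v *)
Require Import Defs.
From Stdlib Require Import Reals ZArith Lra Lia List Factorial.
From Stdlib Require Import Classical ClassicalEpsilon FunctionalExtensionality.
From Coquelicot Require Import Coquelicot.

(** In the system [z ^ (r n) / alpha n] the operator [B_r] is the backward shift, so an
    [r]-even entire function is the sequence of its coordinates [a n = (B_r^n u)(0)], with
    [a n = O(alpha n / R^n)] for every [R].  The bound
    [alpha (n + m) <= Q^(n + m) alpha n alpha m] makes all the double series that occur
    absolutely convergent; in particular [(T_z u)(w)] is symmetric in [z] and [w], and
    [T_z u = sum z^(r n) / alpha n B_r^n u] converges in [H_r].  An operator commuting with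
    [B_r] therefore commutes with [T_z], evaluation at [0] gives [L u = T * u] with
    [T u = (L u)(0)], and [b n = T (z^(r n))] is the symbol.  Conversely, a convolution or a
    symbol operator satisfies [(L u)(z) = sum T (B_r^n u) z^(r n) / alpha n], and such an
    operator commutes with the shift.

    Taylor expansion of entire functions comes from Goursat's bisection, applied
    directly to the homotopy [z + e^s (rho e^(it) - z)] that contracts a circle to [z]:
    this gives Cauchy's formula with no continuity assumption on the derivative. *)

Local Open Scope R_scope.

(** * Contour integrals over parameter rectangles *)

(** [entire] asks for complex differentiability at each point, while [hyper_bessel] and
    [translation] are picked by [epsilon] and say nothing until an element of [Hr r] with the
    required property is exhibited. Both facts lead to coordinates: Cauchy's estimates bound the
    coordinates of every element of [Hr r], and each sequence of that growth is summed to an element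
    of [Hr r], the witness for such a choice. Up to geometric factors alpha n is (n!)^r. This gives
    the constant Q, and it also shows that Phi has exponential type exactly when b n = O(Y^n) for
    some Y. That is the bound which continuity of T gives for b n = T (z^(r n)), and the one under
    which the symbol series converges uniformly on compact sets. Estimates leave room on purpose: a
    radius is enlarged until the terms are at most M (1/2)^n, or M (1/2)^n (1/2)^m for double
    series, uniformly on a disc. Tails and interchanges of summation then reduce to geometric
    series. *)

Lemma is_series_Cmod (a : nat -> C) (l : C) :
  is_series (V := C_NormedModule) a l <->
  forall eps, 0 < eps -> exists N, forall n, (N <= n)%nat ->
    Cmod (sum_n a n - l) < eps.
Proof.
  split.
  - intros H eps He.
    assert (H1 := proj1 (filterlim_locally_ball_norm (K := C_AbsRing) (U := C_NormedModule) (F := eventually) (sum_n a) l) H).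
    exact (H1 (mkposreal eps He)).
  - intros H. apply (proj2 (filterlim_locally_ball_norm (K := C_AbsRing) (U := C_NormedModule) (F := eventually) (sum_n a) l)).
    intros [eps He]. exact (H eps He).
Qed.

Lemma is_derive_Cmod (f : C -> C) (z l : C) :
  is_derive (K := C_AbsRing) (V := C_NormedModule) f z l <->
  forall eps, 0 < eps -> exists d, 0 < d /\ forall y, Cmod (y - z) < d ->
    Cmod (f y - f z - (y - z) * l) <= eps * Cmod (y - z).
Proof.
  split.
  - intros [_ H] eps He.
    destruct (H z (fun P HP => HP) (mkposreal eps He)) as [d Hd].
    exists d; split; [apply cond_pos|]. intros y Hy. exact (Hd y Hy).
  - intros H. split; [apply is_linear_scal_l|].
    intros x Hx.
    assert (E : x = z).
    { symmetry. exact (is_filter_lim_locally_unique (K := C_AbsRing) (V := AbsRing_NormedModule C_AbsRing) z x Hx). }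
    subst x. intros [eps He]. destruct (H eps He) as [d [Hd H1]].
    exists (mkposreal d Hd). intros y Hy. exact (H1 y Hy).
Qed.

(** The variable is real, so [C] is taken as a normed module over R; complex scalars pass through
    the integral by [CRInt_mult], which splits into real and imaginary parts. *)
Definition CRInt (f : R -> C) (a b : R) : C := RInt (V := C_R_CompleteNormedModule) f a b.
Definition RC_continuous (f : R -> C) (x : R) := continuous (U := C_R_NormedModule) f x.

Lemma RC_continuous_Cmod (f : R -> C) (x : R) :
  RC_continuous f x <-> forall eps, 0 < eps -> exists d, 0 < d /\ forall y, Rabs (y - x) < d ->
    Cmod (f y - f x) < eps.
Proof.
  unfold RC_continuous, continuous. split.
  - intros H eps He.
    assert (H1 := proj1 (filterlim_locally_ball_norm (K := R_AbsRing) (U := C_R_NormedModule) (F := locally x) f (f x)) H (mkposreal eps He)).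
    destruct H1 as [d Hd]. exists d; split; [apply cond_pos|].
    intros y Hy. rewrite Cmod_norm. exact (Hd y Hy).
  - intros H. apply (proj2 (filterlim_locally_ball_norm (K := R_AbsRing) (U := C_R_NormedModule) (F := locally x) f (f x))).
    intros [eps He]. destruct (H eps He) as [d [Hd H1]].
    exists (mkposreal d Hd). intros y Hy. specialize (H1 y Hy). rewrite Cmod_norm in H1. exact H1.
Qed.

Lemma CRInt_correct f a b : (forall x, RC_continuous f x) -> is_RInt (V := C_R_NormedModule) f a b (CRInt f a b).
Proof.
  intros H. apply (RInt_correct (V := C_R_CompleteNormedModule)).
  apply (ex_RInt_continuous (V := C_R_CompleteNormedModule)). intros z _. apply H.
Qed.

Lemma CRInt_bound f a b M : a <= b -> (forall x, RC_continuous f x) ->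
  (forall x, a <= x <= b -> Cmod (f x) <= M) -> Cmod (CRInt f a b) <= (b - a) * M.
Proof.
  intros Hab Hc HM. rewrite Cmod_norm.
  apply (norm_RInt_le_const (V := C_R_NormedModule) f a b); auto.
  - intros x Hx. rewrite <- Cmod_norm. auto.
  - now apply CRInt_correct.
Qed.

Lemma CRInt_unique f a b l : is_RInt (V := C_R_NormedModule) f a b l -> CRInt f a b = l.
Proof. apply (is_RInt_unique (V := C_R_CompleteNormedModule)). Qed.

Lemma CRInt_Chasles f a b c : (forall x, RC_continuous f x) -> (CRInt f a b + CRInt f b c)%C = CRInt f a c.
Proof.
  intros H. symmetry. apply CRInt_unique.
  apply (is_RInt_Chasles (V := C_R_NormedModule) f a b c); now apply CRInt_correct.
Qed.

Lemma CRInt_minus f g a b : (forall x, RC_continuous f x) -> (forall x, RC_continuous g x) ->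
  CRInt (fun x => f x - g x)%C a b = (CRInt f a b - CRInt g a b)%C.
Proof.
  intros Hf Hg. apply CRInt_unique.
  apply (is_RInt_minus (V := C_R_NormedModule)); now apply CRInt_correct.
Qed.

Lemma CRInt_plus f g a b : (forall x, RC_continuous f x) -> (forall x, RC_continuous g x) ->
  CRInt (fun x => f x + g x)%C a b = (CRInt f a b + CRInt g a b)%C.
Proof.
  intros Hf Hg. apply CRInt_unique.
  apply (is_RInt_plus (V := C_R_NormedModule)); now apply CRInt_correct.
Qed.

Lemma CRInt_ext f g a b : (forall x, f x = g x) -> CRInt f a b = CRInt g a b.
Proof. intros H. apply (RInt_ext (V := C_R_CompleteNormedModule)). intros; apply H. Qed.

Lemma RC_continuous_const c x : RC_continuous (fun _ => c) x.
Proof. apply (continuous_const (U := R_UniformSpace) (V := C_R_NormedModule)). Qed.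

Lemma RC_continuous_plus f g x : RC_continuous f x -> RC_continuous g x -> RC_continuous (fun x => f x + g x)%C x.
Proof. apply (continuous_plus (V := C_R_NormedModule)). Qed.

Lemma RC_continuous_minus f g x : RC_continuous f x -> RC_continuous g x -> RC_continuous (fun x => f x - g x)%C x.
Proof. apply (continuous_minus (V := C_R_NormedModule)). Qed.

Lemma RC_continuous_bounded f x : RC_continuous f x -> exists d M, 0 < d /\ 0 < M /\ forall y, Rabs (y - x) < d -> Cmod (f y) <= M.
Proof.
  intros H. destruct (proj1 (RC_continuous_Cmod f x) H 1 Rlt_0_1) as [d [Hd H1]].
  exists d, (Cmod (f x) + 1). split; [auto|split].
  - pose proof (Cmod_ge_0 (f x)); lra.
  - intros y Hy. replace (f y) with (f x + (f y - f x))%C by ring.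
    eapply Rle_trans; [apply Cmod_triangle|]. specialize (H1 y Hy). lra.
Qed.

Lemma RC_continuous_mult f g x : RC_continuous f x -> RC_continuous g x -> RC_continuous (fun x => f x * g x)%C x.
Proof.
  intros Hf Hg. apply RC_continuous_Cmod. intros eps He.
  destruct (RC_continuous_bounded g x Hg) as [d1 [M [Hd1 [HM H1]]]].
  assert (HA : 0 < Cmod (f x) + 1) by (pose proof (Cmod_ge_0 (f x)); lra).
  destruct (proj1 (RC_continuous_Cmod f x) Hf (eps / (2 * M))) as [d2 [Hd2 H2]].
  { apply Rdiv_lt_0_compat; lra. }
  destruct (proj1 (RC_continuous_Cmod g x) Hg (eps / (2 * (Cmod (f x) + 1)))) as [d3 [Hd3 H3]].
  { apply Rdiv_lt_0_compat; lra. }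
  exists (Rmin d1 (Rmin d2 d3)). split; [repeat apply Rmin_glb_lt; auto|].
  intros y Hy.
  assert (Hy1 : Rabs (y - x) < d1) by (eapply Rlt_le_trans; [exact Hy|apply Rmin_l]).
  assert (Hy2 : Rabs (y - x) < d2)
    by (eapply Rlt_le_trans; [exact Hy|eapply Rle_trans; [apply Rmin_r|apply Rmin_l]]).
  assert (Hy3 : Rabs (y - x) < d3)
    by (eapply Rlt_le_trans; [exact Hy|eapply Rle_trans; [apply Rmin_r|apply Rmin_r]]).
  replace (f y * g y - f x * g x)%C with ((f y - f x) * g y + f x * (g y - g x))%C by ring.
  eapply Rle_lt_trans; [apply Cmod_triangle|]. rewrite !Cmod_mult.
  specialize (H1 y Hy1); specialize (H2 y Hy2); specialize (H3 y Hy3).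
  assert (Cmod (f y - f x) * Cmod (g y) <= eps / (2 * M) * M).
  { apply Rmult_le_compat; auto using Cmod_ge_0; lra. }
  assert (Cmod (f x) * Cmod (g y - g x) < (Cmod (f x) + 1) * (eps / (2 * (Cmod (f x) + 1)))).
  { apply Rle_lt_trans with (Cmod (f x) * (eps / (2 * (Cmod (f x) + 1)))).
    - apply Rmult_le_compat_l; [apply Cmod_ge_0|lra].
    - apply Rmult_lt_compat_r; [apply Rdiv_lt_0_compat; lra|lra]. }
  replace (eps / (2 * M) * M) with (eps / 2) in * by (field; lra).
  replace ((Cmod (f x) + 1) * (eps / (2 * (Cmod (f x) + 1)))) with (eps / 2) in * by (field; lra).
  lra.
Qed.

Definition C_continuous (f : C -> C) (z : C) := forall eps, 0 < eps -> exists d, 0 < d /\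
  forall y, Cmod (y - z) < d -> Cmod (f y - f z) < eps.

Lemma RC_continuous_comp f g x : RC_continuous g x -> C_continuous f (g x) -> RC_continuous (fun x => f (g x)) x.
Proof.
  intros Hg Hf. apply RC_continuous_Cmod. intros eps He.
  destruct (Hf eps He) as [d [Hd H1]].
  destruct (proj1 (RC_continuous_Cmod g x) Hg d Hd) as [d' [Hd' H2]].
  exists d'; split; auto.
Qed.

Lemma C_continuous_inv (z : C) : z <> 0%C -> C_continuous Cinv z.
Proof.
  intros Hz eps He.
  pose proof (proj1 (Cmod_gt_0 z) Hz) as Hm.
  exists (Rmin (Cmod z / 2) (eps * Cmod z * Cmod z / 2)).
  split.
  { apply Rmin_glb_lt; [lra|]. pose proof (Rmult_lt_0_compat _ _ (Rmult_lt_0_compat _ _ He Hm) Hm); lra. }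
  intros y Hy.
  assert (Hy1 : Cmod (y - z) < Cmod z / 2) by (eapply Rlt_le_trans; [exact Hy|apply Rmin_l]).
  assert (Hy2 : Cmod (y - z) < eps * Cmod z * Cmod z / 2) by (eapply Rlt_le_trans; [exact Hy|apply Rmin_r]).
  assert (Hym : Cmod z / 2 < Cmod y).
  { pose proof (Cmod_triangle y (- (y - z))) as T.
    replace (y + - (y - z))%C with z in T by ring. rewrite Cmod_opp in T. lra. }
  assert (Hy0 : y <> 0%C) by (apply Cmod_gt_0; lra).
  replace (/ y - / z)%C with (- (y - z) * / (y * z))%C by (field; auto).
  rewrite Cmod_mult, Cmod_opp, Cmod_inv, Cmod_mult by (apply Cmult_neq_0; auto).
  apply Rmult_lt_reg_r with (Cmod y * Cmod z); [apply Rmult_lt_0_compat; lra|].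
  replace (Cmod (y - z) * / (Cmod y * Cmod z) * (Cmod y * Cmod z)) with (Cmod (y - z)) by (field; lra).
  eapply Rlt_le_trans; [exact Hy2|].
  replace (eps * Cmod z * Cmod z / 2) with (eps * ((Cmod z / 2) * Cmod z)) by field.
  apply Rmult_le_compat_l; [lra|]. apply Rmult_le_compat_r; lra.
Qed.

Lemma C_continuous_entire f : entire f -> forall z, C_continuous f z.
Proof.
  intros H z eps He. destruct (H z) as [l Hl].
  destruct (proj1 (is_derive_Cmod f z l) Hl 1 Rlt_0_1) as [d [Hd H1]].
  assert (Hp : 0 < 2 + Cmod l) by (pose proof (Cmod_ge_0 l); lra).
  exists (Rmin d (eps / (2 + Cmod l))). split.
  { apply Rmin_glb_lt; auto. apply Rdiv_lt_0_compat; lra. }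
  intros y Hy.
  assert (Hy1 : Cmod (y - z) < d) by (eapply Rlt_le_trans; [exact Hy|apply Rmin_l]).
  assert (Hy2 : Cmod (y - z) < eps / (2 + Cmod l)) by (eapply Rlt_le_trans; [exact Hy|apply Rmin_r]).
  specialize (H1 y Hy1).
  replace (f y - f z)%C with ((f y - f z - (y - z) * l) + (y - z) * l)%C by ring.
  eapply Rle_lt_trans; [apply Cmod_triangle|]. rewrite Cmod_mult.
  assert (Cmod (y - z) * (2 + Cmod l) < eps).
  { apply Rmult_lt_reg_r with (/ (2 + Cmod l)); [now apply Rinv_0_lt_compat|].
    rewrite Rmult_assoc, Rinv_r by lra. lra. }
  assert (HE : Cmod (y - z) = 0 \/ 0 < Cmod (y - z)) by (pose proof (Cmod_ge_0 (y - z)); lra).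
  destruct HE; nra.
Qed.


Lemma nested_intervals (a b : nat -> R) :
  (forall n, a n <= a (S n)) -> (forall n, b (S n) <= b n) -> (forall n, a n <= b n) ->
  exists s, forall n, a n <= s <= b n.
Proof.
  intros Ha Hb Hab.
  assert (Ha' : forall n k, a n <= a (n + k)%nat).
  { intros n k; induction k; [rewrite Nat.add_0_r; lra|].
    rewrite Nat.add_succ_r. eapply Rle_trans; eauto. }
  assert (Hb' : forall n k, b (n + k)%nat <= b n).
  { intros n k; induction k; [rewrite Nat.add_0_r; lra|].
    rewrite Nat.add_succ_r. eapply Rle_trans; eauto. }
  assert (Hub : forall n m, a m <= b n).
  { intros n m. eapply Rle_trans; [apply (Ha' m n)|]. eapply Rle_trans; [apply Hab|].
    rewrite Nat.add_comm. apply Hb'. }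
  destruct (completeness (fun x => exists n, x = a n)) as [s [Hs1 Hs2]].
  - exists (b 0%nat). intros x [n ->]. apply Hub.
  - now exists (a 0%nat), 0%nat.
  - exists s. intros n. split; [apply Hs1; now exists n|].
    apply Hs2. intros x [m ->]. apply Hub.
Qed.

(** * Goursat's bisection for an additive function of rectangles *)

Section Goursat.
(** [F s1 s2 t1 t2] models an integral along the boundary of [s1, s2] x [t1, t2]. Additivity is the
    cancellation along common edges; [F_local] makes [F] little-o of the squared size, which beats
    the factor 4 lost at each bisection. *)
Variable F : R -> R -> R -> R -> C.
Hypothesis F_add1 : forall s1 s2 s3 t1 t2, F s1 s3 t1 t2 = (F s1 s2 t1 t2 + F s2 s3 t1 t2)%C.
Hypothesis F_add2 : forall s1 s2 t1 t2 t3, F s1 s2 t1 t3 = (F s1 s2 t1 t2 + F s1 s2 t2 t3)%C.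
Hypothesis F_local : forall s0 t0 eps, 0 < eps -> exists d, 0 < d /\
  forall s1 s2 t1 t2, s1 <= s0 <= s2 -> t1 <= t0 <= t2 -> s2 - s1 < d -> t2 - t1 < d ->
    Cmod (F s1 s2 t1 t2) <= eps * ((s2 - s1) + (t2 - t1)) ^ 2.

Let valF (q : (R * R) * (R * R)) := Cmod (F (fst (fst q)) (snd (fst q)) (fst (snd q)) (snd (snd q))).
Let sub (p p' : R * R) :=
  fst p <= fst p' /\ snd p' <= snd p /\ snd p' - fst p' = (snd p - fst p) / 2.
Let step q := epsilon (inhabits q)
  (fun q' => sub (fst q) (fst q') /\ sub (snd q) (snd q') /\ valF q <= 4 * valF q').

Lemma bisection_step_spec q : fst (fst q) <= snd (fst q) -> fst (snd q) <= snd (snd q) ->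
  sub (fst q) (fst (step q)) /\ sub (snd q) (snd (step q)) /\ valF q <= 4 * valF (step q).
Proof.
  intros H1 H2.
  refine (epsilon_spec (inhabits q) (fun q' => sub (fst q) (fst q') /\ sub (snd q) (snd q') /\ valF q <= 4 * valF q') _).
  destruct q as [[a b] [c d]]; unfold valF, sub in *; simpl in *.
  set (m := (a + b) / 2). set (n := (c + d) / 2).
  assert (E : F a b c d = (F a m c n + F m b c n + (F a m n d + F m b n d))%C).
  { now rewrite <- !F_add1, <- F_add2. }
  assert (T : Cmod (F a b c d) <= Cmod (F a m c n) + Cmod (F m b c n) + (Cmod (F a m n d) + Cmod (F m b n d))).
  { rewrite E. eapply Rle_trans; [apply Cmod_triangle|]. apply Rplus_le_compat; apply Cmod_triangle. }
  destruct (Rle_dec (Cmod (F a b c d)) (4 * Cmod (F a m c n))).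
  { exists ((a, m), (c, n)); simpl; unfold m, n in *; repeat split; lra. }
  destruct (Rle_dec (Cmod (F a b c d)) (4 * Cmod (F m b c n))).
  { exists ((m, b), (c, n)); simpl; unfold m, n in *; repeat split; lra. }
  destruct (Rle_dec (Cmod (F a b c d)) (4 * Cmod (F a m n d))).
  { exists ((a, m), (n, d)); simpl; unfold m, n in *; repeat split; lra. }
  (* If the other three quarters are too small, the triangle inequality leaves this one. *)
  exists ((m, b), (n, d)); simpl; unfold m, n in *; repeat split; lra.
Qed.

(** Nested quarters shrink to a point (s0, t0) while |F| on the n-th one stays at least 4^(-n) |F a
    b c d|; the local bound at that point allows at most half of this. *)
Lemma goursat a b c d : a <= b -> c <= d -> F a b c d = 0%C.
Proof.
  intros Hab Hcd. apply Cmod_eq_0. apply Rle_antisym; [|apply Cmod_ge_0].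
  set (q := fun n => Nat.iter n step ((a, b), (c, d))).
  assert (Hq : forall n, fst (fst (q n)) <= snd (fst (q n)) /\ fst (snd (q n)) <= snd (snd (q n)) /\
     snd (fst (q n)) - fst (fst (q n)) = (b - a) * (/ 2) ^ n /\
     snd (snd (q n)) - fst (snd (q n)) = (d - c) * (/ 2) ^ n /\
     Cmod (F a b c d) <= 4 ^ n * valF (q n)).
  { induction n as [|n [A1 [A2 [A3 [A4 A5]]]]].
    - simpl; unfold valF; simpl; repeat split; lra.
    - destruct (bisection_step_spec (q n) A1 A2) as [[B1 [B2 B3]] [[C1 [C2 C3]] D]].
      change (q (S n)) with (step (q n)).
      repeat split; try lra.
      + rewrite B3, A3. simpl. field.
      + rewrite C3, A4. simpl. field.
      + eapply Rle_trans; [exact A5|]. simpl.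
        rewrite (Rmult_comm 4), Rmult_assoc. apply Rmult_le_compat_l; [apply pow_le; lra|lra]. }
  assert (Hs : forall n, sub (fst (q n)) (fst (q (S n))) /\ sub (snd (q n)) (snd (q (S n)))).
  { intros n. destruct (Hq n) as [A1 [A2 _]].
    destruct (bisection_step_spec (q n) A1 A2) as [B1 [B2 _]]. now split. }
  destruct (nested_intervals (fun n => fst (fst (q n))) (fun n => snd (fst (q n)))) as [s0 Hs0].
  { intros n; apply (Hs n). } { intros n; apply (Hs n). } { intros n; apply (Hq n). }
  destruct (nested_intervals (fun n => fst (snd (q n))) (fun n => snd (snd (q n)))) as [t0 Ht0].
  { intros n; apply (Hs n). } { intros n; apply (Hs n). } { intros n; apply (Hq n). }
  apply Rnot_lt_le. intros HF.
  (* The summand 1 keeps [S0] positive for a degenerate rectangle. *)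
  set (S0 := (b - a) + (d - c) + 1). assert (HS0 : 0 < S0) by (unfold S0; lra).
  destruct (F_local s0 t0 (Cmod (F a b c d) / (2 * S0 ^ 2))) as [del [Hdel Hloc]].
  { apply Rdiv_lt_0_compat; auto. apply Rmult_lt_0_compat; [lra|now apply pow_lt]. }
  destruct (pow_lt_1_zero (/ 2)) with (y := del / S0) as [n Hn].
  { rewrite Rabs_pos_eq; lra. } { now apply Rdiv_lt_0_compat. }
  specialize (Hn n (Nat.le_refl n)).
  assert (Hp : 0 < (/ 2) ^ n) by (apply pow_lt; lra).
  rewrite Rabs_pos_eq in Hn by lra.
  assert (Hn2 : S0 * (/ 2) ^ n < del).
  { apply Rmult_lt_reg_r with (/ S0); [now apply Rinv_0_lt_compat|].
    replace (S0 * (/ 2) ^ n * / S0) with ((/ 2) ^ n) by (field; lra). exact Hn. }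
  destruct (Hq n) as [A1 [A2 [A3 [A4 A5]]]].
  assert (L := Hloc _ _ _ _ (Hs0 n) (Ht0 n)).
  rewrite A3, A4 in L.
  assert (X1 : (b - a) * (/ 2) ^ n <= S0 * (/ 2) ^ n) by (apply Rmult_le_compat_r; unfold S0; lra).
  assert (X2 : (d - c) * (/ 2) ^ n <= S0 * (/ 2) ^ n) by (apply Rmult_le_compat_r; unfold S0; lra).
  specialize (L ltac:(lra) ltac:(lra)).
  fold (valF (q n)) in L.
  assert (L2 : 4 ^ n * valF (q n) <= Cmod (F a b c d) / 2).
  { apply Rle_trans with (4 ^ n * (Cmod (F a b c d) / (2 * S0 ^ 2) * ((b - a) * (/ 2) ^ n + (d - c) * (/ 2) ^ n) ^ 2)).
    - apply Rmult_le_compat_l; [apply pow_le; lra|exact L].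
    - replace (((b - a) * (/ 2) ^ n + (d - c) * (/ 2) ^ n) ^ 2) with (((b - a) + (d - c)) ^ 2 * ((/ 2) ^ n * (/ 2) ^ n)) by ring.
      rewrite <- Rpow_mult_distr.
      replace (4 ^ n * (Cmod (F a b c d) / (2 * S0 ^ 2) * ((b - a + (d - c)) ^ 2 * (/ 2 * / 2) ^ n)))
        with ((4 ^ n * (/ 2 * / 2) ^ n) * (Cmod (F a b c d) / 2 * ((b - a + (d - c)) ^ 2 / S0 ^ 2))) by (field; lra).
      rewrite <- Rpow_mult_distr. replace (4 * (/ 2 * / 2)) with 1 by field. rewrite pow1, Rmult_1_l.
      rewrite <- (Rmult_1_r (Cmod (F a b c d) / 2)) at 2. apply Rmult_le_compat_l; [lra|].
      apply Rmult_le_reg_r with (S0 ^ 2); [now apply pow_lt|].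
      unfold Rdiv. rewrite Rmult_assoc, Rinv_l, Rmult_1_r, Rmult_1_l by (apply pow_nonzero; lra).
      apply pow_incr. unfold S0; lra. }
  lra.
Qed.
End Goursat.

(** * Cauchy's formula and Taylor expansion *)

Lemma is_RInt_pair (f : R -> C) a b l :
  is_RInt (fun t => fst (f t)) a b (fst l) -> is_RInt (fun t => snd (f t)) a b (snd l) ->
  is_RInt (V := C_R_NormedModule) f a b l.
Proof.
  intros H1 H2. rewrite (surjective_pairing l).
  now apply (is_RInt_fct_extend_pair (U := R_NormedModule) (V := R_NormedModule)).
Qed.

Lemma CRInt_mult c f a b : (forall x, RC_continuous f x) -> CRInt (fun x => c * f x)%C a b = (c * CRInt f a b)%C.
Proof.
  intros Hf. apply CRInt_unique. pose proof (CRInt_correct f a b Hf) as H.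
  pose proof (is_RInt_fct_extend_fst (U := R_NormedModule) (V := R_NormedModule) _ _ _ _ H) as H1.
  pose proof (is_RInt_fct_extend_snd (U := R_NormedModule) (V := R_NormedModule) _ _ _ _ H) as H2.
  apply is_RInt_pair; simpl.
  - apply (is_RInt_minus (V := R_NormedModule));
      apply (is_RInt_scal (V := R_NormedModule)); assumption.
  - apply (is_RInt_plus (V := R_NormedModule));
      apply (is_RInt_scal (V := R_NormedModule)); assumption.
Qed.

Definition cis (t : R) : C := (cos t, sin t).

Lemma Cmod_cis t : Cmod (cis t) = 1.
Proof.
  unfold Cmod, cis; simpl. replace (cos t * (cos t * 1) + sin t * (sin t * 1)) with 1; [apply sqrt_1|].
  pose proof (sin2_cos2 t); unfold Rsqr in *; lra.
Qed.

Lemma cis_lip x y : Cmod (cis y - cis x) <= 2 * Rabs (y - x).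
Proof.
  eapply Rle_trans; [apply Cmod_2Rmax|]. unfold cis; simpl.
  assert (Hs : sqrt 2 <= 2).
  { rewrite <- (sqrt_square 2) at 2 by lra. apply sqrt_le_1; lra. }
  apply Rmult_le_compat; auto using sqrt_pos.
  { eapply Rle_trans; [apply Rabs_pos|apply Rmax_l]. }
  apply Rmax_lub.
  - change (Rabs (cos y - cos x) <= Rabs (y - x)). rewrite <- (Rmult_1_l (Rabs (y - x))).
    apply (bounded_variation cos (fun t => - sin t)). intros t _. split; [auto_derive; auto; ring|].
    rewrite Rabs_Ropp. apply Rabs_le. pose proof (SIN_bound t); lra.
  - change (Rabs (sin y - sin x) <= Rabs (y - x)). rewrite <- (Rmult_1_l (Rabs (y - x))).
    apply (bounded_variation sin cos). intros t _. split; [auto_derive; auto; ring|].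
    apply Rabs_le. pose proof (COS_bound t); lra.
Qed.

Lemma RC_continuous_cis x : RC_continuous cis x.
Proof.
  apply RC_continuous_Cmod. intros eps He. exists (eps / 2). split; [lra|].
  intros y Hy. pose proof (cis_lip x y). lra.
Qed.

Lemma CRInt_cis a b : CRInt cis a b = (- Ci * (cis b - cis a))%C.
Proof.
  apply CRInt_unique. replace (- Ci * (cis b - cis a))%C with (sin b - sin a, - cos b - - cos a).
  2:{ unfold cis, Ci, Cmult, Cminus, Copp, Cplus; simpl. f_equal; ring. }
  apply is_RInt_pair; simpl.
  - apply (is_RInt_derive sin cos).
    + intros; auto_derive; auto; ring.
    + intros. apply continuity_pt_filterlim. apply continuity_cos.
  - apply (is_RInt_derive (fun x => - cos x) sin).
    + intros; auto_derive; auto; ring.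
    + intros. apply continuity_pt_filterlim. apply continuity_sin.
Qed.

Lemma RC_continuous_exp x : RC_continuous (fun s => RtoC (exp s)) x.
Proof.
  apply RC_continuous_Cmod. intros eps He.
  assert (H : continuous exp x).
  { apply continuity_pt_filterlim. apply derivable_continuous_pt, derivable_pt_exp. }
  destruct (proj1 (filterlim_locally exp (exp x)) H (mkposreal eps He)) as [d Hd].
  exists d; split; [apply cond_pos|]. intros y Hy.
  rewrite <- RtoC_minus, Cmod_R. exact (Hd y Hy).
Qed.

Lemma CRInt_exp a b : CRInt (fun s => RtoC (exp s)) a b = RtoC (exp b - exp a).
Proof.
  apply CRInt_unique. apply is_RInt_pair; simpl.
  - apply (is_RInt_derive exp exp).
    + intros; auto_derive; auto; ring.
    + intros. apply continuity_pt_filterlim. apply derivable_continuous_pt, derivable_pt_exp.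
  - refine (eq_rect _ (fun l => is_RInt (fun _ => 0) a b l)
      (is_RInt_const (V := R_NormedModule) a b 0) _ (Rmult_0_r (b - a))).
Qed.

Lemma CRInt_const c a b : CRInt (fun _ => c) a b = (RtoC (b - a) * c)%C.
Proof.
  apply CRInt_unique. apply is_RInt_pair; simpl.
  - rewrite Rmult_0_l, Rminus_0_r. apply (is_RInt_const (V := R_NormedModule)).
  - rewrite Rmult_0_l, Rplus_0_r. apply (is_RInt_const (V := R_NormedModule)).
Qed.

Lemma Cminus_eq_0_eq (x y : C) : (x - y)%C = 0%C -> x = y.
Proof. intros H. replace x with (x - y + y)%C by ring. rewrite H. ring. Qed.

(** * Cauchy's formula on circles contracting to an interior point *)

Section Cauchy.
Variables (z : C) (rho : R).
Hypothesis Hz : Cmod z < rho.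

(** At s = 0 this is the circle, and s -> -infinity contracts it to z. The exponential parameter is
    chosen because w - z = e^s (rho e^(it) - z) gives dw / (i (w - z)) = [cauchy_kernel t] dt - i
    ds: the angular kernel does not depend on s, and no singularity remains on the radial sides. *)
Definition homotopy (s t : R) : C := (z + exp s * (rho * cis t - z))%C.
Definition cauchy_kernel (t : R) : C := (rho * cis t / (rho * cis t - z))%C.

Let rho_pos : 0 < rho. Proof. pose proof (Cmod_ge_0 z); lra. Qed.

Lemma Cmod_rho_cis t : Cmod (rho * cis t) = rho.
Proof. rewrite Cmod_mult, Cmod_cis, Cmod_R, Rabs_pos_eq by lra. ring. Qed.

Lemma denominator_lower t : rho - Cmod z <= Cmod (rho * cis t - z).
Proof.
  pose proof (Cmod_triangle (rho * cis t - z) z) as H.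
  replace (rho * cis t - z + z)%C with (rho * cis t)%C in H by ring.
  rewrite Cmod_rho_cis in H. lra.
Qed.

Lemma denominator_neq_0 t : (rho * cis t - z)%C <> 0%C.
Proof. apply Cmod_gt_0. pose proof (denominator_lower t); lra. Qed.

Lemma denominator_upper t : Cmod (rho * cis t - z) <= 2 * rho.
Proof.
  unfold Cminus. eapply Rle_trans; [apply Cmod_triangle|]. rewrite Cmod_rho_cis, Cmod_opp. lra.
Qed.

Definition kernel_max : R := rho / (rho - Cmod z).

Lemma kernel_max_pos : 0 < kernel_max. Proof. apply Rdiv_lt_0_compat; lra. Qed.

Lemma cauchy_kernel_bound t : Cmod (cauchy_kernel t) <= kernel_max.
Proof.
  unfold cauchy_kernel, kernel_max. rewrite Cmod_div by apply denominator_neq_0. rewrite Cmod_rho_cis.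
  apply Rmult_le_compat_l; [lra|]. apply Rinv_le_contravar; [lra|apply denominator_lower].
Qed.

Lemma RC_continuous_rho_cis x : RC_continuous (fun t => rho * cis t)%C x.
Proof. apply RC_continuous_mult; [apply RC_continuous_const|apply RC_continuous_cis]. Qed.

Lemma cauchy_kernel_continuous x : RC_continuous cauchy_kernel x.
Proof.
  apply RC_continuous_mult; [apply RC_continuous_rho_cis|].
  apply (RC_continuous_comp Cinv (fun t => rho * cis t - z)%C); [|apply C_continuous_inv, denominator_neq_0].
  apply RC_continuous_minus; [apply RC_continuous_rho_cis|apply RC_continuous_const].
Qed.

Lemma homotopy_continuous_angle s x : RC_continuous (homotopy s) x.
Proof.
  apply RC_continuous_plus; [apply RC_continuous_const|]. apply RC_continuous_mult; [apply RC_continuous_const|].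
  apply RC_continuous_minus; [apply RC_continuous_rho_cis|apply RC_continuous_const].
Qed.

Lemma homotopy_continuous_radius t x : RC_continuous (fun s => homotopy s t) x.
Proof.
  apply RC_continuous_plus; [apply RC_continuous_const|]. apply RC_continuous_mult; [apply RC_continuous_exp|apply RC_continuous_const].
Qed.

Definition circle_part (f : C -> C) s t1 t2 : C := CRInt (fun t => f (homotopy s t) * cauchy_kernel t)%C t1 t2.
Definition radial_part (f : C -> C) t s1 s2 : C := CRInt (fun s => f (homotopy s t)) s1 s2.
(* The integral of the pullback of [f w dw / (i (w - z))] along the boundary of a rectangle. *)
Definition boundary_integral f s1 s2 t1 t2 : C :=
  (circle_part f s2 t1 t2 - circle_part f s1 t1 t2 + Ci * (radial_part f t2 s1 s2 - radial_part f t1 s1 s2))%C.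

Lemma circle_part_continuous f s : (forall w, C_continuous f w) -> forall x, RC_continuous (fun t => f (homotopy s t) * cauchy_kernel t)%C x.
Proof.
  intros Hf x. apply RC_continuous_mult; [|apply cauchy_kernel_continuous].
  apply (RC_continuous_comp f (homotopy s)); [apply homotopy_continuous_angle|apply Hf].
Qed.

Lemma radial_part_continuous f t : (forall w, C_continuous f w) -> forall x, RC_continuous (fun s => f (homotopy s t)) x.
Proof. intros Hf x. apply (RC_continuous_comp f (fun s => homotopy s t)); [apply homotopy_continuous_radius|apply Hf]. Qed.

(** The kernel times rho e^(it) - z is rho e^(it), so only integrals of the kernel, [cis] and [exp]
    occur. The integral of the kernel, still unknown here, cancels between the two circular
    sides. *)
Lemma boundary_integral_affine c0 c1 s1 s2 t1 t2 : boundary_integral (fun w => c0 + c1 * w)%C s1 s2 t1 t2 = 0%C.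
Proof.
  assert (EA : forall s, circle_part (fun w => c0 + c1 * w)%C s t1 t2 =
     ((c0 + c1 * z) * CRInt cauchy_kernel t1 t2 + c1 * exp s * rho * (- Ci * (cis t2 - cis t1)))%C).
  { intros s. unfold circle_part.
    rewrite <- CRInt_cis, <- (CRInt_mult _ cauchy_kernel), <- (CRInt_mult _ cis), <- CRInt_plus.
    - apply CRInt_ext. intros t. unfold homotopy, cauchy_kernel. field. apply denominator_neq_0.
    - intros; apply RC_continuous_mult; [apply RC_continuous_const|apply cauchy_kernel_continuous].
    - intros; apply RC_continuous_mult; [apply RC_continuous_const|apply RC_continuous_cis].
    - apply RC_continuous_cis.
    - apply cauchy_kernel_continuous. }
  assert (EB : forall t, radial_part (fun w => c0 + c1 * w)%C t s1 s2 =
     (RtoC (s2 - s1) * (c0 + c1 * z) + c1 * (rho * cis t - z) * RtoC (exp s2 - exp s1))%C).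
  { intros t. unfold radial_part. rewrite <- CRInt_const, <- CRInt_exp, <- CRInt_mult, <- CRInt_plus.
    - apply CRInt_ext. intros s. unfold homotopy. ring.
    - intros; apply RC_continuous_const.
    - intros; apply RC_continuous_mult; [apply RC_continuous_const|apply RC_continuous_exp].
    - apply RC_continuous_exp. }
  unfold boundary_integral. rewrite !EA, !EB, !RtoC_minus. ring.
Qed.

Lemma boundary_integral_minus f g s1 s2 t1 t2 : (forall w, C_continuous f w) -> (forall w, C_continuous g w) ->
  boundary_integral (fun w => f w - g w)%C s1 s2 t1 t2 = (boundary_integral f s1 s2 t1 t2 - boundary_integral g s1 s2 t1 t2)%C.
Proof.
  intros Hf Hg.
  assert (EA : forall s, circle_part (fun w => f w - g w)%C s t1 t2 = (circle_part f s t1 t2 - circle_part g s t1 t2)%C).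
  { intros s. unfold circle_part. rewrite <- CRInt_minus by now apply circle_part_continuous.
    apply CRInt_ext. intros; ring. }
  assert (EB : forall t, radial_part (fun w => f w - g w)%C t s1 s2 = (radial_part f t s1 s2 - radial_part g t s1 s2)%C).
  { intros t. unfold radial_part. now rewrite <- CRInt_minus by now apply radial_part_continuous. }
  unfold boundary_integral. rewrite !EA, !EB. ring.
Qed.

Lemma exp_lip s s0 : Rabs (s - s0) <= 1 -> Rabs (exp s - exp s0) <= exp (s0 + 1) * Rabs (s - s0).
Proof.
  intros H. apply (bounded_variation exp exp). intros t Ht. split; [auto_derive; auto; ring|].
  rewrite Rabs_pos_eq by (left; apply exp_pos).
  assert (t <= s0 + 1) by (pose proof (Rle_abs (t - s0)); lra).
  destruct (Req_dec t (s0 + 1)) as [->|]; [lra|]. left; apply exp_increasing; lra.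
Qed.

Lemma homotopy_lip s0 t0 s t : Rabs (s - s0) <= 1 ->
  Cmod (homotopy s t - homotopy s0 t0) <= 2 * rho * exp (s0 + 1) * (Rabs (s - s0) + Rabs (t - t0)).
Proof.
  intros H.
  replace (homotopy s t - homotopy s0 t0)%C with
    (RtoC (exp s - exp s0) * (rho * cis t - z) + (exp s0 * rho) * (cis t - cis t0))%C
    by (unfold homotopy; rewrite RtoC_minus; ring).
  eapply Rle_trans; [apply Cmod_triangle|]. rewrite !Cmod_mult, !Cmod_R.
  rewrite (Rabs_pos_eq rho) by lra. rewrite (Rabs_pos_eq (exp s0)) by (left; apply exp_pos).
  pose proof (exp_lip s s0 H). pose proof (cis_lip t0 t).
  assert (He : exp s0 <= exp (s0 + 1)) by (left; apply exp_increasing; lra).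
  pose proof (exp_pos s0). pose proof (exp_pos (s0 + 1)).
  pose proof (Rabs_pos (s - s0)). pose proof (Rabs_pos (t - t0)).
  assert (Rabs (exp s - exp s0) * Cmod (rho * cis t - z) <= exp (s0 + 1) * Rabs (s - s0) * (2 * rho)).
  { apply Rmult_le_compat; auto using Rabs_pos, Cmod_ge_0, denominator_upper. }
  assert (exp s0 * rho * Cmod (cis t - cis t0) <= exp (s0 + 1) * rho * (2 * Rabs (t - t0))).
  { apply Rmult_le_compat; auto using Cmod_ge_0.
    - apply Rmult_le_pos; lra.
    - apply Rmult_le_compat_r; lra. }
  lra.
Qed.

Lemma C_continuous_affine c0 c1 w : C_continuous (fun w => c0 + c1 * w)%C w.
Proof.
  intros eps He. assert (Hp : 0 < Cmod c1 + 1) by (pose proof (Cmod_ge_0 c1); lra).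
  exists (eps / (Cmod c1 + 1)). split; [now apply Rdiv_lt_0_compat|].
  intros y Hy. replace (c0 + c1 * y - (c0 + c1 * w))%C with (c1 * (y - w))%C by ring.
  rewrite Cmod_mult. apply Rle_lt_trans with ((Cmod c1 + 1) * Cmod (y - w)).
  - apply Rmult_le_compat_r; [apply Cmod_ge_0|lra].
  - apply Rmult_lt_reg_r with (/ (Cmod c1 + 1)); [now apply Rinv_0_lt_compat|].
    replace ((Cmod c1 + 1) * Cmod (y - w) * / (Cmod c1 + 1)) with (Cmod (y - w)) by (field; lra). exact Hy.
Qed.

Lemma C_continuous_minus f g w : C_continuous f w -> C_continuous g w -> C_continuous (fun w => f w - g w)%C w.
Proof.
  intros Hf Hg eps He. destruct (Hf (eps / 2)) as [d1 [Hd1 H1]]; [lra|].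
  destruct (Hg (eps / 2)) as [d2 [Hd2 H2]]; [lra|].
  exists (Rmin d1 d2). split; [now apply Rmin_glb_lt|]. intros y Hy.
  specialize (H1 y (Rlt_le_trans _ _ _ Hy (Rmin_l _ _))).
  specialize (H2 y (Rlt_le_trans _ _ _ Hy (Rmin_r _ _))).
  replace (f y - g y - (f w - g w))%C with ((f y - f w) + - (g y - g w))%C by ring.
  eapply Rle_lt_trans; [apply Cmod_triangle|]. rewrite Cmod_opp. lra.
Qed.

(** The tangent affine map at [w0] contributes nothing, so [f] may be replaced by its first-order
    remainder, at most [eps' * (Lam * D)] on the rectangle. The side lengths supply the second
    factor [D]. *)
Lemma boundary_integral_local f : entire f -> forall s0 t0 eps, 0 < eps -> exists d, 0 < d /\
  forall s1 s2 t1 t2, s1 <= s0 <= s2 -> t1 <= t0 <= t2 -> s2 - s1 < d -> t2 - t1 < d ->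
    Cmod (boundary_integral f s1 s2 t1 t2) <= eps * ((s2 - s1) + (t2 - t1)) ^ 2.
Proof.
  intros Hf s0 t0 eps He. set (w0 := homotopy s0 t0).
  destruct (Hf w0) as [l Hl].
  set (Lam := 2 * rho * exp (s0 + 1)).
  assert (HLam : 0 < Lam) by (unfold Lam; pose proof (exp_pos (s0 + 1)); apply Rmult_lt_0_compat; lra).
  pose proof kernel_max_pos as Hk.
  (* Chosen so that the four sides together give exactly eps D^2. *)
  set (eps' := eps / (2 * Lam * (1 + kernel_max))).
  assert (He' : 0 < eps').
  { apply Rdiv_lt_0_compat; auto. apply Rmult_lt_0_compat; lra. }
  destruct (proj1 (is_derive_Cmod f w0 l) Hl eps' He') as [d [Hd H1]].
  (* The bound 1/2 allows [homotopy_lip]; the other keeps the image of the rectangle within distance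
     [d] of [w0]. *)
  exists (Rmin (1 / 2) (d / (2 * Lam))). split.
  { apply Rmin_glb_lt; [lra|]. apply Rdiv_lt_0_compat; lra. }
  intros s1 s2 t1 t2 Hs Ht Hds Hdt.
  assert (Hds1 := Rlt_le_trans _ _ _ Hds (Rmin_l _ _)).
  assert (Hds2 := Rlt_le_trans _ _ _ Hds (Rmin_r _ _)).
  assert (Hdt2 := Rlt_le_trans _ _ _ Hdt (Rmin_r _ _)).
  set (D := (s2 - s1) + (t2 - t1)).
  assert (HD : 0 <= D) by (unfold D; lra).
  assert (HDd : Lam * D < d).
  { apply Rlt_le_trans with (Lam * (2 * (d / (2 * Lam)))).
    - apply Rmult_lt_compat_l; [lra|unfold D; lra].
    - right; field; lra. }
  set (aff := fun w => ((f w0 - l * w0) + l * w)%C).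
  set (g := fun w => (f w - aff w)%C).
  assert (Cg : forall w, C_continuous g w).
  { intros w. apply C_continuous_minus; [now apply C_continuous_entire|apply C_continuous_affine]. }
  assert (E : boundary_integral f s1 s2 t1 t2 = boundary_integral g s1 s2 t1 t2).
  { unfold g. rewrite boundary_integral_minus.
    - unfold aff. rewrite boundary_integral_affine. ring.
    - now apply C_continuous_entire.
    - apply C_continuous_affine. }
  assert (Hg : forall s t, s1 <= s <= s2 -> t1 <= t <= t2 -> Cmod (g (homotopy s t)) <= eps' * (Lam * D)).
  { intros s t Hs' Ht'.
    assert (Hsa : Rabs (s - s0) <= s2 - s1) by (apply Rabs_le; lra).
    assert (Hta : Rabs (t - t0) <= t2 - t1) by (apply Rabs_le; lra).
    assert (Hl1 := homotopy_lip s0 t0 s t ltac:(lra)). fold Lam w0 in Hl1.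
    assert (Hl2 : Lam * (Rabs (s - s0) + Rabs (t - t0)) <= Lam * D).
    { apply Rmult_le_compat_l; unfold D; lra. }
    specialize (H1 (homotopy s t) ltac:(lra)).
    replace (g (homotopy s t)) with (f (homotopy s t) - f w0 - (homotopy s t - w0) * l)%C by (unfold g, aff; ring).
    eapply Rle_trans; [exact H1|]. apply Rmult_le_compat_l; lra. }
  assert (Hm : 0 <= eps' * (Lam * D)) by (apply Rmult_le_pos; [lra|apply Rmult_le_pos; lra]).
  assert (HA : forall s, s1 <= s <= s2 -> Cmod (circle_part g s t1 t2) <= (t2 - t1) * (eps' * (Lam * D) * kernel_max)).
  { intros s Hs'. apply CRInt_bound; [lra|now apply circle_part_continuous|]. intros t Ht'. rewrite Cmod_mult.
    apply Rmult_le_compat; auto using Cmod_ge_0, cauchy_kernel_bound. }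
  assert (HB : forall t, t1 <= t <= t2 -> Cmod (radial_part g t s1 s2) <= (s2 - s1) * (eps' * (Lam * D))).
  { intros t Ht'. apply CRInt_bound; [lra|now apply radial_part_continuous|]. auto. }
  rewrite E. unfold boundary_integral.
  eapply Rle_trans; [apply Cmod_triangle|]. rewrite Cmod_mult, Cmod_Ci, Rmult_1_l.
  unfold Cminus.
  pose proof (Cmod_triangle (circle_part g s2 t1 t2) (- circle_part g s1 t1 t2)) as T1.
  pose proof (Cmod_triangle (radial_part g t2 s1 s2) (- radial_part g t1 s1 s2)) as T2.
  rewrite Cmod_opp in T1, T2.
  pose proof (HA s1 ltac:(lra)). pose proof (HA s2 ltac:(lra)).
  pose proof (HB t1 ltac:(lra)). pose proof (HB t2 ltac:(lra)).
  apply Rle_trans with (2 * (D * (eps' * (Lam * D) * (1 + kernel_max)))).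
  - assert ((t2 - t1) * (eps' * (Lam * D) * kernel_max) + (s2 - s1) * (eps' * (Lam * D)) <= D * (eps' * (Lam * D) * (1 + kernel_max))).
    { generalize dependent (eps' * (Lam * D)). intros X **.
      assert (0 <= (t2 - t1) * X) by (apply Rmult_le_pos; lra).
      assert (0 <= (s2 - s1) * (X * kernel_max)) by (apply Rmult_le_pos; [lra|apply Rmult_le_pos; lra]).
      unfold D; nra. }
    lra.
  - right. unfold eps'. fold D. field. lra.
Qed.

Lemma boundary_integral_zero f s1 s2 t1 t2 : entire f -> s1 <= s2 -> t1 <= t2 -> boundary_integral f s1 s2 t1 t2 = 0%C.
Proof.
  intros Hf. pose proof (C_continuous_entire f Hf) as Cf. apply (goursat (boundary_integral f)).
  - intros a b c u v. unfold boundary_integral, radial_part. rewrite <- (CRInt_Chasles (fun s => f (homotopy s v)) a b c) by now apply radial_part_continuous.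
    rewrite <- (CRInt_Chasles (fun s => f (homotopy s u)) a b c) by now apply radial_part_continuous. ring.
  - intros a b u v w. unfold boundary_integral, circle_part.
    rewrite <- (CRInt_Chasles (fun t => f (homotopy b t) * cauchy_kernel t)%C u v w) by now apply circle_part_continuous.
    rewrite <- (CRInt_Chasles (fun t => f (homotopy a t) * cauchy_kernel t)%C u v w) by now apply circle_part_continuous. ring.
  - now apply boundary_integral_local.
Qed.

Lemma cis_2PI : cis (2 * PI) = cis 0.
Proof. unfold cis. now rewrite cos_2PI, sin_2PI, cos_0, sin_0. Qed.

(** On [s, 0] x [0, 2 PI] the radial sides agree by periodicity, so the circular integral does not
    depend on s <= 0. As s -> -infinity, continuity of f at z turns it into f(z) times the integral
    of the kernel, whose value is found separately. *)
Lemma integral_cauchy_kernel f : entire f ->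
  CRInt (fun t => f (rho * cis t) * cauchy_kernel t)%C 0 (2 * PI) = (f z * CRInt cauchy_kernel 0 (2 * PI))%C.
Proof.
  intros Hf. pose proof (C_continuous_entire f Hf) as Cf. pose proof PI_RGT_0 as HPI.
  assert (E0 : CRInt (fun t => f (rho * cis t) * cauchy_kernel t)%C 0 (2 * PI) = circle_part f 0 0 (2 * PI)).
  { apply CRInt_ext. intros t. unfold homotopy. rewrite exp_0. do 2 f_equal. ring. }
  rewrite E0.
  assert (Es : forall s, s <= 0 -> circle_part f 0 0 (2 * PI) = circle_part f s 0 (2 * PI)).
  { intros s Hs. pose proof (boundary_integral_zero f s 0 0 (2 * PI) Hf Hs ltac:(lra)) as H. unfold boundary_integral in H.
    assert (EB : radial_part f (2 * PI) s 0 = radial_part f 0 s 0).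
    { apply CRInt_ext. intros x. unfold homotopy. now rewrite cis_2PI. }
    rewrite EB in H. replace (circle_part f 0 0 (2 * PI)) with (circle_part f s 0 (2 * PI) + (circle_part f 0 0 (2 * PI) - circle_part f s 0 (2 * PI) + Ci * (radial_part f 0 s 0 - radial_part f 0 s 0)))%C by ring.
    rewrite H. ring. }
  apply Cminus_eq_0_eq.
  apply Cmod_eq_0. apply Rle_antisym; [|apply Cmod_ge_0]. apply Rle_plus_epsilon. intros eps He.
  pose proof kernel_max_pos as Hk.
  assert (Hp : 0 < 2 * PI * kernel_max) by (apply Rmult_lt_0_compat; lra).
  destruct (Cf z (eps / (2 * PI * kernel_max))) as [d [Hd H1]]; [now apply Rdiv_lt_0_compat|].
  (* Then e^s times the maximal distance 2 rho is at most d / 2. *)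
  set (s := Rmin 0 (ln (d / (4 * rho)))).
  assert (Hs : s <= 0) by apply Rmin_l.
  assert (Hes : exp s <= d / (4 * rho)).
  { rewrite <- (exp_ln (d / (4 * rho))) by (apply Rdiv_lt_0_compat; lra).
    destruct (Rmin_r 0 (ln (d / (4 * rho)))) as [X|X]; fold s in X.
    - left; now apply exp_increasing.
    - rewrite X; lra. }
  rewrite (Es s Hs). unfold circle_part. rewrite <- CRInt_mult by apply cauchy_kernel_continuous.
  rewrite <- CRInt_minus.
  - replace (0 + eps) with ((2 * PI - 0) * (eps / (2 * PI * kernel_max) * kernel_max)) by (field; lra).
    apply CRInt_bound; [lra| |].
    + intros x. apply RC_continuous_minus; [now apply circle_part_continuous|]. apply RC_continuous_mult; [apply RC_continuous_const|apply cauchy_kernel_continuous].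
    + intros t _. replace (f (homotopy s t) * cauchy_kernel t - f z * cauchy_kernel t)%C with ((f (homotopy s t) - f z) * cauchy_kernel t)%C by ring.
      rewrite Cmod_mult. apply Rmult_le_compat; auto using Cmod_ge_0, cauchy_kernel_bound.
      left. apply H1. unfold homotopy. replace (z + exp s * (rho * cis t - z) - z)%C with (exp s * (rho * cis t - z))%C by ring.
      rewrite Cmod_mult, Cmod_R, Rabs_pos_eq by (left; apply exp_pos).
      apply Rle_lt_trans with (d / (4 * rho) * (2 * rho)).
      * apply Rmult_le_compat; auto using Cmod_ge_0, denominator_upper. left; apply exp_pos.
      * replace (d / (4 * rho) * (2 * rho)) with (d / 2) by (field; lra). lra.
  - now apply circle_part_continuous.
  - intros x. apply RC_continuous_mult; [apply RC_continuous_const|apply cauchy_kernel_continuous].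
Qed.

(** The index runs over k < n, so the empty sum is available for inductions; [sum_n a n] is
    [Csum a (S n)]. *)
Fixpoint Csum (a : nat -> C) (n : nat) : C :=
  match n with O => 0%C | S k => (Csum a k + a k)%C end.

(** With q = z e^(-it) / rho the kernel is 1 / (1 - q); this is its geometric expansion with the
    exact remainder q^N / (1 - q). *)
Lemma cauchy_kernel_geometric (N : nat) t :
  cauchy_kernel t = (Csum (fun n => (z / rho) ^ n * cis (- (INR n * t))) N + (z / rho) ^ N * cis (- (INR N * t)) * cauchy_kernel t)%C.
Proof.
  induction N as [|N IH].
  - simpl Csum. rewrite Rmult_0_l, Ropp_0. unfold cis at 1. rewrite cos_0, sin_0.
    change (1, 0) with (RtoC 1). simpl Cpow. ring.
  - rewrite IH at 1. simpl Csum. rewrite <- Cplus_assoc. f_equal.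
    assert (E : (cis (- (INR N * t)) = cis (- (INR (S N) * t)) * cis t)%C).
    { rewrite S_INR. replace (- (INR N * t)) with (- ((INR N + 1) * t) + t) by ring.
      unfold cis, Cmult; simpl. now rewrite cos_plus, sin_plus, (Rplus_comm (cos _ * sin t)), (Rplus_comm (sin _ * cos t)). }
    rewrite E. simpl Cpow. unfold cauchy_kernel. field. split; [apply denominator_neq_0|].
    intros H. apply RtoC_inj in H. lra.
Qed.

Lemma RC_continuous_cis_scaled (n : nat) x : RC_continuous (fun t => cis (- (INR n * t))) x.
Proof.
  apply RC_continuous_Cmod. intros eps He. pose proof (pos_INR n).
  exists (eps / (2 * (INR n + 1))). split; [apply Rdiv_lt_0_compat; lra|].
  intros y Hy. eapply Rle_lt_trans; [apply cis_lip|].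
  replace (- (INR n * y) - - (INR n * x)) with (- INR n * (y - x)) by ring.
  rewrite Rabs_mult, Rabs_Ropp, (Rabs_pos_eq (INR n)) by lra.
  apply Rle_lt_trans with (2 * ((INR n + 1) * Rabs (y - x))).
  - apply Rmult_le_compat_l; [lra|]. apply Rmult_le_compat_r; [apply Rabs_pos|lra].
  - replace eps with (2 * ((INR n + 1) * (eps / (2 * (INR n + 1))))) by (field; lra).
    apply Rmult_lt_compat_l; [lra|]. apply Rmult_lt_compat_l; lra.
Qed.

(** Not normalised by 1 / (2 PI). The frequencies n >= 0 are those produced by the geometric
    expansion of the kernel. *)
Definition fourier (g : R -> C) (n : nat) : C := CRInt (fun t => g t * cis (- (INR n * t)))%C 0 (2 * PI).

Lemma fourier_bound g n M : (forall x, RC_continuous g x) -> (forall t, Cmod (g t) <= M) ->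
  Cmod (fourier g n) <= 2 * PI * M.
Proof.
  intros Hg HM. replace (2 * PI * M) with ((2 * PI - 0) * M) by ring.
  pose proof PI_RGT_0. apply CRInt_bound; [lra| |].
  - intros x. apply RC_continuous_mult; [apply Hg|apply RC_continuous_cis_scaled].
  - intros t _. rewrite Cmod_mult, Cmod_cis, Rmult_1_r. apply HM.
Qed.

Lemma Csum_sum_n a n : sum_n a n = Csum a (S n).
Proof.
  induction n as [|n IH].
  - rewrite sum_O. symmetry. apply Cplus_0_l.
  - rewrite sum_Sn, IH. reflexivity.
Qed.

(** The finite geometric expansion is integrated term by term, and the remainder is at most 2 PI M
    [kernel_max] (|z| / rho)^N. The function [g] is general because the lemma serves both f on the
    circle and the constant 1. *)
Lemma integral_cauchy_kernel_series g M : (forall x, RC_continuous g x) -> (forall t, Cmod (g t) <= M) ->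
  is_series (V := C_NormedModule) (fun n => (z / rho) ^ n * fourier g n)%C
    (CRInt (fun t => g t * cauchy_kernel t)%C 0 (2 * PI)).
Proof.
  intros Hg HM. apply is_series_Cmod. intros eps He. pose proof PI_RGT_0 as HPI.
  assert (HM0 : 0 <= M) by (eapply Rle_trans; [apply Cmod_ge_0|apply (HM 0)]).
  pose proof kernel_max_pos as Hk.
  assert (Hq : Cmod (z / rho) = Cmod z / rho).
  { rewrite Cmod_div by (intros H; apply RtoC_inj in H; lra). rewrite Cmod_R, Rabs_pos_eq; lra. }
  assert (Hq0 : 0 <= Cmod z / rho) by (rewrite <- Hq; apply Cmod_ge_0).
  assert (Hq1 : Cmod z / rho < 1).
  { apply Rmult_lt_reg_r with rho; auto. unfold Rdiv. rewrite Rmult_assoc, Rinv_l by lra. lra. }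
  (* M + 1 in place of M, since M may be 0 and this number is a divisor. *)
  assert (Hp : 0 < 2 * PI * (M + 1) * kernel_max).
  { apply Rmult_lt_0_compat; [|exact Hk]. apply Rmult_lt_0_compat; lra. }
  destruct (pow_lt_1_zero (Cmod z / rho)) with (y := eps / (2 * PI * (M + 1) * kernel_max)) as [N HN].
  { rewrite Rabs_pos_eq; auto. } { now apply Rdiv_lt_0_compat. }
  exists N. intros n Hn. rewrite Csum_sum_n.
  assert (E : forall m, CRInt (fun t => g t * cauchy_kernel t)%C 0 (2 * PI) =
    (Csum (fun n => (z / rho) ^ n * fourier g n) m +
     (z / rho) ^ m * CRInt (fun t => g t * cis (- (INR m * t)) * cauchy_kernel t) 0 (2 * PI))%C).
  { assert (E1 : forall m, (forall x, RC_continuous (fun t => Csum (fun n => (z / rho) ^ n * (g t * cis (- (INR n * t)))) m)%C x) /\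
       CRInt (fun t => Csum (fun n => (z / rho) ^ n * (g t * cis (- (INR n * t)))) m)%C 0 (2 * PI) =
       Csum (fun n => (z / rho) ^ n * fourier g n)%C m).
    { induction m as [|m [IH1 IH2]]; simpl Csum.
      - split; [intros; apply RC_continuous_const|]. rewrite CRInt_const. ring.
      - assert (C1 : forall x, RC_continuous (fun t => g t * cis (- (INR m * t)))%C x)
          by (intros; apply RC_continuous_mult; [apply Hg|apply RC_continuous_cis_scaled]).
        split.
        + intros x. apply RC_continuous_plus; [apply IH1|]. apply RC_continuous_mult; [apply RC_continuous_const|apply C1].
        + rewrite CRInt_plus, IH2, CRInt_mult; auto. intros x. apply RC_continuous_mult; [apply RC_continuous_const|apply C1]. }
    intros m. destruct (E1 m) as [C1 E2]. rewrite <- E2.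
    assert (C2 : forall x, RC_continuous (fun t => g t * cis (- (INR m * t)) * cauchy_kernel t)%C x)
      by (intros; apply RC_continuous_mult; [apply RC_continuous_mult; [apply Hg|apply RC_continuous_cis_scaled]|apply cauchy_kernel_continuous]).
    rewrite <- CRInt_mult, <- CRInt_plus; auto.
    - apply CRInt_ext. intros t. rewrite (cauchy_kernel_geometric m t) at 1.
      assert (E3 : forall k, (Csum (fun n => (z / rho) ^ n * (g t * cis (- (INR n * t)))) k =
         g t * Csum (fun n => (z / rho) ^ n * cis (- (INR n * t))) k)%C).
      { induction k as [|k IH]; simpl Csum; [ring|]. rewrite IH; ring. }
      rewrite E3. ring.
    - intros x. apply RC_continuous_mult; [apply RC_continuous_const|apply C2]. }
  rewrite (E (S n)).
  match goal with |- Cmod (?x - (?x + ?y)) < _ => replace (x - (x + y))%C with (- y)%C by ring end.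
  rewrite Cmod_opp, Cmod_mult, Cmod_pow, Hq.
  specialize (HN (S n) ltac:(lia)). rewrite Rabs_pos_eq in HN by now apply pow_le.
  assert (B : Cmod (CRInt (fun t => g t * cis (- (INR (S n) * t)) * cauchy_kernel t)%C 0 (2 * PI)) <= (2 * PI - 0) * (M * kernel_max)).
  { apply CRInt_bound; [lra| |].
    - intros x. apply RC_continuous_mult; [apply RC_continuous_mult; [apply Hg|apply RC_continuous_cis_scaled]|apply cauchy_kernel_continuous].
    - intros t _. rewrite !Cmod_mult, Cmod_cis, Rmult_1_r.
      apply Rmult_le_compat; auto using Cmod_ge_0, cauchy_kernel_bound. }
  apply Rle_lt_trans with ((Cmod z / rho) ^ S n * (2 * PI * (M + 1) * kernel_max)).
  - apply Rmult_le_compat_l; [now apply pow_le|]. eapply Rle_trans; [exact B|].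
    replace ((2 * PI - 0) * (M * kernel_max)) with (2 * PI * kernel_max * M) by ring.
    replace (2 * PI * (M + 1) * kernel_max) with (2 * PI * kernel_max * (M + 1)) by ring.
    apply Rmult_le_compat_l; [|lra]. apply Rmult_le_pos; lra.
  - replace eps with (eps / (2 * PI * (M + 1) * kernel_max) * (2 * PI * (M + 1) * kernel_max)) by (field; lra).
    apply Rmult_lt_compat_r; auto.
Qed.

End Cauchy.

Lemma is_Cseries_unique (a : nat -> C) l l' :
  is_series (V := C_NormedModule) a l -> is_series (V := C_NormedModule) a l' -> l = l'.
Proof.
  intros H H'.
  exact (filterlim_locally_unique (K := C_AbsRing) (V := C_NormedModule) (F := eventually) _ _ _ H H').
Qed.

Lemma fourier_one (n : nat) : fourier (fun _ => RtoC 1) n = match n with O => RtoC (2 * PI) | S _ => 0%C end.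
Proof.
  unfold fourier. transitivity (CRInt (fun t => cis (- (INR n * t))) 0 (2 * PI)).
  { apply CRInt_ext; intros; ring. }
  destruct n as [|n].
  - transitivity (CRInt (fun _ => RtoC 1) 0 (2 * PI)).
    + apply CRInt_ext. intros t. unfold cis. simpl. now rewrite Rmult_0_l, Ropp_0, cos_0, sin_0.
    + rewrite CRInt_const, Rminus_0_r. ring.
  - assert (Hn : INR (S n) <> 0) by now apply not_0_INR.
    assert (Es : sin (INR (S n) * (2 * PI)) = 0).
    { replace (INR (S n) * (2 * PI)) with (0 + 2 * INR (S n) * PI) by ring. rewrite sin_period. apply sin_0. }
    assert (Ec : cos (INR (S n) * (2 * PI)) = 1).
    { replace (INR (S n) * (2 * PI)) with (0 + 2 * INR (S n) * PI) by ring. rewrite cos_period. apply cos_0. }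
    apply CRInt_unique. revert Hn Es Ec. generalize (INR (S n)). intros m Hn Es Ec.
    replace (RtoC 0) with (sin (m * (2 * PI)) / m - sin (m * 0) / m,
      cos (m * (2 * PI)) / m - cos (m * 0) / m).
    2:{ rewrite Es, Ec, Rmult_0_r, sin_0, cos_0. unfold RtoC. f_equal; unfold Rdiv; ring. }
    apply is_RInt_pair; unfold cis; simpl fst; simpl snd.
    + apply (is_RInt_derive (fun t => sin (m * t) / m) (fun t => cos (- (m * t)))).
      * intros; rewrite cos_neg. auto_derive; auto. field; auto.
      * intros. apply (ex_derive_continuous (V := R_NormedModule)). auto_derive; auto.
    + apply (is_RInt_derive (fun t => cos (m * t) / m) (fun t => sin (- (m * t)))).
      * intros; rewrite sin_neg. auto_derive; auto. field; auto.
      * intros. apply (ex_derive_continuous (V := R_NormedModule)). auto_derive; auto.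
Qed.

Lemma is_Cseries_head (a : nat -> C) : (forall n, a (S n) = 0%C) -> is_series (V := C_NormedModule) a (a 0%nat).
Proof.
  intros H. apply is_series_Cmod. intros eps He. exists 0%nat. intros n _.
  assert (E : Csum a (S n) = a 0%nat).
  { induction n as [|n IH]; [simpl; ring|]. simpl Csum in *. rewrite IH, H. ring. }
  rewrite Csum_sum_n, E. replace (a 0%nat - a 0%nat)%C with (RtoC 0) by ring. now rewrite Cmod_0.
Qed.

(** In the series for g = 1 all Fourier coefficients but the zeroth vanish; no primitive of the
    kernel is involved. *)
Lemma CRInt_cauchy_kernel z rho : Cmod z < rho -> CRInt (cauchy_kernel z rho) 0 (2 * PI) = RtoC (2 * PI).
Proof.
  intros Hz. pose proof (integral_cauchy_kernel_series z rho Hz (fun _ => RtoC 1) 1) as H.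
  assert (E : CRInt (fun t => 1 * cauchy_kernel z rho t)%C 0 (2 * PI) = CRInt (cauchy_kernel z rho) 0 (2 * PI))
    by (apply CRInt_ext; intros; ring).
  cbv beta in H. rewrite E in H.
  refine (is_Cseries_unique _ _ _ (H _ _) _).
  - intros; apply RC_continuous_const.
  - intros; rewrite Cmod_1; lra.
  - set (a := fun n => ((z / rho) ^ n * fourier (fun _ => RtoC 1) n)%C).
    replace (RtoC (2 * PI)) with (a 0%nat) by (unfold a; rewrite fourier_one; simpl; ring).
    apply is_Cseries_head. intros n. unfold a. rewrite fourier_one. ring.
Qed.

(** Continuity bounds the function for t in [-PI, PI], and periodicity of [cis] carries the bound to
    every t. *)
Lemma circle_bound f rho : entire f -> exists M, 0 < M /\ forall t, Cmod (f (rho * cis t)%C) <= M.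
Proof.
  intros Hf.
  assert (Hc : forall x, RC_continuous (fun t => f (rho * cis t)%C) x).
  { intros x. apply (RC_continuous_comp f (fun t => rho * cis t)%C); [|now apply C_continuous_entire].
    apply RC_continuous_mult; [apply RC_continuous_const|apply RC_continuous_cis]. }
  destruct (bounded_continuity (V := C_R_NormedModule) (fun t => f (rho * cis t)%C) (-PI) PI) as [M HM].
  { intros x _. apply Hc. }
  exists (Rmax M 1). split; [apply Rlt_le_trans with 1; [lra|apply Rmax_r]|].
  intros t.
  assert (HP : exists k : Z, -PI <= t - IZR k * (2 * PI) <= PI).
  { pose proof PI_RGT_0. exists (up ((t - PI) / (2 * PI))).
    destruct (archimed ((t - PI) / (2 * PI))) as [A B].
    assert (E : t - PI = (t - PI) / (2 * PI) * (2 * PI)) by (field; lra).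
    set (u := IZR (up ((t - PI) / (2 * PI)))) in *. set (v := (t - PI) / (2 * PI)) in *. nra. }
  destruct HP as [k Hk].
  assert (E : cis t = cis (t - IZR k * (2 * PI))).
  { assert (Hper : forall n x, cis (x + 2 * INR n * PI) = cis x).
    { intros n x. unfold cis. now rewrite cos_period, sin_period. }
    destruct (Z_le_dec 0 k) as [K|K].
    - rewrite <- (Hper (Z.to_nat k) (t - IZR k * (2 * PI))). f_equal.
      rewrite INR_IZR_INZ, Z2Nat.id by lia. ring.
    - rewrite <- (Hper (Z.to_nat (- k)) t). f_equal.
      rewrite INR_IZR_INZ, Z2Nat.id, opp_IZR by lia. ring. }
  rewrite E, Cmod_norm. eapply Rle_trans; [left; apply (HM _ Hk)|apply Rmax_l].
Qed.

(** Taylor expansion on one disc, with Cauchy's estimate as first clause. The coefficients come from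
    integrals over the circle of radius rho; their independence of rho is shown in
    [entire_expansion]. *)
Lemma entire_series f rho : entire f -> 0 < rho -> exists c : nat -> C,
  (forall M, (forall t, Cmod (f (rho * cis t)%C) <= M) -> forall n, Cmod (c n) * rho ^ n <= M) /\
  forall z, Cmod z < rho -> is_series (V := C_NormedModule) (fun n => c n * z ^ n)%C (f z).
Proof.
  intros Hf Hr. pose proof PI_RGT_0 as HPI.
  set (g := fun t => f (rho * cis t)%C).
  assert (Hc : forall x, RC_continuous g x).
  { intros x. apply (RC_continuous_comp f (fun t => rho * cis t)%C); [|now apply C_continuous_entire].
    apply RC_continuous_mult; [apply RC_continuous_const|apply RC_continuous_cis]. }
  assert (HP0 : RtoC (2 * PI) <> 0%C) by (intros H; apply RtoC_inj in H; lra).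
  assert (HR0 : RtoC rho <> 0%C) by (intros H; apply RtoC_inj in H; lra).
  exists (fun n => fourier g n / (RtoC (2 * PI) * rho ^ n))%C. split.
  - intros M HM n.
    rewrite Cmod_div, Cmod_mult, Cmod_pow, !Cmod_R, !Rabs_pos_eq by
      (try (apply Cmult_neq_0; auto; apply Cpow_nz; auto); lra).
    pose proof (fourier_bound g n M Hc HM) as B.
    assert (Hpr : 0 < rho ^ n) by now apply pow_lt.
    replace (Cmod (fourier g n) / (2 * PI * rho ^ n) * rho ^ n) with (Cmod (fourier g n) / (2 * PI)) by (field; lra).
    apply Rmult_le_reg_r with (2 * PI); [lra|]. unfold Rdiv. rewrite Rmult_assoc, Rinv_l; lra.
  - intros z Hz. destruct (circle_bound f rho Hf) as [M [_ HM]].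
    pose proof (integral_cauchy_kernel_series z rho Hz g M Hc HM) as S.
    unfold g in S at 2. rewrite integral_cauchy_kernel, CRInt_cauchy_kernel in S by auto.
    apply is_series_Cmod. intros eps He.
    destruct (proj1 (is_series_Cmod _ _) S (eps * (2 * PI))) as [N HN]; [apply Rmult_lt_0_compat; lra|].
    exists N. intros n Hn. specialize (HN n Hn).
    assert (E : forall k, (Csum (fun n => fourier g n / (RtoC (2 * PI) * rho ^ n) * z ^ n) k * RtoC (2 * PI) =
      Csum (fun n => (z / rho) ^ n * fourier g n) k)%C).
    { induction k as [|k IH]; simpl Csum; [ring|]. rewrite <- IH.
      assert (Ep : ((z / rho) ^ k = z ^ k / rho ^ k)%C).
      { unfold Cdiv. rewrite Cpow_mult_l, Cpow_inv; auto. }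
      rewrite Ep. field. split; auto. now apply Cpow_nz. }
    rewrite Csum_sum_n in *. rewrite <- E in HN.
    apply Rmult_lt_reg_r with (2 * PI); [lra|].
    eapply Rle_lt_trans; [|exact HN]. right.
    rewrite <- (Rabs_pos_eq (2 * PI)) at 1 by lra. rewrite <- Cmod_R, <- Cmod_mult. f_equal. ring.
Qed.

(** * Power series *)

Notation is_Cseries := (is_series (V := C_NormedModule)).

Lemma is_Cseries_Cmod (a : nat -> C) (l : C) :
  is_Cseries a l <-> forall eps, 0 < eps -> exists N, forall n, (N <= n)%nat -> Cmod (Csum a n - l) < eps.
Proof.
  rewrite is_series_Cmod. split; intros H eps He; destruct (H eps He) as [N HN].
  - exists (S N). intros [|n] Hn; [lia|]. rewrite <- Csum_sum_n. apply HN; lia.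
  - exists N. intros n Hn. rewrite Csum_sum_n. apply HN; lia.
Qed.

Lemma is_Cseries_ext (a b : nat -> C) (l : C) : (forall n, a n = b n) -> is_Cseries a l -> is_Cseries b l.
Proof. intros H. apply is_series_ext. exact H. Qed.

Lemma is_Cseries_plus (a b : nat -> C) (la lb : C) : is_Cseries a la -> is_Cseries b lb -> is_Cseries (fun n => a n + b n)%C (la + lb)%C.
Proof. apply (is_series_plus (V := C_NormedModule)). Qed.

Lemma is_Cseries_mult (c : C) (a : nat -> C) (l : C) : is_Cseries a l -> is_Cseries (fun n => c * a n)%C (c * l)%C.
Proof. apply (is_series_scal (V := C_NormedModule)). Qed.

Lemma is_Cseries_minus (a b : nat -> C) (la lb : C) : is_Cseries a la -> is_Cseries b lb -> is_Cseries (fun n => a n - b n)%C (la - lb)%C.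
Proof. apply (is_series_minus (V := C_NormedModule)). Qed.

Lemma is_Cseries_shift (a : nat -> C) (l : C) : is_Cseries a l -> is_Cseries (fun n => match n with O => RtoC 0 | S k => a k end) l.
Proof.
  rewrite !is_Cseries_Cmod. intros H eps He. destruct (H eps He) as [N HN].
  exists (S N). intros [|n] Hn; [lia|].
  assert (E : Csum (fun n => match n with O => RtoC 0 | S k => a k end) (S n) = Csum a n).
  { clear. induction n; [simpl; ring|]. simpl Csum in *. rewrite IHn; ring. }
  change (Cmod (Csum (fun n => match n with O => RtoC 0 | S k => a k end) (S n) - l) < eps).
  rewrite E. apply HN; lia.
Qed.

Lemma pow_small A x eps : 0 <= x < 1 -> 0 < eps -> exists N, forall n, (N <= n)%nat -> A * x ^ n < eps.
Proof.
  intros Hx He. destruct (pow_lt_1_zero x) with (y := eps / (Rabs A + 1)) as [N HN].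
  { rewrite Rabs_pos_eq; lra. }
  { apply Rdiv_lt_0_compat; auto. pose proof (Rabs_pos A); lra. }
  exists N. intros n Hn. specialize (HN n Hn). pose proof (pow_le x n (proj1 Hx)) as Hp.
  rewrite Rabs_pos_eq in HN by auto. pose proof (Rabs_pos A). pose proof (Rle_abs A).
  apply Rle_lt_trans with ((Rabs A + 1) * x ^ n); [nra|].
  replace eps with ((Rabs A + 1) * (eps / (Rabs A + 1))) by (field; lra).
  apply Rmult_lt_compat_l; lra.
Qed.

(** * Series with a geometric majorant *)

Section Dominated.
Variables (M x : R).
Hypothesis Hx : 0 <= x < 1.

(** The factor 1 - x^n makes the right side an exact geometric sum, which lets the induction
    close. *)
Lemma Csum_diff a N n : (forall n, Cmod (a n) <= M * x ^ n) ->
  Cmod (Csum a (N + n) - Csum a N) <= M * x ^ N / (1 - x) * (1 - x ^ n).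
Proof.
  intros Ha. induction n.
  - rewrite Nat.add_0_r. replace (Csum a N - Csum a N)%C with (RtoC 0) by ring. rewrite Cmod_0. simpl. lra.
  - rewrite Nat.add_succ_r. simpl Csum.
    replace (Csum a (N + n) + a (N + n)%nat - Csum a N)%C with ((Csum a (N + n) - Csum a N) + a (N + n)%nat)%C by ring.
    eapply Rle_trans; [apply Cmod_triangle|]. specialize (Ha (N + n)%nat). rewrite pow_add in Ha.
    eapply Rle_trans; [apply Rplus_le_compat; [exact IHn|exact Ha]|]. right. simpl. field. lra.
Qed.

Lemma geometric_majorant_nonneg (a : nat -> C) : (forall n, Cmod (a n) <= M * x ^ n) -> 0 <= M.
Proof.
  intros Ha. specialize (Ha 0%nat). simpl in Ha. pose proof (Cmod_ge_0 (a 0%nat)). lra.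
Qed.

Lemma is_Cseries_tail (a : nat -> C) (l : C) N : (forall n, Cmod (a n) <= M * x ^ n) -> is_Cseries a l ->
  Cmod (Csum a N - l) <= M * x ^ N / (1 - x).
Proof.
  intros Ha Hl. pose proof (geometric_majorant_nonneg a Ha) as HM. apply Rle_plus_epsilon. intros eps He.
  destruct (proj1 (is_Cseries_Cmod a l) Hl eps He) as [N1 HN1].
  specialize (HN1 (N + N1)%nat ltac:(lia)).
  pose proof (Csum_diff a N N1 Ha) as D.
  replace (Csum a N - l)%C with (- (Csum a (N + N1) - Csum a N) + (Csum a (N + N1) - l))%C by ring.
  eapply Rle_trans; [apply Cmod_triangle|]. rewrite Cmod_opp.
  assert (0 <= M * x ^ N / (1 - x)).
  { apply Rmult_le_pos; [apply Rmult_le_pos; [auto|apply pow_le; lra]|]. left; apply Rinv_0_lt_compat; lra. }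
  assert (0 <= x ^ N1) by (apply pow_le; lra). nra.
Qed.

Lemma is_Cseries_bound (a : nat -> C) (l : C) : (forall n, Cmod (a n) <= M * x ^ n) -> is_Cseries a l -> Cmod l <= M / (1 - x).
Proof.
  intros Ha Hl. pose proof (is_Cseries_tail a l 0 Ha Hl) as H. simpl in H.
  replace (0 - l)%C with (- l)%C in H by ring. rewrite Cmod_opp in H. now rewrite Rmult_1_r in H.
Qed.

Lemma ex_Cseries_geometric (a : nat -> C) : (forall n, Cmod (a n) <= M * x ^ n) -> exists l : C, is_Cseries a l.
Proof.
  intros Ha.
  apply (ex_series_le (K := C_AbsRing) (V := C_CompleteNormedModule) a (fun n => M * x ^ n)); [exact Ha|].
  apply (ex_series_scal (K := R_AbsRing) (V := R_NormedModule) M (fun n => x ^ n)). apply ex_series_geom. rewrite Rabs_pos_eq; lra.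
Qed.

End Dominated.

(** The sum of the first N columns is the series over n of the N-th partial sums of the rows. Row n
    has a tail of at most M x^n x^N / (1 - x), so the total error is at most M x^N / (1 - x)^2. *)
Lemma is_Cseries_swap M x (f : nat -> nat -> C) (r c : nat -> C) (S : C) : 0 <= x < 1 -> (forall n m, Cmod (f n m) <= M * x ^ n * x ^ m) ->
  (forall n, is_Cseries (f n) (r n)) -> (forall m, is_Cseries (fun n => f n m) (c m)) ->
  is_Cseries r S -> is_Cseries c S.
Proof.
  intros Hx Hf Hr Hc HS. apply is_Cseries_Cmod. intros eps He.
  assert (E : forall N, is_Cseries (fun n => Csum (f n) N) (Csum c N)).
  { induction N; simpl.
    - apply (is_Cseries_ext (fun n => 0 * f n 0%nat)%C); [intros; ring|].
      refine (eq_rect _ (fun l : C => is_Cseries _ l) (is_Cseries_mult 0 _ _ (Hc 0%nat)) _ _). ring.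
    - now apply is_Cseries_plus. }
  destruct (pow_small (M / (1 - x) / (1 - x)) x eps Hx He) as [N HN].
  exists N. intros n Hn. eapply Rle_lt_trans; [|exact (HN n Hn)].
  replace (M / (1 - x) / (1 - x) * x ^ n) with (M * x ^ n / (1 - x) / (1 - x)) by (field; lra).
  apply (is_Cseries_bound (M * x ^ n / (1 - x)) x Hx (fun k => Csum (f k) n - r k)%C); [|now apply is_Cseries_minus].
  intros k. replace (M * x ^ n / (1 - x) * x ^ k) with (M * x ^ k * x ^ n / (1 - x)) by (field; lra).
  now apply is_Cseries_tail.
Qed.

Lemma is_Cseries_term_bounded (a : nat -> C) (l : C) : is_Cseries a l -> exists M, forall n, Cmod (a n) <= M.
Proof.
  intros H. destruct (proj1 (is_Cseries_Cmod a l) H 1 Rlt_0_1) as [N HN].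
  assert (HF : forall k, exists M, 0 <= M /\ forall n, (n < k)%nat -> Cmod (a n) <= M).
  { induction k as [|k [M [HM1 HM2]]]; [exists 0; split; [lra|lia]|].
    exists (M + Cmod (a k)). pose proof (Cmod_ge_0 (a k)). split; [lra|].
    intros n Hn. destruct (Nat.eq_dec n k) as [->|]; [lra|]. specialize (HM2 n ltac:(lia)). lra. }
  destruct (HF N) as [M [HM1 HM2]]. exists (M + 2). intros n.
  destruct (le_lt_dec N n) as [Hn|Hn]; [|specialize (HM2 n Hn); lra].
  pose proof (HN n Hn). pose proof (HN (S n) ltac:(lia)) as H1. simpl in H1.
  pose proof (Cmod_triangle (Csum a n + a n - l) (- (Csum a n - l))) as T.
  replace (Csum a n + a n - l + - (Csum a n - l))%C with (a n) in T by ring.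
  rewrite Cmod_opp in T. lra.
Qed.

(** Once the coefficients below n vanish, the n-th term at t = (rho / 2) x is minus the tail, of
    order x^(n+1); dividing by x^n and letting x tend to 0 gives d n = 0. Real t are enough, which
    later identifies functions from their values on the real axis. *)
Lemma power_series_zero rho (d : nat -> C) : 0 < rho ->
  (forall t : R, 0 < t < rho -> is_Cseries (fun n => d n * t ^ n)%C (RtoC 0)) -> forall n, d n = RtoC 0.
Proof.
  intros Hr H.
  destruct (is_Cseries_term_bounded _ _ (H (rho / 2) ltac:(lra))) as [M HM].
  assert (HM' : forall n, Cmod (d n) * (rho / 2) ^ n <= M).
  { intros n. specialize (HM n). rewrite Cmod_mult, Cmod_pow, Cmod_R, Rabs_pos_eq in HM by lra. exact HM. }
  assert (HM0 : 0 <= M) by (eapply Rle_trans; [|apply (HM 0%nat)]; apply Cmod_ge_0).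
  intros n. induction n as [n IH] using (well_founded_induction lt_wf).
  apply Cmod_eq_0. apply Rle_antisym; [|apply Cmod_ge_0].
  assert (Hp : 0 < (rho / 2) ^ n) by (apply pow_lt; lra).
  apply Rmult_le_reg_r with ((rho / 2) ^ n); auto. rewrite Rmult_0_l.
  apply Rle_plus_epsilon. intros eps He. rewrite Rplus_0_l.
  (* The bound 1/2 gives 1 / (1 - x) <= 2, and the other gives 2 M x <= eps. *)
  set (x := Rmin (1 / 2) (eps / (2 * M + 1))).
  assert (Hx : 0 < x <= 1 / 2).
  { split; [apply Rmin_glb_lt; [lra|apply Rdiv_lt_0_compat; lra]|apply Rmin_l]. }
  assert (Hx2 : 2 * M * x <= eps).
  { apply Rle_trans with ((2 * M + 1) * (eps / (2 * M + 1))); [|right; field; lra].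
    apply Rmult_le_compat; try lra. apply Rmin_r. }
  set (t := rho / 2 * x).
  assert (Ht : 0 < t) by (apply Rmult_lt_0_compat; lra).
  assert (Htr : t < rho) by (unfold t; nra).
  assert (Ez : forall k, Cmod (d k * RtoC t ^ k) = Cmod (d k) * (rho / 2) ^ k * x ^ k).
  { intros k. rewrite Cmod_mult, Cmod_pow, Cmod_R, Rabs_pos_eq by lra. unfold t.
    rewrite Rpow_mult_distr. ring. }
  assert (Hd : forall k, Cmod (d k * RtoC t ^ k) <= M * x ^ k).
  { intros k. rewrite Ez. apply Rmult_le_compat_r; [apply pow_le; lra|apply HM']. }
  pose proof (is_Cseries_tail M x ltac:(lra) _ _ (S n) Hd (H t (conj Ht Htr))) as T.
  assert (E0 : forall k, (k <= n)%nat -> Csum (fun k => d k * RtoC t ^ k)%C k = 0%C).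
  { induction k; intros Hk; simpl; [auto|]. rewrite IHk, (IH k) by lia. ring. }
  simpl Csum in T. rewrite E0 in T by lia.
  replace (0 + d n * RtoC t ^ n - 0)%C with (d n * RtoC t ^ n)%C in T by ring. rewrite Ez in T.
  assert (Hxn : 0 < x ^ n) by (apply pow_lt; lra).
  apply Rmult_le_reg_r with (x ^ n); auto. eapply Rle_trans; [exact T|].
  apply Rle_trans with (2 * M * x * x ^ n); [|apply Rmult_le_compat_r; lra].
  simpl. replace (M * (x * x ^ n) / (1 - x)) with (M * x * x ^ n * / (1 - x)) by (unfold Rdiv; ring).
  replace (2 * M * x * x ^ n) with (M * x * x ^ n * 2) by ring.
  apply Rmult_le_compat_l; [repeat apply Rmult_le_pos; lra|].
  rewrite <- (Rinv_inv 2). apply Rinv_le_contravar; lra.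
Qed.

Lemma power_series_unique rho (f : C -> C) (a b : nat -> C) : 0 < rho ->
  (forall z, Cmod z < rho -> is_Cseries (fun n => a n * z ^ n)%C (f z)) ->
  (forall z, Cmod z < rho -> is_Cseries (fun n => b n * z ^ n)%C (f z)) -> forall n, a n = b n.
Proof.
  intros Hr Ha Hb n. apply Cminus_eq_0_eq. apply (power_series_zero rho (fun n => a n - b n)%C Hr).
  intros t Ht. apply (is_Cseries_ext (fun n => a n * t ^ n - b n * t ^ n)%C); [intros; ring|].
  assert (Hz : Cmod t < rho) by (rewrite Cmod_R, Rabs_pos_eq; lra).
  replace (RtoC 0) with (f t - f t)%C by ring. apply is_Cseries_minus; auto.
Qed.

(** * Power series with infinite radius of convergence *)

Definition rapid_decay (c : nat -> C) := forall R, 0 < R -> exists M, forall n, Cmod (c n) * R ^ n <= M.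

(** Decay at radius 2 (X + 1) leaves a factor (1/2)^n on the disc of radius X; the summand 1 keeps
    the radius positive when X = 0. *)
Lemma rapid_decay_geometric c X : rapid_decay c -> 0 <= X -> exists M, 0 <= M /\ forall n w, Cmod w <= X ->
  Cmod (c n * w ^ n) <= M * (/ 2) ^ n.
Proof.
  intros Hc HX. destruct (Hc (2 * (X + 1))) as [M HM]; [lra|].
  exists M. split.
  { specialize (HM 0%nat). simpl in HM. pose proof (Cmod_ge_0 (c 0%nat)). lra. }
  intros n w Hw. rewrite Cmod_mult, Cmod_pow.
  apply Rle_trans with (Cmod (c n) * (X + 1) ^ n).
  - apply Rmult_le_compat_l; [apply Cmod_ge_0|]. apply pow_incr. split; [apply Cmod_ge_0|lra].
  - specialize (HM n). rewrite Rpow_mult_distr in HM.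
    assert (Hp : 0 < (/ 2) ^ n) by (apply pow_lt; lra).
    apply Rmult_le_compat_r with (r := (/ 2) ^ n) in HM; [|lra].
    eapply Rle_trans; [|exact HM]. right.
    assert (E : 2 ^ n * (/ 2) ^ n = 1) by (rewrite <- Rpow_mult_distr, Rinv_r, pow1; lra).
    transitivity (Cmod (c n) * (X + 1) ^ n * (2 ^ n * (/ 2) ^ n)); [rewrite E|]; ring.
Qed.

Definition Cpseries (c : nat -> C) (z : C) : C :=
  epsilon (inhabits (RtoC 0)) (fun l => is_Cseries (fun n => c n * z ^ n)%C l).

Lemma Cpseries_spec c z : rapid_decay c -> is_Cseries (fun n => c n * z ^ n)%C (Cpseries c z).
Proof.
  intros Hc. apply (epsilon_spec (inhabits (RtoC 0)) (fun l => is_Cseries (fun n => c n * z ^ n)%C l)).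
  destruct (rapid_decay_geometric c (Cmod z) Hc (Cmod_ge_0 z)) as [M [_ HM]].
  apply (ex_Cseries_geometric M (/ 2)); [lra|]. intros n. apply HM; lra.
Qed.

Lemma Cpseries_unique (c : nat -> C) (z l : C) : rapid_decay c -> is_Cseries (fun n => c n * z ^ n)%C l -> Cpseries c z = l.
Proof. intros Hc H. exact (is_Cseries_unique _ _ _ (Cpseries_spec c z Hc) H). Qed.

Definition derive_coef (c : nat -> C) (n : nat) : C := (RtoC (INR (S n)) * c (S n))%C.

Lemma INR_S_le_pow2 n : INR (S n) <= 2 ^ n.
Proof.
  induction n; [simpl; lra|]. rewrite S_INR. simpl pow.
  assert (1 <= 2 ^ n) by (apply pow_R1_Rle; lra). lra.
Qed.

Lemma rapid_decay_shift c : rapid_decay c -> rapid_decay (fun n => c (S n)).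
Proof.
  intros Hc R HR. destruct (Hc R HR) as [M HM]. exists (M / R). intros n.
  specialize (HM (S n)). simpl in HM. apply Rmult_le_reg_r with R; auto.
  replace (M / R * R) with M by (field; lra). lra.
Qed.

(** A factor linear in n is at most a multiple of 2^n, absorbed by doubling the radius. *)
Lemma rapid_decay_lin k c : rapid_decay c -> rapid_decay (fun n => (RtoC (INR n) + RtoC k) * c n)%C.
Proof.
  intros Hc R HR. destruct (Hc (2 * R)) as [M HM]; [lra|].
  exists ((1 + Rabs k) * M). intros n. rewrite <- RtoC_plus, Cmod_mult, Cmod_R.
  specialize (HM n). rewrite Rpow_mult_distr in HM.
  assert (Hb : Rabs (INR n + k) <= (1 + Rabs k) * 2 ^ n).
  { eapply Rle_trans; [apply Rabs_triang|]. rewrite (Rabs_pos_eq (INR n)) by apply pos_INR.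
    pose proof (INR_S_le_pow2 n) as A. rewrite S_INR in A. pose proof (Rabs_pos k). pose proof (pos_INR n). nra. }
  pose proof (Cmod_ge_0 (c n)). pose proof (pow_le R n ltac:(lra)). pose proof (Rabs_pos k).
  apply Rle_trans with ((1 + Rabs k) * 2 ^ n * Cmod (c n) * R ^ n).
  - apply Rmult_le_compat_r; auto. apply Rmult_le_compat_r; auto.
  - replace ((1 + Rabs k) * 2 ^ n * Cmod (c n) * R ^ n) with ((1 + Rabs k) * (Cmod (c n) * (2 ^ n * R ^ n))) by ring.
    apply Rmult_le_compat_l; lra.
Qed.

Lemma rapid_decay_derive_coef c : rapid_decay c -> rapid_decay (derive_coef c).
Proof.
  intros Hc. pose proof (rapid_decay_lin 1 _ (rapid_decay_shift c Hc)) as H.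
  intros R HR. destruct (H R HR) as [M HM]. exists M. intros n.
  unfold derive_coef. rewrite S_INR, RtoC_plus. apply HM.
Qed.

(** The remainders satisfy R_(n+1) = (z + h) R_n + n z^(n-1) h^2, and n^2 + n <= (n + 1)^2. The
    condition rho >= 1 absorbs the lower exponent n - 1. *)
Lemma pow_taylor2 (z h : C) rho : 1 <= rho -> Cmod z + Cmod h <= rho -> forall n,
  Cmod ((z + h) ^ n - z ^ n - RtoC (INR n) * z ^ (n - 1) * h) <= INR n * INR n * rho ^ n * (Cmod h * Cmod h).
Proof.
  intros Hr Hz. induction n as [|n IH].
  - simpl. replace (1 - 1 - 0 * 1 * h)%C with (RtoC 0) by ring. rewrite Cmod_0. lra.
  - replace ((z + h) ^ S n - z ^ S n - RtoC (INR (S n)) * z ^ (S n - 1) * h)%C with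
      ((z + h) * ((z + h) ^ n - z ^ n - RtoC (INR n) * z ^ (n - 1) * h) + RtoC (INR n) * z ^ (n - 1) * (h * h))%C.
    2:{ rewrite S_INR, RtoC_plus. simpl (S n - 1)%nat. rewrite Nat.sub_0_r. destruct n as [|n].
        - simpl. ring.
        - simpl (S n - 1)%nat. rewrite Nat.sub_0_r. simpl Cpow. ring. }
    eapply Rle_trans; [apply Cmod_triangle|]. rewrite !Cmod_mult, Cmod_pow, Cmod_R, Rabs_pos_eq by apply pos_INR.
    pose proof (pos_INR n) as Hn. pose proof (Cmod_ge_0 h). pose proof (Cmod_ge_0 z).
    assert (H1 : Cmod (z + h) <= rho) by (eapply Rle_trans; [apply Cmod_triangle|lra]).
    assert (H2 : Cmod z ^ (n - 1) <= rho ^ S n).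
    { apply Rle_trans with (rho ^ (n - 1)); [apply pow_incr; lra|]. apply Rle_pow; [lra|lia]. }
    assert (Hh : 0 <= Cmod h * Cmod h) by now apply Rmult_le_pos.
    assert (Hrn : 0 <= rho ^ n) by (apply pow_le; lra).
    assert (A : Cmod (z + h) * Cmod ((z + h) ^ n - z ^ n - RtoC (INR n) * z ^ (n - 1) * h) <=
      rho * (INR n * INR n * rho ^ n * (Cmod h * Cmod h))).
    { apply Rmult_le_compat; auto using Cmod_ge_0. }
    assert (B : INR n * Cmod z ^ (n - 1) * (Cmod h * Cmod h) <= INR n * rho ^ S n * (Cmod h * Cmod h)).
    { apply Rmult_le_compat_r; auto. apply Rmult_le_compat_l; auto. }
    eapply Rle_trans; [apply Rplus_le_compat; [exact A|exact B]|].
    rewrite S_INR. simpl pow.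
    replace (rho * (INR n * INR n * rho ^ n * (Cmod h * Cmod h)) + INR n * (rho * rho ^ n) * (Cmod h * Cmod h))
      with ((INR n * INR n + INR n) * (rho * rho ^ n * (Cmod h * Cmod h))) by ring.
    replace ((INR n + 1) * (INR n + 1) * (rho * rho ^ n) * (Cmod h * Cmod h))
      with ((INR n + 1) * (INR n + 1) * (rho * rho ^ n * (Cmod h * Cmod h))) by ring.
    apply Rmult_le_compat_r; [|nra]. apply Rmult_le_pos; auto. apply Rmult_le_pos; lra.
Qed.

(** Reindexed for termwise comparison with c n z^n; the truncated exponent at n = 0 is harmless
    because of the factor n. *)
Lemma Cpseries_derive_coef_shift c z : rapid_decay c -> is_Cseries (fun n => RtoC (INR n) * c n * z ^ (n - 1))%C (Cpseries (derive_coef c) z).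
Proof.
  intros Hc. pose proof (is_Cseries_shift _ _ (Cpseries_spec _ z (rapid_decay_derive_coef c Hc))) as H.
  revert H. apply is_Cseries_ext. intros [|n]; [simpl; ring|].
  unfold derive_coef. simpl (S n - 1)%nat. now rewrite Nat.sub_0_r.
Qed.

Lemma is_derive_Cpseries c z : rapid_decay c -> is_derive (K := C_AbsRing) (V := C_NormedModule) (Cpseries c) z (Cpseries (derive_coef c) z).
Proof.
  intros Hc. apply is_derive_Cmod. intros eps He.
  set (rho := Cmod z + 1). assert (Hr : 1 <= rho) by (unfold rho; pose proof (Cmod_ge_0 z); lra).
  (* The factor 4^n at radius 4 rho pays for the n^2 of [pow_taylor2]. *)
  destruct (rapid_decay_geometric c (4 * rho) Hc ltac:(lra)) as [M [HM0 HM]].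
  exists (Rmin 1 (eps / (2 * M + 1))). split.
  { apply Rmin_glb_lt; [lra|]. apply Rdiv_lt_0_compat; lra. }
  intros y Hy. set (h := (y - z)%C) in *.
  assert (Hh1 : Cmod h < 1) by (eapply Rlt_le_trans; [exact Hy|apply Rmin_l]).
  assert (Hh2 : Cmod h < eps / (2 * M + 1)) by (eapply Rlt_le_trans; [exact Hy|apply Rmin_r]).
  replace y with (z + h)%C by (unfold h; ring).
  pose proof (is_Cseries_minus _ _ _ _ (is_Cseries_minus _ _ _ _ (Cpseries_spec c (z + h)%C Hc) (Cpseries_spec c z Hc))
    (is_Cseries_mult h _ _ (Cpseries_derive_coef_shift c z Hc))) as S.
  assert (B : Cmod (Cpseries c (z + h)%C - Cpseries c z - h * Cpseries (derive_coef c) z) <= (M * (Cmod h * Cmod h)) / (1 - / 2)).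
  { refine (is_Cseries_bound _ (/ 2) ltac:(lra) _ _ _ S). intros n.
    replace (c n * (z + h) ^ n - c n * z ^ n - h * (RtoC (INR n) * c n * z ^ (n - 1)))%C
      with (c n * ((z + h) ^ n - z ^ n - RtoC (INR n) * z ^ (n - 1) * h))%C by ring.
    rewrite Cmod_mult.
    assert (T := pow_taylor2 z h rho Hr ltac:(unfold rho; lra) n).
    specialize (HM n (RtoC (4 * rho)) ltac:(rewrite Cmod_R, Rabs_pos_eq; lra)).
    rewrite Cmod_mult, Cmod_pow, Cmod_R, Rabs_pos_eq, Rpow_mult_distr in HM by lra.
    pose proof (Cmod_ge_0 (c n)) as Hcn.
    eapply Rle_trans; [apply Rmult_le_compat_l; [auto|exact T]|].
    assert (Hhh : 0 <= Cmod h * Cmod h) by (apply Rmult_le_pos; apply Cmod_ge_0).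
    assert (H4 : INR n * INR n <= 4 ^ n).
    { replace 4 with (2 * 2) by lra. rewrite Rpow_mult_distr.
      pose proof (INR_S_le_pow2 n) as A. rewrite S_INR in A. pose proof (pos_INR n).
      apply Rmult_le_compat; lra. }
    apply Rle_trans with (Cmod (c n) * (4 ^ n * rho ^ n) * (Cmod h * Cmod h)).
    - rewrite <- Rmult_assoc. apply Rmult_le_compat_r; auto. apply Rmult_le_compat_l; auto.
      apply Rmult_le_compat_r; auto. apply pow_le; lra.
    - replace (M * (Cmod h * Cmod h) * (/ 2) ^ n) with (M * (/ 2) ^ n * (Cmod h * Cmod h)) by ring.
      apply Rmult_le_compat_r; auto. }
  replace (M * (Cmod h * Cmod h) / (1 - / 2)) with (2 * M * Cmod h * Cmod h) in B by field.
  replace (z + h - z)%C with h by ring.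
  eapply Rle_trans; [exact B|]. apply Rmult_le_compat_r; [apply Cmod_ge_0|].
  assert ((2 * M + 1) * Cmod h <= eps).
  { apply Rle_trans with ((2 * M + 1) * (eps / (2 * M + 1))); [|right; field; lra].
    apply Rmult_le_compat_l; lra. }
  pose proof (Cmod_ge_0 h). nra.
Qed.

Lemma entire_Cpseries c : rapid_decay c -> entire (Cpseries c).
Proof. intros Hc z. exists (Cpseries (derive_coef c) z). now apply is_derive_Cpseries. Qed.

Lemma C_derive_Cpseries c : rapid_decay c -> C_derive (Cpseries c) = Cpseries (derive_coef c).
Proof. intros Hc. apply functional_extensionality. intros z. apply is_C_derive_unique. now apply is_derive_Cpseries. Qed.

Lemma euler_op_Cpseries k c : rapid_decay c -> euler_op k (Cpseries c) = Cpseries (fun n => (RtoC (INR n) + RtoC k) * c n)%C.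
Proof.
  intros Hc. apply functional_extensionality. intros z. symmetry. apply Cpseries_unique; [now apply rapid_decay_lin|].
  unfold euler_op. rewrite C_derive_Cpseries by auto.
  refine (is_Cseries_ext _ _ _ _ (is_Cseries_plus _ _ _ _ (is_Cseries_mult z _ _ (Cpseries_derive_coef_shift c z Hc)) (is_Cseries_mult (RtoC k) _ _ (Cpseries_spec c z Hc)))).
  intros [|n]; [simpl; ring|]. simpl (S n - 1)%nat. rewrite Nat.sub_0_r. simpl Cpow. ring.
Qed.

(** The coefficients found for radius 1 agree with those for any other radius by uniqueness on the
    smaller disc, so a single sequence satisfies Cauchy's estimate on every circle; rapid decay is
    that estimate. *)
Lemma entire_expansion f : entire f -> exists c, rapid_decay c /\ f = Cpseries c /\
  forall rho M, 0 < rho -> (forall t, Cmod (f (rho * cis t)%C) <= M) -> forall n, Cmod (c n) * rho ^ n <= M.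
Proof.
  intros Hf. destruct (entire_series f 1 Hf Rlt_0_1) as [c [_ Hc]].
  assert (HE : forall rho, 0 < rho ->
    (forall M, (forall t, Cmod (f (rho * cis t)%C) <= M) -> forall n, Cmod (c n) * rho ^ n <= M) /\
    forall z, Cmod z < rho -> is_Cseries (fun n => c n * z ^ n)%C (f z)).
  { intros rho Hr. destruct (entire_series f rho Hf Hr) as [c' [H1 H2]].
    assert (E : c = c').
    { apply functional_extensionality. apply (power_series_unique (Rmin 1 rho) f).
      - apply Rmin_glb_lt; lra.
      - intros z Hz. apply Hc. eapply Rlt_le_trans; [exact Hz|apply Rmin_l].
      - intros z Hz. apply H2. eapply Rlt_le_trans; [exact Hz|apply Rmin_r]. }
    subst c'. now split. }
  assert (Hfast : rapid_decay c).
  { intros R HR. destruct (circle_bound f R Hf) as [M [_ HM]]. exists M. now apply HE. }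
  exists c. split; [auto|split].
  - apply functional_extensionality. intros z. symmetry. apply Cpseries_unique; auto.
    apply (HE (Cmod z + 1)); pose proof (Cmod_ge_0 z); lra.
  - intros rho M Hr HM. now apply HE.
Qed.

(** * The Gamma function and the numbers alpha *)

(** For a nonnegative integrand the integrals over [a, b] grow with the interval, so their supremum
    over a <= 1 <= b is the improper integral. *)
Lemma is_RInt_gen_monotone (f : R -> R) M :
  (forall t, 0 < t -> continuous f t) -> (forall t, 0 < t -> 0 <= f t) ->
  (forall a b, 0 < a <= 1 -> 1 <= b -> RInt f a b <= M) ->
  exists l, is_RInt_gen f (at_right 0) (Rbar_locally p_infty) l /\
    forall a b, 0 < a <= 1 -> 1 <= b -> RInt f a b <= l.
Proof.
  intros Hc Hp HM.
  assert (Hex : forall a b, 0 < a -> a <= b -> ex_RInt f a b).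
  { intros a b Ha Hab. apply (ex_RInt_continuous (V := R_CompleteNormedModule)).
    intros t Ht. apply Hc. rewrite Rmin_left in Ht by lra. lra. }
  assert (Hmono : forall a b a' b', 0 < a' -> a' <= a -> a <= b -> b <= b' -> RInt f a b <= RInt f a' b').
  { intros a b a' b' H1 H2 H3 H4.
    rewrite <- (RInt_Chasles f a' a b') by (apply Hex; lra).
    rewrite <- (RInt_Chasles f a b b') by (apply Hex; lra).
    assert (A : 0 <= RInt f a' a) by (apply RInt_ge_0; [lra|apply Hex; lra|intros; apply Hp; lra]).
    assert (B : 0 <= RInt f b b') by (apply RInt_ge_0; [lra|apply Hex; lra|intros; apply Hp; lra]).
    unfold plus; simpl. lra. }
  destruct (completeness (fun y => exists a b, 0 < a <= 1 /\ 1 <= b /\ y = RInt f a b)) as [l [Hl1 Hl2]].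
  { exists M. intros y [a [b [Ha [Hb ->]]]]. now apply HM. }
  { exists (RInt f 1 1), 1, 1. repeat split; lra. }
  exists l. split.
  2:{ intros a b Ha Hb. apply Hl1. now exists a, b. }
  intros P [eps HP].
  assert (HE : exists a b, 0 < a <= 1 /\ 1 <= b /\ l - eps < RInt f a b).
  { destruct (Classical_Prop.classic (exists a b, 0 < a <= 1 /\ 1 <= b /\ l - eps < RInt f a b)) as [|N]; auto.
    exfalso. assert (l <= l - eps).
    { apply Hl2. intros y [a [b [Ha [Hb ->]]]]. apply Rnot_lt_le. intros H. apply N. now exists a, b. }
    destruct eps as [e He]; simpl in *; lra. }
  destruct HE as [a0 [b0 [Ha0 [Hb0 HI]]]].
  apply Filter_prod with (fun a => 0 < a < a0) (fun b => b0 < b).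
  - exists (mkposreal a0 (proj1 Ha0)). intros y Hy Hy0. split; auto.
    unfold ball in Hy; simpl in Hy; unfold AbsRing_ball, abs, minus, plus, opp in Hy; simpl in Hy.
    rewrite Rabs_pos_eq in Hy; lra.
  - exists b0. auto.
  - intros a b Ha Hb. exists (RInt f a b). split.
    + apply (RInt_correct (V := R_CompleteNormedModule)). simpl. apply Hex; lra.
    + apply HP. assert (RInt f a0 b0 <= RInt f a b) by (apply Hmono; lra).
      assert (RInt f a b <= l) by (apply Hl1; exists a, b; repeat split; lra).
      apply Rabs_lt_between'. destruct eps as [e He]; simpl in *; lra.
Qed.

Definition Gamma_integrand (x t : R) : R := Rpower t (x - 1) * exp (- t).

Lemma Gamma_integrand_pos x t : 0 < Gamma_integrand x t.
Proof. apply Rmult_lt_0_compat; apply exp_pos. Qed.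

Lemma Gamma_integrand_cont x t : 0 < t -> continuous (Gamma_integrand x) t.
Proof.
  intros Ht. apply (ex_derive_continuous (V := R_NormedModule)). unfold Gamma_integrand, Rpower. auto_derive. auto.
Qed.

(** This is 1 + ln y <= y at y = t / (2 x). *)
Lemma Rpower_le_exp x t : 0 < x -> 0 < t -> Rpower t x <= exp (x * ln (2 * x)) * exp (t / 2).
Proof.
  intros Hx Ht. unfold Rpower. rewrite <- exp_plus.
  assert (H : x * ln t <= x * ln (2 * x) + t / 2).
  { assert (Hy : 0 < t / (2 * x)) by (apply Rdiv_lt_0_compat; lra).
    pose proof (exp_ineq1_le (ln (t / (2 * x)))) as E. rewrite exp_ln in E by auto.
    rewrite ln_div in E by lra.
    assert (x * (1 + (ln t - ln (2 * x))) <= x * (t / (2 * x))) by (apply Rmult_le_compat_l; lra).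
    replace (x * (t / (2 * x))) with (t / 2) in H by (field; lra). lra. }
  destruct H as [H|H]; [left; now apply exp_increasing|rewrite H; lra].
Qed.

Lemma Rpower_Gamma_integrand x t : 0 < t -> Rpower t x * exp (- t) = t * Gamma_integrand x t.
Proof.
  intros Ht. unfold Gamma_integrand. replace x with (1 + (x - 1)) at 1 by ring.
  rewrite Rpower_plus, Rpower_1 by auto. ring.
Qed.

(** On (0, 1] the integrand is at most t^(x-1), of integral at most 1 / x. On [1, b] an extra factor
    t >= 1 makes it t^x e^(-t) <= K e^(-t/2), of integral at most 2 K. *)
Lemma Gamma_integrand_bounded x : 0 < x -> exists M, forall a b, 0 < a <= 1 -> 1 <= b -> RInt (Gamma_integrand x) a b <= M.
Proof.
  intros Hx. set (K := exp (x * ln (2 * x))).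
  assert (HK : 0 < K) by apply exp_pos.
  exists (/ x + 2 * K). intros a b Ha Hb.
  assert (Hex : forall a b, 0 < a -> a <= b -> ex_RInt (Gamma_integrand x) a b).
  { intros u v Hu Huv. apply (ex_RInt_continuous (V := R_CompleteNormedModule)).
    intros t Ht. apply Gamma_integrand_cont. rewrite Rmin_left in Ht by lra. lra. }
  rewrite <- (RInt_Chasles (Gamma_integrand x) a 1 b) by (apply Hex; lra).
  apply Rplus_le_compat.
  - assert (H : is_RInt (fun t => Rpower t (x - 1)) a 1 (Rpower 1 x / x - Rpower a x / x)).
    { apply (is_RInt_derive (fun t => Rpower t x / x)).
      - intros t Ht. rewrite Rmin_left in Ht by lra. unfold Rpower. auto_derive; [lra|].
        replace (x * ln t) with (ln t + (x - 1) * ln t) by ring.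
        rewrite exp_plus, exp_ln by lra. field. lra.
      - intros t Ht. rewrite Rmin_left in Ht by lra.
        apply (ex_derive_continuous (V := R_NormedModule)). unfold Rpower. auto_derive. lra. }
    assert (HB : RInt (Gamma_integrand x) a 1 <= Rpower 1 x / x - Rpower a x / x).
    { rewrite <- (is_RInt_unique _ _ _ _ H). apply RInt_le; [lra|apply Hex; lra|eexists; exact H|].
      intros t Ht. unfold Gamma_integrand. rewrite <- (Rmult_1_r (Rpower t (x - 1))) at 2.
      apply Rmult_le_compat_l; [left; apply exp_pos|]. rewrite <- exp_0. left; apply exp_increasing; lra. }
    assert (E : Rpower 1 x = 1) by (unfold Rpower; rewrite ln_1, Rmult_0_r; apply exp_0).
    rewrite E in HB. assert (0 < Rpower a x / x) by (apply Rdiv_lt_0_compat; [apply exp_pos|lra]).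
    unfold Rdiv in *; lra.
  - assert (H : is_RInt (fun t => K * exp (- t / 2)) 1 b (- 2 * K * exp (- b / 2) - - 2 * K * exp (- 1 / 2))).
    { apply (is_RInt_derive (fun t => - 2 * K * exp (- t / 2))).
      - intros t Ht. auto_derive; auto. unfold Rdiv. field.
      - intros t Ht. apply (ex_derive_continuous (V := R_NormedModule)). auto_derive. auto. }
    assert (HB : RInt (Gamma_integrand x) 1 b <= - 2 * K * exp (- b / 2) - - 2 * K * exp (- 1 / 2)).
    { rewrite <- (is_RInt_unique _ _ _ _ H). apply RInt_le; [lra|apply Hex; lra|eexists; exact H|].
      intros t Ht.
      apply Rle_trans with (t * Gamma_integrand x t).
      - rewrite <- (Rmult_1_l (Gamma_integrand x t)) at 1. apply Rmult_le_compat_r; [left; apply Gamma_integrand_pos|lra].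
      - rewrite <- Rpower_Gamma_integrand by lra.
        replace (- t / 2) with (t / 2 + - t) by field. rewrite exp_plus, <- Rmult_assoc.
        apply Rmult_le_compat_r; [left; apply exp_pos|]. apply Rpower_le_exp; lra. }
    assert (exp (- 1 / 2) <= 1) by (rewrite <- exp_0; left; apply exp_increasing; lra).
    pose proof (exp_pos (- b / 2)). nra.
Qed.

Lemma Gamma_correct x : 0 < x -> is_RInt_gen (Gamma_integrand x) (at_right 0) (Rbar_locally p_infty) (Gamma x) /\ 0 < Gamma x.
Proof.
  intros Hx. destruct (Gamma_integrand_bounded x Hx) as [M HM].
  destruct (is_RInt_gen_monotone (Gamma_integrand x) M) as [l [H1 H2]]; auto.
  { intros; now apply Gamma_integrand_cont. } { intros; left; apply Gamma_integrand_pos. }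
  assert (E : Gamma x = l).
  { apply (is_RInt_gen_unique (V := R_CompleteNormedModule) (Fa := at_right 0) (Fb := Rbar_locally p_infty) (Gamma_integrand x) l H1). }
  rewrite E. split; auto. apply Rlt_le_trans with (RInt (Gamma_integrand x) 1 2); [|apply H2; lra].
  apply RInt_gt_0; [lra|intros; apply Gamma_integrand_pos|intros; apply Gamma_integrand_cont; lra].
Qed.

(** Integration by parts: g(t) = t^x e^(-t) has derivative x times the integrand for x minus the
    integrand for x + 1, and g vanishes at both ends. *)
Lemma Gamma_S x : 0 < x -> Gamma (x + 1) = x * Gamma x.
Proof.
  intros Hx. set (g := fun t => Rpower t x * exp (- t)).
  set (K := exp (x * ln (2 * x))).
  assert (HK : 0 < K) by apply exp_pos.
  assert (Hd : forall t, 0 < t -> is_derive g t (x * Gamma_integrand x t - Gamma_integrand (x + 1) t)).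
  { intros t Ht. unfold g, Gamma_integrand, Rpower. auto_derive; [auto|].
    replace (x * ln t) with (ln t + (x - 1) * ln t) by ring.
    replace ((x + 1 - 1) * ln t) with (ln t + (x - 1) * ln t) by ring.
    rewrite exp_plus, exp_ln by lra. field. lra. }
  assert (Hlt : filter_prod (at_right 0) (Rbar_locally p_infty)
     (fun ab : R * R => 0 < Rmin (fst ab) (snd ab))).
  { apply Filter_prod with (fun a => 0 < a) (fun b => 0 < b).
    - exists (mkposreal 1 Rlt_0_1). intros y _ Hy; exact Hy.
    - exists 0. auto.
    - intros a b Ha Hb. simpl. now apply Rmin_glb_lt. }
  assert (H0 : is_RInt_gen (Derive g) (at_right 0) (Rbar_locally p_infty) (0 - 0)).
  { apply (is_RInt_gen_Derive (Fa := at_right 0) (Fb := Rbar_locally p_infty)).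
    - revert Hlt. apply filter_imp. intros ab Hab t Ht. eexists. apply Hd. lra.
    - revert Hlt. apply filter_imp. intros ab Hab t Ht.
      apply (continuous_ext_loc (T := R_UniformSpace) (U := R_UniformSpace) (Derive g) (fun t => x * Gamma_integrand x t - Gamma_integrand (x + 1) t)).
      + assert (Ht0 : 0 < t) by lra. exists (mkposreal t Ht0). intros y Hy. symmetry.
        apply is_derive_unique, Hd. apply Rabs_lt_between' in Hy. simpl in Hy. lra.
      + apply (continuous_minus (V := R_NormedModule)).
        * apply (continuous_scal_r (V := R_NormedModule)). apply Gamma_integrand_cont; lra.
        * apply Gamma_integrand_cont; lra.
    (* The radius is eps^(1/x), below which t^x < eps. *)
    - apply filterlim_locally. intros eps. exists (mkposreal _ (exp_pos (ln eps / x))).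
      intros t Ht Ht0. apply Rabs_lt_between' in Ht. simpl in Ht.
      assert (G : 0 < g t) by (apply Rmult_lt_0_compat; apply exp_pos).
      assert (g t < eps).
      { apply Rle_lt_trans with (Rpower t x).
        - unfold g. rewrite <- (Rmult_1_r (Rpower t x)) at 2. apply Rmult_le_compat_l; [left; apply exp_pos|].
          rewrite <- exp_0. left; apply exp_increasing; lra.
        - rewrite <- (exp_ln eps) by apply cond_pos. unfold Rpower. apply exp_increasing.
          assert (L : ln t < ln eps / x) by (apply exp_lt_inv; rewrite exp_ln; lra).
          apply Rmult_lt_compat_l with (r := x) in L; auto.
          replace (x * (ln eps / x)) with (ln eps) in L by (field; lra). exact L. }
      apply Rabs_lt_between'. lra.
    (* Beyond this point K e^(-t/2) < eps. *)
    - apply filterlim_locally. intros eps. exists (Rmax 0 (- 2 * ln (eps / K))).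
      intros t Ht.
      assert (Ht0 : 0 < t) by (eapply Rle_lt_trans; [apply Rmax_l|exact Ht]).
      assert (Ht1 : - 2 * ln (eps / K) < t) by (eapply Rle_lt_trans; [apply Rmax_r|exact Ht]).
      assert (G : 0 < g t) by (apply Rmult_lt_0_compat; apply exp_pos).
      assert (g t < eps).
      { apply Rle_lt_trans with (K * exp (- t / 2)).
        - unfold g. replace (- t / 2) with (t / 2 + - t) by field. rewrite exp_plus, <- Rmult_assoc.
          apply Rmult_le_compat_r; [left; apply exp_pos|]. now apply Rpower_le_exp.
        - assert (He : 0 < eps / K) by (apply Rdiv_lt_0_compat; [apply cond_pos|auto]).
          replace (pos eps) with (K * exp (ln (eps / K))) by (rewrite exp_ln by auto; field; lra).
          apply Rmult_lt_compat_l; auto. apply exp_increasing. lra. }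
      apply Rabs_lt_between'. lra. }
  destruct (Gamma_correct x Hx) as [H1 _]. destruct (Gamma_correct (x + 1) ltac:(lra)) as [H2 _].
  pose proof (is_RInt_gen_minus _ _ _ _ (is_RInt_gen_scal _ x _ H1) H2) as H3.
  apply (is_RInt_gen_ext _ (Derive g)) in H3.
  - pose proof (is_RInt_gen_unique (V := R_CompleteNormedModule) (Fa := at_right 0) (Fb := Rbar_locally p_infty) _ _ H0) as U0.
    pose proof (is_RInt_gen_unique (V := R_CompleteNormedModule) (Fa := at_right 0) (Fb := Rbar_locally p_infty) _ _ H3) as U3.
    rewrite U0 in U3. change (0 - 0 = x * Gamma x - Gamma (x + 1)) in U3. lra.
  - revert Hlt. apply filter_imp. intros ab Hab t Ht. symmetry. apply is_derive_unique, Hd. lra.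
Qed.

(** * Growth of the numbers alpha *)

Section Alpha.
Variables (r : nat) (gamma : nat -> R).
Hypothesis hr : (2 <= r)%nat.
Hypothesis hgamma : forall k, (1 <= k <= r - 1)%nat -> 0 < gamma k + 1.

Definition shifted_product (l : list nat) (x : R) : R := fold_right Rmult 1 (map (fun i => gamma i + x) l).

(** This is alpha (n+1) / alpha n, and also the factor in B_r z^(r (n+1)) = [ratio n] z^(r n); this
    coincidence makes B_r the backward shift. *)
Definition ratio (n : nat) : R := INR r ^ r * INR (S n) * shifted_product (seq 1 (r - 1)) (INR (S n)).

Lemma in_seq_gamma i : In i (seq 1 (r - 1)) -> 0 < gamma i + 1.
Proof. intros H. apply in_seq in H. apply hgamma. lia. Qed.

(** For x >= 1 each factor gamma i + x lies between min(1, gamma i + 1) x and (1 + |gamma i|) x. *)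
Lemma shifted_product_bounds l : (forall i, In i l -> 0 < gamma i + 1) -> exists A B, 0 < A /\ 0 < B /\
  forall x, 1 <= x -> A * x ^ length l <= shifted_product l x <= B * x ^ length l.
Proof.
  induction l as [|i l IH]; intros H.
  - exists 1, 1. unfold shifted_product; simpl. repeat split; lra.
  - destruct IH as [A [B [HA [HB HAB]]]]; [intros; apply H; now right|].
    assert (Hi : 0 < gamma i + 1) by (apply H; now left).
    exists (Rmin 1 (gamma i + 1) * A), ((1 + Rabs (gamma i)) * B).
    assert (Hm : 0 < Rmin 1 (gamma i + 1)) by (apply Rmin_glb_lt; lra).
    pose proof (Rabs_pos (gamma i)) as Hg.
    split; [now apply Rmult_lt_0_compat|]. split; [apply Rmult_lt_0_compat; lra|].
    intros x Hx. destruct (HAB x Hx) as [L U]. unfold shifted_product in *. simpl.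
    assert (Hxl : 0 < x ^ length l) by (apply pow_lt; lra).
    assert (0 < A * x ^ length l) by (apply Rmult_lt_0_compat; auto).
    assert (L1 : Rmin 1 (gamma i + 1) * x <= gamma i + x).
    { destruct (Rle_dec 0 (gamma i)).
      - rewrite Rmin_left by lra. lra.
      - rewrite Rmin_right by lra. nra. }
    assert (U1 : gamma i + x <= (1 + Rabs (gamma i)) * x).
    { pose proof (Rle_abs (gamma i)). nra. }
    assert (0 < Rmin 1 (gamma i + 1) * x) by (apply Rmult_lt_0_compat; lra).
    split.
    + replace (Rmin 1 (gamma i + 1) * A * (x * x ^ length l)) with ((Rmin 1 (gamma i + 1) * x) * (A * x ^ length l)) by ring.
      apply Rmult_le_compat; lra.
    + replace ((1 + Rabs (gamma i)) * B * (x * x ^ length l)) with (((1 + Rabs (gamma i)) * x) * (B * x ^ length l)) by ring.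
      apply Rmult_le_compat; lra.
Qed.

Lemma alpha_0 : alpha r gamma 0 = 1.
Proof.
  unfold alpha. rewrite Nat.mul_0_r. simpl fact. simpl pow. simpl INR.
  assert (H := in_seq_gamma). induction (seq 1 (r - 1)) as [|i l IH]; simpl; [ring|].
  assert (Hi : 0 < gamma i + 1) by (apply H; now left).
  rewrite Rplus_0_r. destruct (Gamma_correct (gamma i + 1) Hi) as [_ HG].
  unfold Rdiv at 1. rewrite Rinv_r, !Rmult_1_l by lra.
  rewrite !Rmult_1_l in IH. apply IH. intros; apply H; now right.
Qed.

Lemma alpha_S n : alpha r gamma (S n) = ratio n * alpha r gamma n.
Proof.
  unfold alpha, ratio. rewrite Nat.mul_succ_r, pow_add. rewrite fact_simpl, mult_INR.
  assert (E : fold_right Rmult 1 (map (fun i => Gamma (gamma i + INR (S n) + 1) / Gamma (gamma i + 1)) (seq 1 (r - 1))) =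
    shifted_product (seq 1 (r - 1)) (INR (S n)) * fold_right Rmult 1 (map (fun i => Gamma (gamma i + INR n + 1) / Gamma (gamma i + 1)) (seq 1 (r - 1)))).
  { assert (H := in_seq_gamma). unfold shifted_product. induction (seq 1 (r - 1)) as [|i l IH]; cbn [map fold_right]; [ring|].
    rewrite IH by (intros; apply H; now right).
    assert (Hi : 0 < gamma i + 1) by (apply H; now left).
    pose proof (pos_INR n).
    replace (gamma i + INR (S n)) with (gamma i + INR n + 1) by (rewrite S_INR; ring).
    rewrite (Gamma_S (gamma i + INR n + 1)) by lra. unfold Rdiv. ring. }
  rewrite E. ring.
Qed.

Lemma ratio_bounds : exists A B, 0 < A /\ 0 < B /\ forall n, A * INR (S n) ^ r <= ratio n <= B * INR (S n) ^ r.
Proof.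
  destruct (shifted_product_bounds (seq 1 (r - 1)) in_seq_gamma) as [A [B [HA [HB H]]]].
  assert (Hr : 0 < INR r ^ r) by (apply pow_lt, lt_0_INR; lia).
  exists (INR r ^ r * A), (INR r ^ r * B).
  split; [now apply Rmult_lt_0_compat|]. split; [now apply Rmult_lt_0_compat|].
  intros n. rewrite length_seq in H.
  assert (Hn : 1 <= INR (S n)) by (rewrite S_INR; pose proof (pos_INR n); lra).
  destruct (H (INR (S n)) Hn) as [L U]. unfold ratio.
  assert (E : INR (S n) ^ r = INR (S n) * INR (S n) ^ (r - 1)).
  { replace r with (S (r - 1)) at 1 by lia. reflexivity. }
  rewrite E. split.
  - replace (INR r ^ r * A * (INR (S n) * INR (S n) ^ (r - 1))) with (INR r ^ r * INR (S n) * (A * INR (S n) ^ (r - 1))) by ring.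
    apply Rmult_le_compat_l; auto. apply Rmult_le_pos; lra.
  - replace (INR r ^ r * B * (INR (S n) * INR (S n) ^ (r - 1))) with (INR r ^ r * INR (S n) * (B * INR (S n) ^ (r - 1))) by ring.
    apply Rmult_le_compat_l; auto. apply Rmult_le_pos; lra.
Qed.

(** Telescoping product of the quotients, each comparable to (k + 1)^r. *)
Lemma alpha_bounds : exists A B, 0 < A /\ 0 < B /\ forall n,
  A ^ n * INR (fact n) ^ r <= alpha r gamma n <= B ^ n * INR (fact n) ^ r.
Proof.
  destruct ratio_bounds as [A [B [HA [HB H]]]]. exists A, B. split; [auto|split; [auto|]].
  induction n as [|n [L U]].
  - rewrite alpha_0. simpl fact. simpl INR. rewrite pow1. simpl. lra.
  - rewrite alpha_S, fact_simpl, mult_INR, Rpow_mult_distr. simpl pow at 1 4.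
    destruct (H n) as [L1 U1].
    assert (Hf : 0 < INR (fact n) ^ r) by (apply pow_lt, INR_fact_lt_0).
    assert (Hs : 0 < INR (S n) ^ r) by (apply pow_lt, lt_0_INR; lia).
    assert (0 < A ^ n * INR (fact n) ^ r) by (apply Rmult_lt_0_compat; [now apply pow_lt|auto]).
    assert (0 < A * INR (S n) ^ r) by (now apply Rmult_lt_0_compat).
    simpl (A ^ S n); simpl (B ^ S n). split.
    + replace (A * A ^ n * (INR (S n) ^ r * INR (fact n) ^ r)) with ((A * INR (S n) ^ r) * (A ^ n * INR (fact n) ^ r)) by ring.
      apply Rmult_le_compat; lra.
    + replace (B * B ^ n * (INR (S n) ^ r * INR (fact n) ^ r)) with ((B * INR (S n) ^ r) * (B ^ n * INR (fact n) ^ r)) by ring.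
      apply Rmult_le_compat; lra.
Qed.

Lemma alpha_pos n : 0 < alpha r gamma n.
Proof.
  destruct alpha_bounds as [A [B [HA [HB H]]]]. destruct (H n) as [L _].
  eapply Rlt_le_trans; [|exact L]. apply Rmult_lt_0_compat; [now apply pow_lt|apply pow_lt, INR_fact_lt_0].
Qed.

(** The binomial coefficient of n + m over n is at most 2^(n+m), by Pascal's rule: the factor n + m
    of (n + m)! is split into its two summands. *)
Lemma fact_add_le n m : INR (fact (n + m)) <= 2 ^ (n + m) * (INR (fact n) * INR (fact m)).
Proof.
  remember (n + m)%nat as k eqn:Hk. revert n m Hk.
  induction k as [|k IH]; intros n m Hk.
  - assert (n = 0%nat) by lia. assert (m = 0%nat) by lia. subst. simpl. lra.
  - destruct n as [|n].
    { simpl in Hk. subst m. change (INR (fact 0)) with 1.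
      assert (1 <= 2 ^ S k) by (apply pow_R1_Rle; lra). pose proof (INR_fact_lt_0 (S k)). nra. }
    destruct m as [|m].
    { rewrite Nat.add_0_r in Hk. rewrite <- Hk. change (INR (fact 0)) with 1.
      assert (1 <= 2 ^ S k) by (apply pow_R1_Rle; lra). pose proof (INR_fact_lt_0 (S k)). nra. }
    pose proof (IH n (S m) ltac:(lia)) as H1. pose proof (IH (S n) m ltac:(lia)) as H2.
    rewrite fact_simpl, mult_INR.
    replace (INR (S k)) with (INR (S n) + INR (S m)) by (rewrite <- plus_INR; f_equal; lia).
    rewrite (fact_simpl n), (fact_simpl m), !mult_INR in *.
    assert (0 < INR (S n)) by (apply lt_0_INR; lia). assert (0 < INR (S m)) by (apply lt_0_INR; lia).
    assert (A1 : INR (S n) * INR (fact k) <= INR (S n) * (2 ^ k * (INR (fact n) * (INR (S m) * INR (fact m)))))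
      by (apply Rmult_le_compat_l; lra).
    assert (A2 : INR (S m) * INR (fact k) <= INR (S m) * (2 ^ k * (INR (S n) * INR (fact n) * INR (fact m))))
      by (apply Rmult_le_compat_l; lra).
    simpl pow. lra.
Qed.

Lemma alpha_add : exists Q, 1 <= Q /\ forall n m, alpha r gamma (n + m) <= Q ^ (n + m) * (alpha r gamma n * alpha r gamma m).
Proof.
  destruct alpha_bounds as [A [B [HA [HB H]]]].
  assert (H2r : 0 < 2 ^ r) by (apply pow_lt; lra).
  exists (Rmax 1 (B * 2 ^ r / A)). split; [apply Rmax_l|]. intros n m.
  assert (HQ : 0 < B * 2 ^ r / A) by (apply Rdiv_lt_0_compat; auto; now apply Rmult_lt_0_compat).
  pose proof (alpha_pos n). pose proof (alpha_pos m).
  apply Rle_trans with ((B * 2 ^ r / A) ^ (n + m) * (alpha r gamma n * alpha r gamma m)).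
  2:{ apply Rmult_le_compat_r; [apply Rmult_le_pos; lra|]. apply pow_incr. split; [lra|apply Rmax_r]. }
  destruct (H (n + m)%nat) as [_ U]. destruct (H n) as [Ln _]. destruct (H m) as [Lm _].
  pose proof (fact_add_le n m) as F.
  assert (F2 : INR (fact (n + m)) ^ r <= (2 ^ (n + m) * (INR (fact n) * INR (fact m))) ^ r).
  { apply pow_incr. split; [left; apply INR_fact_lt_0|auto]. }
  rewrite !Rpow_mult_distr in F2. rewrite <- pow_mult, Nat.mul_comm, pow_mult in F2.
  assert (HBn : 0 < B ^ (n + m)) by now apply pow_lt.
  assert (HAn : 0 < A ^ (n + m)) by now apply pow_lt.
  apply Rle_trans with (B ^ (n + m) * ((2 ^ r) ^ (n + m) * (INR (fact n) ^ r * INR (fact m) ^ r))).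
  { eapply Rle_trans; [exact U|]. apply Rmult_le_compat_l; lra. }
  assert (Hnm : (A ^ n * INR (fact n) ^ r) * (A ^ m * INR (fact m) ^ r) <= alpha r gamma n * alpha r gamma m).
  { apply Rmult_le_compat; auto; apply Rmult_le_pos; apply pow_le; try lra; left; apply INR_fact_lt_0. }
  assert (E : B ^ (n + m) * ((2 ^ r) ^ (n + m) * (INR (fact n) ^ r * INR (fact m) ^ r)) =
    (B * 2 ^ r / A) ^ (n + m) * ((A ^ n * INR (fact n) ^ r) * (A ^ m * INR (fact m) ^ r))).
  { unfold Rdiv. rewrite !Rpow_mult_distr, pow_inv. rewrite (pow_add A). field.
    split; apply pow_nonzero; lra. }
  rewrite E. apply Rmult_le_compat_l; [apply pow_le; lra|auto].
Qed.

Lemma pow_le_fact_exp y n : 0 <= y -> y ^ n <= INR (fact n) * exp y.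
Proof.
  intros Hy. pose proof (exp_ge_taylor y n Hy) as H.
  assert (Hn : y ^ n / INR (fact n) <= sum_f_R0 (fun k => y ^ k / INR (fact k)) n).
  { destruct n; [simpl; lra|]. rewrite tech5.
    assert (0 <= sum_f_R0 (fun k => y ^ k / INR (fact k)) n); [|lra].
    apply cond_pos_sum. intros k. apply Rmult_le_pos; [now apply pow_le|]. left. apply Rinv_0_lt_compat, INR_fact_lt_0. }
  pose proof (INR_fact_lt_0 n).
  apply Rmult_le_reg_r with (/ INR (fact n)); [now apply Rinv_0_lt_compat|].
  replace (INR (fact n) * exp y * / INR (fact n)) with (exp y) by (field; lra). unfold Rdiv in Hn. lra.
Qed.

Lemma exp_pow y n : exp y ^ n = exp (INR n * y).
Proof.
  induction n; [simpl; now rewrite Rmult_0_l, exp_0|].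
  rewrite S_INR. simpl. rewrite IHn, <- exp_plus. f_equal. ring.
Qed.

(** The r-th power of (K y)^n <= n! e^(K y), with K so large that K^r A >= 1. It turns geometric
    bounds on b n into exponential type. *)
Lemma alpha_exp : exists K, 0 < K /\ forall n y, 0 <= y -> y ^ (r * n) <= alpha r gamma n * exp (K * y).
Proof.
  destruct alpha_bounds as [A [B [HA [HB H]]]].
  set (K := Rmax 1 (/ A)). assert (HK : 1 <= K) by apply Rmax_l.
  exists (INR r * K). split; [apply Rmult_lt_0_compat; [apply lt_0_INR; lia|lra]|].
  intros n y Hy. destruct (H n) as [L _].
  assert (HKA : 1 <= K ^ r * A).
  { apply Rle_trans with (K * A).
    - apply Rle_trans with (/ A * A); [rewrite Rinv_l; lra|]. apply Rmult_le_compat_r; [lra|apply Rmax_r].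
    - apply Rmult_le_compat_r; [lra|]. rewrite <- (pow_1 K) at 1. apply Rle_pow; [lra|lia]. }
  assert (HKAn : 1 <= (K ^ r * A) ^ n) by now apply pow_R1_Rle.
  pose proof (pow_le_fact_exp (K * y) n ltac:(apply Rmult_le_pos; lra)) as P.
  assert (P2 : ((K * y) ^ n) ^ r <= (INR (fact n) * exp (K * y)) ^ r).
  { apply pow_incr. split; [|auto]. apply pow_le, Rmult_le_pos; lra. }
  rewrite (Rpow_mult_distr (INR (fact n))), exp_pow in P2.
  assert (Hyn : 0 <= y ^ (r * n)) by now apply pow_le.
  apply Rle_trans with (A ^ n * INR (fact n) ^ r * exp (INR r * K * y)).
  2:{ apply Rmult_le_compat_r; [left; apply exp_pos|auto]. }
  apply Rle_trans with ((K ^ r * A) ^ n * y ^ (r * n)); [rewrite <- (Rmult_1_l (y ^ (r * n))) at 1; apply Rmult_le_compat_r; auto|].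
  replace ((K ^ r * A) ^ n * y ^ (r * n)) with (A ^ n * ((K * y) ^ n) ^ r).
  2:{ rewrite !Rpow_mult_distr, <- !pow_mult, (Nat.mul_comm n r). ring. }
  rewrite (Rmult_assoc (A ^ n)). apply Rmult_le_compat_l; [apply pow_le; lra|].
  replace (INR r * K * y) with (INR r * (K * y)) by ring. exact P2.
Qed.

(** From n! <= (n + 1)^n. It is shaped for Cauchy's estimate on the circle of radius n + 1, which
    stays positive at n = 0. *)
Lemma alpha_le_pow : exists B, 0 < B /\ forall n, alpha r gamma n <= B ^ n * INR (S n) ^ (r * n).
Proof.
  destruct alpha_bounds as [A [B [HA [HB H]]]]. exists B. split; auto. intros n.
  destruct (H n) as [_ U]. eapply Rle_trans; [exact U|]. apply Rmult_le_compat_l; [apply pow_le; lra|].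
  rewrite Nat.mul_comm, pow_mult. apply pow_incr. split; [left; apply INR_fact_lt_0|].
  clear. induction n; [simpl; lra|]. rewrite fact_simpl, mult_INR. cbn [pow].
  pose proof (pos_INR n). pose proof (INR_fact_lt_0 n).
  assert (L : INR (S n) <= INR (S (S n))) by (apply le_INR; lia).
  assert (INR (S n) ^ n <= INR (S (S n)) ^ n) by (apply pow_incr; split; [apply pos_INR|auto]).
  apply Rmult_le_compat; [apply pos_INR|lra|exact L|lra].
Qed.
End Alpha.

(** * Coordinates of r-even entire functions *)

(** Each block of r consecutive indices contains exactly one index congruent to j. *)
Lemma Csum_sparse (f : nat -> C) r j : (j < r)%nat ->
  (forall m, m mod r <> j -> f m = RtoC 0) ->
  forall N, Csum f (r * N) = Csum (fun n => f (r * n + j)%nat) N.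
Proof.
  intros Hj Hf N. induction N as [|N IH].
  - now rewrite Nat.mul_0_r.
  - rewrite Nat.mul_succ_r. simpl Csum. rewrite <- IH.
    assert (H : forall k, (k <= r)%nat -> Csum f (r * N + k) =
      (Csum f (r * N) + if (j <? k)%nat then f (r * N + j)%nat else RtoC 0)%C).
    { induction k as [|k IHk]; intros Hk.
      - rewrite Nat.add_0_r. simpl. ring.
      - rewrite Nat.add_succ_r. simpl Csum. rewrite IHk by lia.
        destruct (Nat.ltb_spec j k), (Nat.ltb_spec j (S k)); try lia.
        + rewrite (Hf (r * N + k)%nat); [ring|].
          rewrite Nat.mul_comm, Nat.add_comm, Nat.Div0.mod_add, Nat.mod_small; lia.
        + assert (j = k) by lia. subst. ring.
        + rewrite (Hf (r * N + k)%nat); [ring|].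
          rewrite Nat.mul_comm, Nat.add_comm, Nat.Div0.mod_add, Nat.mod_small; lia. }
    rewrite H by lia. destruct (Nat.ltb_spec j r); [auto|lia].
Qed.

Lemma is_Cseries_sparse (f : nat -> C) r j (l : C) : (j < r)%nat ->
  (forall m, m mod r <> j -> f m = RtoC 0) -> is_Cseries f l -> is_Cseries (fun n => f (r * n + j)%nat) l.
Proof.
  intros Hj Hf H. apply is_Cseries_Cmod. intros eps He.
  destruct (proj1 (is_Cseries_Cmod f l) H eps He) as [N HN]. exists N. intros n Hn.
  rewrite <- (Csum_sparse f r j Hj Hf). apply HN. nia.
Qed.

Lemma is_Cseries_single (f : nat -> C) n : (forall m, m <> n -> f m = RtoC 0) -> is_Cseries f (f n).
Proof.
  intros H. apply is_Cseries_Cmod. intros eps He. exists (S n). intros N HN.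
  assert (E : forall k, Csum f k = if (n <? k)%nat then f n else RtoC 0).
  { induction k; [reflexivity|]. simpl Csum. rewrite IHk.
    destruct (Nat.ltb_spec n k), (Nat.ltb_spec n (S k)); try lia.
    - rewrite (H k) by lia. ring.
    - assert (n = k) by lia. subst. ring.
    - rewrite (H k) by lia. ring. }
  rewrite E. destruct (Nat.ltb_spec n N); [|lia].
  replace (f n - f n)%C with (RtoC 0) by ring. now rewrite Cmod_0.
Qed.

Lemma cis_pow x n : (cis x ^ n)%C = cis (INR n * x).
Proof.
  induction n.
  - simpl. unfold cis. now rewrite Rmult_0_l, cos_0, sin_0.
  - rewrite S_INR. simpl Cpow. rewrite IHn. replace ((INR n + 1) * x) with (x + INR n * x) by ring.
    unfold cis, Cmult; simpl. rewrite cos_plus, sin_plus. f_equal; ring.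
Qed.

Lemma omega_pow r n : (omega r ^ n)%C = cis (INR n * (2 * PI / INR r)).
Proof. apply cis_pow. Qed.

Lemma omega_root r : (1 <= r)%nat -> (omega r ^ r)%C = RtoC 1.
Proof.
  intros Hr. rewrite omega_pow. replace (INR r * (2 * PI / INR r)) with (2 * PI).
  2:{ field. apply not_0_INR. lia. }
  rewrite cis_2PI. unfold cis. now rewrite cos_0, sin_0.
Qed.

(** For j = m mod r nonzero, the angle j PI / r lies strictly between 0 and PI, so cos (2 j PI / r)
    = 1 - 2 sin^2 (j PI / r) < 1. *)
Lemma omega_primitive r m : (1 <= r)%nat -> (omega r ^ m)%C = RtoC 1 -> m mod r = 0%nat.
Proof.
  intros Hr H. rewrite (Nat.div_mod m r) in H by lia.
  rewrite Cpow_add_r, Cpow_mult_r, omega_root, Cpow_1_l, Cmult_1_l in H by auto.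
  pose proof (Nat.mod_upper_bound m r ltac:(lia)) as Hb.
  destruct (Nat.eq_dec (m mod r) 0) as [|Hn]; auto. exfalso.
  set (j := (m mod r)%nat) in *. rewrite omega_pow in H.
  assert (Hc : cos (INR j * (2 * PI / INR r)) = 1) by (apply (f_equal fst) in H; exact H).
  assert (Hr0 : 0 < INR r) by (apply lt_0_INR; lia).
  assert (Hj0 : 0 < INR j) by (apply lt_0_INR; lia).
  assert (Hjr : INR j < INR r) by (apply lt_INR; lia).
  pose proof PI_RGT_0 as HPI.
  replace (INR j * (2 * PI / INR r)) with (2 * (INR j * PI / INR r)) in Hc by (field; lra).
  rewrite cos_2a_sin in Hc.
  assert (Hs : 0 < sin (INR j * PI / INR r)).
  { apply sin_gt_0.
    - apply Rdiv_lt_0_compat; auto. now apply Rmult_lt_0_compat.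
    - apply Rmult_lt_reg_r with (INR r); auto. unfold Rdiv. rewrite Rmult_assoc, Rinv_l by lra. nra. }
  nra.
Qed.

Section Coordinates.
Variables (r : nat) (gamma : nat -> R).
Hypothesis hr : (2 <= r)%nat.
Hypothesis hgamma : forall k, (1 <= k <= r - 1)%nat -> 0 < gamma k + 1.

Local Notation al := (alpha r gamma).
Local Notation B := (hyper_bessel r gamma).
Local Notation Bn := (hyper_bessel_iter r gamma).

Let al_pos n : 0 < al n. Proof. now apply alpha_pos. Qed.

Lemma al_nz n : RtoC (al n) <> RtoC 0.
Proof. intros H. apply RtoC_inj in H. pose proof (al_pos n). lra. Qed.

(** Powers R^n instead of R^(r n): the two conditions agree because R is arbitrary. *)
Definition coordinate_growth (a : nat -> C) := forall R, 0 < R -> exists M, forall n, Cmod (a n) * R ^ n <= M * al n.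

(* [a] is the sequence of coordinates of [u] in the system [z ^ (r n) / alpha n],
   on which the hyper-Bessel operator acts as the backward shift. *)
Definition coordinates (u : Hr r) (a : nat -> C) :=
  coordinate_growth a /\ forall z, is_Cseries (fun n => a n / al n * z ^ (r * n))%C (u z).

Definition taylor_coef (a : nat -> C) (m : nat) : C :=
  if (m mod r =? 0)%nat then (a (m / r)%nat / al (m / r)%nat)%C else RtoC 0.

Lemma taylor_coef_mul a n : taylor_coef a (r * n + 0) = (a n / al n)%C.
Proof.
  unfold taylor_coef. rewrite Nat.add_0_r, (Nat.mul_comm r), Nat.Div0.mod_mul, Nat.div_mul by lia. reflexivity.
Qed.

Lemma taylor_coef_other a m : m mod r <> 0%nat -> taylor_coef a m = RtoC 0.
Proof. intros H. unfold taylor_coef. destruct (Nat.eqb_spec (m mod r) 0); [contradiction|auto]. Qed.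

Lemma Cmod_div_al (c : C) n : Cmod (c / al n) = Cmod c / al n.
Proof. rewrite Cmod_div, Cmod_R, Rabs_pos_eq; auto using al_nz. left; apply al_pos. Qed.

Lemma Rdiv_le_al x M n : x <= M * al n -> x / al n <= M.
Proof.
  intros H. pose proof (al_pos n). apply Rmult_le_reg_r with (al n); auto.
  unfold Rdiv. rewrite Rmult_assoc, Rinv_l; lra.
Qed.

Lemma rapid_decay_taylor_coef a : coordinate_growth a -> rapid_decay (taylor_coef a).
Proof.
  intros Ha R HR. destruct (Ha (R ^ r) (pow_lt _ _ HR)) as [M HM].
  assert (HM0 : 0 <= M).
  { specialize (HM 0%nat). simpl in HM. pose proof (Cmod_ge_0 (a 0%nat)). pose proof (al_pos 0). nra. }
  exists M. intros m. unfold taylor_coef. destruct (Nat.eqb_spec (m mod r) 0) as [E|E].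
  - specialize (HM (m / r)%nat). rewrite <- pow_mult in HM.
    assert (Em : m = (r * (m / r))%nat) by (apply Nat.Div0.div_exact; auto).
    rewrite <- Em in HM. rewrite Cmod_div_al.
    replace (Cmod (a (m / r)%nat) / al (m / r) * R ^ m) with (Cmod (a (m / r)%nat) * R ^ m / al (m / r)) by (unfold Rdiv; ring).
    now apply Rdiv_le_al.
  - rewrite Cmod_0, Rmult_0_l. auto.
Qed.

Lemma is_Cseries_taylor_coef a z : coordinate_growth a -> is_Cseries (fun n => a n / al n * z ^ (r * n))%C (Cpseries (taylor_coef a) z).
Proof.
  intros Ha.
  refine (is_Cseries_ext _ _ _ _ (is_Cseries_sparse _ r 0 _ _ _ (Cpseries_spec (taylor_coef a) z (rapid_decay_taylor_coef a Ha)))).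
  - intros n. rewrite taylor_coef_mul, Nat.add_0_r. reflexivity.
  - lia.
  - intros m Hm. rewrite taylor_coef_other by auto. ring.
Qed.

Lemma even_Cpseries_taylor_coef a : coordinate_growth a -> even_order r (Cpseries (taylor_coef a)).
Proof.
  intros Ha k z Hk. apply Cpseries_unique; [now apply rapid_decay_taylor_coef|].
  refine (is_Cseries_ext _ _ _ _ (Cpseries_spec (taylor_coef a) z (rapid_decay_taylor_coef a Ha))).
  intros m. destruct (Nat.eq_dec (m mod r) 0) as [E|E].
  - assert (Em : m = (r * (m / r))%nat) by (apply Nat.Div0.div_exact; auto).
    f_equal. rewrite Cpow_mult_l, <- Cpow_mult_r, (Nat.mul_comm k), Em, <- Nat.mul_assoc, !Cpow_mult_r.
    rewrite omega_root by lia. rewrite !Cpow_1_l. ring.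
  - rewrite taylor_coef_other by auto. ring.
Qed.

Lemma coordinates_build a : coordinate_growth a -> exists u : Hr r, coordinates u a /\ Hr_fun u = Cpseries (taylor_coef a).
Proof.
  intros Ha. exists (mkHr (Cpseries (taylor_coef a)) (entire_Cpseries _ (rapid_decay_taylor_coef a Ha)) (even_Cpseries_taylor_coef a Ha)).
  split; [|reflexivity]. split; auto. intros z. simpl. now apply is_Cseries_taylor_coef.
Qed.

Lemma coordinates_inj u v a : coordinates u a -> coordinates v a -> u = v.
Proof.
  intros [_ Hu] [_ Hv]. apply Hr_ext. intros z. exact (is_Cseries_unique _ _ _ (Hu z) (Hv z)).
Qed.

Lemma coordinates_Cpseries u a : coordinates u a -> Hr_fun u = Cpseries (taylor_coef a).
Proof.
  intros H. destruct (coordinates_build a (proj1 H)) as [v [Hv E]]. now rewrite (coordinates_inj _ _ _ H Hv).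
Qed.

(** The substitution t = s^r turns both expansions into power series in a positive real variable. *)
Lemma coordinates_unique_real (f : C -> C) (a b : nat -> C) :
  (forall s : R, 0 < s -> is_Cseries (fun n => a n / al n * s ^ (r * n))%C (f s)) ->
  (forall s : R, 0 < s -> is_Cseries (fun n => b n / al n * s ^ (r * n))%C (f s)) -> a = b.
Proof.
  intros Ha Hb. apply functional_extensionality. intros n.
  assert (H : (a n / al n - b n / al n)%C = RtoC 0).
  { apply (power_series_zero 1 (fun n => a n / al n - b n / al n)%C Rlt_0_1). intros t Ht.
    set (s := Rpower t (/ INR r)).
    assert (Hs : s ^ r = t).
    { unfold s. rewrite <- Rpower_pow by apply exp_pos. rewrite Rpower_mult, Rinv_l, Rpower_1; try lra.
      apply not_0_INR. lia. }
    apply (is_Cseries_ext (fun n => a n / al n * RtoC s ^ (r * n) - b n / al n * RtoC s ^ (r * n))%C).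
    - intros k. rewrite Cpow_mult_r, <- RtoC_pow, Hs. ring.
    - replace (RtoC 0) with (f s - f s)%C by ring. apply is_Cseries_minus; [apply Ha|apply Hb]; apply exp_pos. }
  apply Cminus_eq_0_eq in H.
  replace (a n) with (a n / al n * al n)%C by (field; apply al_nz). rewrite H. field. apply al_nz.
Qed.

(** Invariance under z -> omega z multiplies the Taylor coefficient c m by omega^m, so uniqueness
    kills it unless r divides m. Cauchy's estimate is kept as a second clause for the study of
    exponential type. *)
Lemma coordinates_exists (u : Hr r) : exists a, coordinates u a /\
  forall rho M, 0 < rho -> (forall t, Cmod (u (rho * cis t)%C) <= M) ->
    forall n, Cmod (a n) * rho ^ (r * n) <= M * al n.
Proof.
  destruct (entire_expansion u (Hr_entire r u)) as [c [Hc [Ec Hest]]].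
  assert (Hm : forall m, m mod r <> 0%nat -> c m = RtoC 0).
  { intros m Hm.
    assert (E : (c m * omega r ^ m)%C = c m).
    { apply (power_series_unique 1 (fun z => u z) (fun m => c m * omega r ^ m)%C c Rlt_0_1).
      - intros z _. rewrite <- (Hr_even r u 1%nat z) by lia. rewrite Cpow_1_r, Ec.
        refine (is_Cseries_ext _ _ _ _ (Cpseries_spec c (omega r * z)%C Hc)).
        intros n. rewrite Cpow_mult_l. ring.
      - intros z _. rewrite Ec. now apply Cpseries_spec. }
    destruct (Ceq_dec (c m) 0) as [|Hn]; auto. exfalso. apply Hm, omega_primitive; [lia|].
    replace (omega r ^ m)%C with (/ c m * (c m * omega r ^ m))%C by (field; auto).
    rewrite E. field; auto. }
  exists (fun n => al n * c (r * n)%nat)%C.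
  assert (Hest' : forall rho M, 0 < rho -> (forall t, Cmod (u (rho * cis t)%C) <= M) ->
    forall n, Cmod (al n * c (r * n)%nat)%C * rho ^ (r * n) <= M * al n).
  { intros rho M Hr HM n. rewrite Cmod_mult, Cmod_R, Rabs_pos_eq by (left; apply al_pos).
    specialize (Hest rho M Hr HM (r * n)%nat). pose proof (al_pos n).
    rewrite Rmult_assoc, (Rmult_comm (al n)). apply Rmult_le_compat_r; lra. }
  split; [split|exact Hest'].
  (* The estimate carries R^(r n), which dominates R^n once R >= 1. *)
  - intros R HR. set (R' := Rmax 1 R).
    assert (HR' : 1 <= R') by apply Rmax_l.
    destruct (circle_bound u R' (Hr_entire r u)) as [M [_ HM]]. exists M. intros n.
    eapply Rle_trans; [|apply (Hest' R' M ltac:(lra) HM n)].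
    apply Rmult_le_compat_l; [apply Cmod_ge_0|].
    apply Rle_trans with (R' ^ n); [apply pow_incr; split; [lra|apply Rmax_r]|].
    apply Rle_pow; [auto|nia].
  - intros z. rewrite Ec.
    refine (is_Cseries_ext _ _ _ _ (is_Cseries_sparse _ r 0 _ _ _ (Cpseries_spec c z Hc))).
    + intros n. rewrite Nat.add_0_r. field. apply al_nz.
    + lia.
    + intros m Hm'. rewrite Hm by auto. ring.
Qed.

Lemma coordinates_unique (f : C -> C) (a b : nat -> C) :
  (forall z, is_Cseries (fun n => a n / al n * z ^ (r * n))%C (f z)) ->
  (forall z, is_Cseries (fun n => b n / al n * z ^ (r * n))%C (f z)) -> a = b.
Proof. intros Ha Hb. apply (coordinates_unique_real f); auto. Qed.

(** The positive half-line already determines the coordinates. *)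
Lemma Hr_eq_real (u v : Hr r) : (forall t : R, t <> 0 -> u t = v t) -> u = v.
Proof.
  intros H. destruct (coordinates_exists u) as [a [Ha _]], (coordinates_exists v) as [b [Hb _]].
  assert (E : a = b).
  { apply (coordinates_unique_real u).
    - intros s _. apply Ha.
    - intros s Hs. rewrite H by lra. apply Hb. }
  subst b. exact (coordinates_inj _ _ _ Ha Hb).
Qed.

(** Growth of [a] at radius 2 Q X: Q^(n+m) pays for splitting alpha (n + m), and 2^(n+m) yields the
    two geometric factors. *)
Lemma coordinate_growth_double a X : coordinate_growth a -> 0 < X -> exists M, 0 <= M /\ forall n m,
  Cmod (a (n + m)%nat) * X ^ n * X ^ m <= M * (/ 2) ^ n * (/ 2) ^ m * (al n * al m).
Proof.
  intros Ha HX. destruct (alpha_add r gamma hr hgamma) as [Q [HQ HA]].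
  destruct (Ha (2 * Q * X)) as [M HM]; [apply Rmult_lt_0_compat; lra|].
  assert (HM0 : 0 <= M).
  { specialize (HM 0%nat). simpl in HM. pose proof (Cmod_ge_0 (a 0%nat)). pose proof (al_pos 0). nra. }
  exists M. split; auto. intros n m. specialize (HM (n + m)%nat). specialize (HA n m).
  rewrite !Rpow_mult_distr in HM.
  assert (HQn : 0 < Q ^ (n + m)) by (apply pow_lt; lra).
  assert (H2n : 0 < (/ 2) ^ (n + m)) by (apply pow_lt; lra).
  assert (E2 : 2 ^ (n + m) * (/ 2) ^ (n + m) = 1) by (rewrite <- Rpow_mult_distr, Rinv_r, pow1; lra).
  apply Rmult_le_reg_r with (Q ^ (n + m)); auto.
  assert (S1 : Cmod (a (n + m)%nat) * (2 ^ (n + m) * Q ^ (n + m) * X ^ (n + m)) * (/ 2) ^ (n + m) <=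
    M * (Q ^ (n + m) * (al n * al m)) * (/ 2) ^ (n + m)).
  { apply Rmult_le_compat_r; [lra|]. eapply Rle_trans; [exact HM|]. now apply Rmult_le_compat_l. }
  replace (Cmod (a (n + m)%nat) * X ^ n * X ^ m * Q ^ (n + m)) with
    (Cmod (a (n + m)%nat) * (2 ^ (n + m) * Q ^ (n + m) * X ^ (n + m)) * (/ 2) ^ (n + m)).
  2:{ transitivity (Cmod (a (n + m)%nat) * (2 ^ (n + m) * (/ 2) ^ (n + m)) * Q ^ (n + m) * X ^ (n + m)); [ring|].
      rewrite E2, (pow_add X). ring. }
  eapply Rle_trans; [exact S1|]. rewrite (pow_add (/ 2)). right; ring.
Qed.

Lemma coordinate_growth_add a n : coordinate_growth a -> coordinate_growth (fun m => a (n + m)%nat).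
Proof.
  intros Ha R HR. destruct (coordinate_growth_double a R Ha HR) as [M [HM0 HM]].
  exists (M * al n / R ^ n). intros m. specialize (HM n m).
  assert (HRn : 0 < R ^ n) by now apply pow_lt.
  apply Rmult_le_reg_r with (R ^ n); auto.
  replace (M * al n / R ^ n * al m * R ^ n) with (M * 1 * 1 * (al n * al m)) by (field; lra).
  replace (Cmod (a (n + m)%nat) * R ^ m * R ^ n) with (Cmod (a (n + m)%nat) * R ^ n * R ^ m) by ring.
  eapply Rle_trans; [exact HM|]. pose proof (al_pos n). pose proof (al_pos m).
  assert (Hp : forall k, 0 <= (/ 2) ^ k <= 1).
  { intros k. split; [apply pow_le; lra|]. rewrite <- (pow1 k). apply pow_incr; lra. }
  apply Rmult_le_compat_r; [apply Rmult_le_pos; lra|].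
  rewrite !Rmult_assoc. apply Rmult_le_compat_l; auto.
  apply Rmult_le_compat; apply Hp.
Qed.

Lemma bessel_fold_Cpseries l c : rapid_decay c -> exists c', rapid_decay c' /\
  fold_right (fun i f => euler_op (INR r * gamma i + 1) f) (Cpseries c) l = Cpseries c' /\
  forall m, c' m = (RtoC (fold_right Rmult 1 (map (fun i => INR m + (INR r * gamma i + 1)) l))%R * c m)%C.
Proof.
  intros Hc. induction l as [|i l [c' [H1 [H2 H3]]]].
  - exists c. split; [auto|split; [auto|]]. intros; simpl; ring.
  - eexists. split; [|split].
    + exact (rapid_decay_lin (INR r * gamma i + 1) c' H1).
    + cbn [fold_right]. rewrite H2. now apply euler_op_Cpseries.
    + intros m. cbn [fold_right map]. rewrite H3, RtoC_mult, !RtoC_plus. ring.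
Qed.

(** After d/dz the monomial z^(r (n+1)) has exponent r n + (r - 1), and each Euler operator
    multiplies it by r n + (r - 1) + r gamma_i + 1 = r (gamma_i + n + 1). *)
Lemma bessel_coef n : fold_right Rmult 1 (map (fun i => INR (r * n + (r - 1)) + (INR r * gamma i + 1)) (seq 1 (r - 1)))
    * INR (S (r * n + (r - 1))) = ratio r gamma n.
Proof.
  replace (S (r * n + (r - 1))) with (r * S n)%nat by lia. rewrite mult_INR. unfold ratio, shifted_product.
  assert (E : INR (r * n + (r - 1)) + 1 = INR r * INR (S n)).
  { rewrite <- S_INR, <- mult_INR. f_equal. lia. }
  assert (P : forall l, fold_right Rmult 1 (map (fun i => INR (r * n + (r - 1)) + (INR r * gamma i + 1)) l) =
    INR r ^ length l * fold_right Rmult 1 (map (fun i => gamma i + INR (S n)) l)).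
  { induction l as [|i l IH]; cbn [fold_right map length pow]; [ring|]. rewrite IH.
    replace (INR (r * n + (r - 1)) + (INR r * gamma i + 1)) with (INR r * (gamma i + INR (S n))) by lra. ring. }
  assert (Er : INR r ^ r = INR r * INR r ^ (r - 1)).
  { change (INR r * INR r ^ (r - 1)) with (INR r ^ S (r - 1)). f_equal. lia. }
  rewrite P, length_seq, Er. ring.
Qed.

(** The Euler operators leave a series supported on exponents congruent to r - 1 modulo r. Division
    by z^(r-1) makes it a series in z^(r n), with coefficients [ratio n] a (n+1) / alpha (n+1) = a
    (n+1) / alpha n. *)
Lemma hyper_bessel_formula_coordinates u a v : coordinates u a -> coordinates v (fun n => a (S n)) ->
  forall z, z <> RtoC 0 -> v z = hyper_bessel_formula r gamma u z.
Proof.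
  intros Hu [_ Hv] z Hz.
  assert (Hc := rapid_decay_taylor_coef a (proj1 Hu)).
  destruct (bessel_fold_Cpseries (seq 1 (r - 1)) (derive_coef (taylor_coef a)) (rapid_decay_derive_coef _ Hc)) as [c' [H1 [H2 H3]]].
  unfold hyper_bessel_formula. rewrite (coordinates_Cpseries u a Hu), C_derive_Cpseries, H2 by auto.
  refine (is_Cseries_unique _ _ _ (Hv z) _).
  assert (Hj : forall m, m mod r <> (r - 1)%nat -> (c' m * z ^ m)%C = RtoC 0).
  { intros m Hm. rewrite H3. unfold derive_coef. rewrite taylor_coef_other; [ring|].
    intros E. apply Hm.
    assert (Em : S m = (r * (S m / r))%nat) by (apply Nat.Div0.div_exact; auto).
    destruct (S m / r)%nat as [|q]; [lia|].
    replace m with ((r - 1) + q * r)%nat by lia.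
    rewrite Nat.Div0.mod_add, Nat.mod_small; lia. }
  pose proof (is_Cseries_mult (/ z ^ (r - 1))%C _ _ (is_Cseries_sparse _ r (r - 1) _ ltac:(lia) Hj (Cpseries_spec c' z H1))) as H.
  revert H. apply is_Cseries_ext. intros n. rewrite H3. unfold derive_coef.
  replace (S (r * n + (r - 1))) with (r * S n + 0)%nat at 2 by lia. rewrite taylor_coef_mul.
  assert (Hz' : (z ^ (r - 1))%C <> RtoC 0) by now apply Cpow_nz.
  rewrite Cpow_add_r.
  pose proof (bessel_coef n) as Eb. apply (f_equal RtoC) in Eb. rewrite RtoC_mult in Eb.
  rewrite (alpha_S r gamma hr hgamma), RtoC_mult, <- Eb.
  assert (Hrat : RtoC (ratio r gamma n) <> RtoC 0).
  { intros E. apply RtoC_inj in E. pose proof (al_pos (S n)) as P. rewrite (alpha_S r gamma hr hgamma), E in P. lra. }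
  rewrite <- Eb in Hrat.
  field. repeat split; auto using al_nz; intros E; apply Hrat; rewrite E; ring.
Qed.

(* In the definition of [hyper_bessel] the bound variable [z] has type [R], so its
   defining equation is only available on the punctured real axis. *)
Lemma coordinates_bessel u a : coordinates u a -> coordinates (B u) (fun n => a (S n)).
Proof.
  intros Hu. destruct (coordinates_build (fun n => a (S n)) (coordinate_growth_add a 1 (proj1 Hu))) as [v [Hv _]].
  assert (E : B u = v).
  { assert (Hreal : forall (v : Hr r), coordinates v (fun n => a (S n)) ->
      forall t : R, t <> 0 -> v t = hyper_bessel_formula r gamma u t).
    { intros v' Hv' t Ht. apply hyper_bessel_formula_coordinates with a; auto.
      intros E. apply RtoC_inj in E. contradiction. }
    apply Hr_eq_real. intros t Ht. rewrite (Hreal v Hv t Ht).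
    refine (epsilon_spec (inhabits (Hr_zero r))
      (fun v : Hr r => forall t : R, t <> 0 -> v t = hyper_bessel_formula r gamma u t) _ t Ht).
    exists v. auto. }
  now rewrite E.
Qed.

Lemma coordinates_bessel_iter u a n : coordinates u a -> coordinates (Bn n u) (fun m => a (n + m)%nat).
Proof.
  intros Hu. induction n; [exact Hu|]. simpl. pose proof (coordinates_bessel _ _ IHn) as H.
  replace (fun m => a (S (n + m))) with (fun m => a (n + S m)%nat); [exact H|].
  apply functional_extensionality. intros m. f_equal. lia.
Qed.

Lemma is_Cseries_at_0 (a : nat -> C) : is_Cseries (fun n => a n / al n * RtoC 0 ^ (r * n))%C (a 0%nat).
Proof.
  pose proof (is_Cseries_head (fun n => a n / al n * RtoC 0 ^ (r * n))%C) as H.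
  replace (a 0%nat) with (a 0%nat / al 0 * RtoC 0 ^ (r * 0))%C.
  - apply H. intros n. replace (r * S n)%nat with (S (r * n + (r - 1))) by lia. simpl Cpow. ring.
  - rewrite Nat.mul_0_r, alpha_0 by auto. simpl. field.
Qed.

Lemma coordinates_at_0 u a : coordinates u a -> u (RtoC 0) = a 0%nat.
Proof. intros [_ H]. exact (is_Cseries_unique _ _ _ (H (RtoC 0)) (is_Cseries_at_0 a)). Qed.

Lemma bessel_iter_at_0 u a n : coordinates u a -> Bn n u (RtoC 0) = a n.
Proof. intros H. rewrite (coordinates_at_0 _ _ (coordinates_bessel_iter u a n H)). f_equal. lia. Qed.

(** One bound for all double series of the proof: [bb n] will be w^(r n), R^n or the symbol
    coefficient b n. [Z] exceeds both Y and |z|^r, so a single radius serves both indices. *)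
Lemma double_series_bound a (bb : nat -> C) Y X C0 : coordinate_growth a -> 0 < Y -> 0 <= X -> 0 <= C0 ->
  (forall n, Cmod (bb n) <= C0 * Y ^ n) ->
  exists M, 0 <= M /\ forall n m z, Cmod z <= X ->
    Cmod (bb n / al n * (a (n + m)%nat / al m * z ^ (r * m))) <= M * (/ 2) ^ n * (/ 2) ^ m.
Proof.
  intros Ha HY HX HC Hb. set (Z := Y + X ^ r).
  assert (HXr : 0 <= X ^ r) by now apply pow_le.
  destruct (coordinate_growth_double a Z Ha ltac:(unfold Z; lra)) as [M [HM0 HM]].
  exists (C0 * M). split; [now apply Rmult_le_pos|]. intros n m z Hz.
  rewrite !Cmod_mult, !Cmod_div_al, Cmod_pow.
  pose proof (al_pos n) as Pn. pose proof (al_pos m) as Pm.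
  assert (HZn : 0 <= Z ^ n) by (apply pow_le; unfold Z; lra).
  assert (B1 : Cmod (bb n) <= C0 * Z ^ n).
  { eapply Rle_trans; [apply Hb|]. apply Rmult_le_compat_l; auto. apply pow_incr. unfold Z; lra. }
  assert (B2 : Cmod z ^ (r * m) <= Z ^ m).
  { rewrite pow_mult. apply pow_incr. split; [apply pow_le, Cmod_ge_0|].
    apply Rle_trans with (X ^ r); [apply pow_incr; split; [apply Cmod_ge_0|auto]|unfold Z; lra]. }
  specialize (HM n m).
  replace (Cmod (bb n) / al n * (Cmod (a (n + m)%nat) / al m * Cmod z ^ (r * m)))
    with ((Cmod (bb n) * (Cmod (a (n + m)%nat) * Cmod z ^ (r * m))) * / (al n * al m)) by (field; lra).
  apply Rmult_le_reg_r with (al n * al m); [now apply Rmult_lt_0_compat|].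
  rewrite Rmult_assoc, Rinv_l, Rmult_1_r by (apply Rgt_not_eq; now apply Rmult_lt_0_compat).
  apply Rle_trans with ((C0 * Z ^ n) * (Cmod (a (n + m)%nat) * Z ^ m)).
  - apply Rmult_le_compat; auto using Cmod_ge_0.
    + apply Rmult_le_pos; [apply Cmod_ge_0|apply pow_le, Cmod_ge_0].
    + apply Rmult_le_compat_l; [apply Cmod_ge_0|auto].
  - replace (C0 * Z ^ n * (Cmod (a (n + m)%nat) * Z ^ m)) with (C0 * (Cmod (a (n + m)%nat) * Z ^ n * Z ^ m)) by ring.
    replace (C0 * M * (/ 2) ^ n * (/ 2) ^ m * (al n * al m)) with (C0 * (M * (/ 2) ^ n * (/ 2) ^ m * (al n * al m))) by ring.
    now apply Rmult_le_compat_l.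
Qed.

Lemma bessel_iter_bound (u : Hr r) (bb : nat -> C) Y X C0 : 0 < Y -> 0 <= X -> 0 <= C0 ->
  (forall n, Cmod (bb n) <= C0 * Y ^ n) ->
  exists M, 0 <= M /\ forall n z, Cmod z <= X -> Cmod (bb n / al n * Bn n u z) <= M * (/ 2) ^ n.
Proof.
  intros HY HX HC Hb. destruct (coordinates_exists u) as [a [Ha _]].
  destruct (double_series_bound a bb Y X C0 (proj1 Ha) HY HX HC Hb) as [M [HM0 HM]].
  exists (M * 2). split; [lra|]. intros n z Hz.
  pose proof (is_Cseries_mult (bb n / al n)%C _ _ (proj2 (coordinates_bessel_iter u a n Ha) z)) as S.
  pose proof (is_Cseries_bound (M * (/ 2) ^ n) (/ 2) ltac:(lra) _ _ (fun m => HM n m z Hz) S) as H.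
  replace (M * (/ 2) ^ n / (1 - / 2)) with (M * 2 * (/ 2) ^ n) in H by field. exact H.
Qed.

Lemma Cmod_pow_le_geometric (w : C) n : Cmod (w ^ (r * n)) <= 1 * ((Cmod w + 1) ^ r) ^ n.
Proof.
  rewrite Cmod_pow, pow_mult, Rmult_1_l. pose proof (Cmod_ge_0 w).
  apply pow_incr. split; [apply pow_le; lra|apply pow_incr; lra].
Qed.

(** The weights R^n in [bessel_iter_bound]. Hence n -> B_r^n u(z) is a coordinate sequence, and the
    choice defining [translation] has a witness. *)
Lemma coordinate_growth_bessel_iter u z : coordinate_growth (fun n => Bn n u z).
Proof.
  intros R HR.
  destruct (bessel_iter_bound u (fun n => RtoC (R ^ n)) R (Cmod z) 1) as [M [HM0 HM]]; try lra.
  { apply Cmod_ge_0. }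
  { intros n. rewrite Cmod_R, Rabs_pos_eq by (apply pow_le; lra). lra. }
  exists M. intros n. specialize (HM n z (Rle_refl _)).
  rewrite Cmod_mult, Cmod_div_al, Cmod_R, Rabs_pos_eq in HM by (apply pow_le; lra).
  pose proof (al_pos n).
  assert (Hp : (/ 2) ^ n <= 1) by (rewrite <- (pow1 n); apply pow_incr; lra).
  apply Rmult_le_reg_r with (/ al n); [now apply Rinv_0_lt_compat|].
  replace (M * al n * / al n) with M by (field; lra).
  replace (Cmod (Bn n u z) * R ^ n * / al n) with (R ^ n / al n * Cmod (Bn n u z)) by (unfold Rdiv; ring).
  eapply Rle_trans; [exact HM|]. nra.
Qed.

Lemma coordinates_translation u z : coordinates (translation r gamma z u) (fun n => Bn n u z).
Proof.
  pose proof (coordinate_growth_bessel_iter u z) as Hg. split; auto.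
  destruct (coordinates_build _ Hg) as [v [[_ Hv] _]].
  intros w.
  refine (is_Cseries_ext _ _ _ _ (epsilon_spec (inhabits (Hr_zero r))
    (fun v : Hr r => forall w : C, is_series (V := C_NormedModule)
       (fun n => w ^ (r * n) / al n * Bn n u z)%C (v w)) _ w)).
  - intros n. unfold Cdiv. ring.
  - exists v. intros w'. refine (is_Cseries_ext _ _ _ _ (Hv w')). intros n. unfold Cdiv. ring.
Qed.

(* Both sides equal the double sum of [a (n + m) w ^ (r n) z ^ (r m) / (alpha n alpha m)]. *)
Lemma translation_sym u z w : is_Cseries (fun n => z ^ (r * n) / al n * Bn n u w)%C (translation r gamma z u w).
Proof.
  destruct (coordinates_exists u) as [a [Ha _]].
  destruct (double_series_bound a (fun n => w ^ (r * n))%C ((Cmod w + 1) ^ r) (Cmod z) 1 (proj1 Ha)) as [M [HM0 HM]]; try lra.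
  { apply pow_lt. pose proof (Cmod_ge_0 w). lra. }
  { apply Cmod_ge_0. }
  { apply Cmod_pow_le_geometric. }
  apply (is_Cseries_swap M (/ 2) (fun n m => w ^ (r * n) / al n * (a (n + m)%nat / al m * z ^ (r * m)))%C
    (fun n => w ^ (r * n) / al n * Bn n u z)%C); try lra.
  - intros n m. apply HM; lra.
  - intros n. apply is_Cseries_mult. exact (proj2 (coordinates_bessel_iter u a n Ha) z).
  - intros m. refine (is_Cseries_ext _ _ _ _ (is_Cseries_mult (z ^ (r * m) / al m)%C _ _ (proj2 (coordinates_bessel_iter u a m Ha) w))).
    intros n. rewrite (Nat.add_comm m n). unfold Cdiv. ring.
  - refine (is_Cseries_ext _ _ _ _ (proj2 (coordinates_translation u z) w)). intros n. unfold Cdiv. ring.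
Qed.

Lemma translation_at_0 u z : translation r gamma z u (RtoC 0) = u z.
Proof. apply (coordinates_at_0 _ _ (coordinates_translation u z)). Qed.

(** By symmetry: the expansion in z reduces at z = 0 to its term n = 0, which is u(w). *)
Lemma translation_zero u : translation r gamma (RtoC 0) u = u.
Proof.
  apply Hr_ext. intros w. refine (is_Cseries_unique _ _ _ (translation_sym u (RtoC 0) w) _).
  refine (is_Cseries_ext _ _ _ _ (is_Cseries_at_0 (fun n => Bn n u w))). intros n. unfold Cdiv. ring.
Qed.

End Coordinates.

(** * Commutants of the hyper-Bessel operator *)

Lemma locally_Cmod (z : C) (P : C -> Prop) :
  locally (T := C_UniformSpace) z P <-> exists eps, 0 < eps /\ forall w : C, Cmod (w - z) < eps -> P w.
Proof.
  split.
  - intros H. apply locally_C in H. destruct H as [eps H]. exists eps. split; [apply cond_pos|exact H].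
  - intros [eps [He H]]. apply locally_C. exists (mkposreal eps He). exact H.
Qed.

(** Finitely many of the open discs of integer radius about 0 cover K. *)
Lemma compact_bounded (K : C -> Prop) : compact_set (X := C_UniformSpace) K ->
  exists X, 0 < X /\ forall z, K z -> Cmod z <= X.
Proof.
  intros H. destruct (H nat (fun n z => Cmod z < INR n)) as [l Hl].
  - intros n z Hz.
    assert (Hd : 0 < INR n - Cmod z) by lra.
    apply locally_Cmod. exists (INR n - Cmod z). split; [auto|]. intros w Hw.
    pose proof (Cmod_triangle z (w - z)) as T. replace (z + (w - z))%C with w in T by ring. lra.
  - intros z _. exists (Z.to_nat (up (Cmod z))). destruct (archimed (Cmod z)) as [A _].
    pose proof (Cmod_ge_0 z). rewrite INR_IZR_INZ, Z2Nat.id; [lra|]. apply le_IZR. lra.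
  - exists (INR (list_max l) + 1). pose proof (pos_INR (list_max l)). split; [lra|].
    intros z Hz. destruct (Hl z Hz) as [n [Hn Hzn]].
    assert (n <= list_max l)%nat.
    { pose proof (proj1 (list_max_le l (list_max l)) (Nat.le_refl _)) as F.
      rewrite Forall_forall in F. auto. }
    apply le_INR in H1. lra.
Qed.

Lemma compact_singleton (w : C) : compact_set (X := C_UniformSpace) (fun x => x = w).
Proof.
  intros I U _ HU. destruct (HU w eq_refl) as [i Hi]. exists (i :: nil).
  intros x ->. exists i. split; [now left|auto].
Qed.

Lemma Hr_eval_sum_n r (g : nat -> Hr r) w N : (sum_n g N : Hr r) w = Csum (fun n => g n w) (S N).
Proof.
  induction N as [|N IH].
  - rewrite sum_O. simpl. ring.
  - rewrite sum_Sn. change ((sum_n g N : Hr r) w + g (S N) w = Csum (fun n => g n w) (S N) + g (S N) w)%C.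
    now rewrite IH.
Qed.

(** Compact sets lie in discs, where the geometric majorant bounds the tail uniformly; [u] is
    already known as the pointwise sum. *)
Lemma Hr_series_converges r (g : nat -> Hr r) (u : Hr r) :
  (forall X, 0 < X -> exists M, 0 <= M /\ forall n w, Cmod w <= X -> Cmod (g n w) <= M * (/ 2) ^ n) ->
  (forall w, is_Cseries (fun n => g n w) (u w)) ->
  filterlim (fun N => sum_n g N) eventually (Hr_nbhs u).
Proof.
  intros Hg Hu P [K [HK [eps HP]]].
  destruct (compact_bounded K HK) as [X [HX HKX]]. destruct (Hg X HX) as [M [HM0 HM]].
  destruct (pow_small (2 * M) (/ 2) eps ltac:(lra) (cond_pos eps)) as [N HN].
  exists N. intros n Hn. apply HP. intros z Hz. rewrite Hr_eval_sum_n.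
  eapply Rle_lt_trans; [apply (is_Cseries_tail M (/ 2) ltac:(lra) _ _ _ (fun k => HM k z (HKX z Hz)) (Hu z))|].
  replace (M * (/ 2) ^ S n / (1 - / 2)) with (2 * M * (/ 2) ^ S n) by field. apply HN. lia.
Qed.

(** * Continuous linear functionals on the space of r-even entire functions *)

Section Dual.
Variables (r : nat) (T : Hr r -> C).
Hypothesis HT : Hr_dual T.

Lemma dual_plus (u v : Hr r) : T (Hr_plus r u v) = (T u + T v)%C.
Proof. apply (proj1 (proj1 HT)). Qed.

Lemma dual_scal c (u : Hr r) : T (Hr_scal r c u) = (c * T u)%C.
Proof. apply (proj2 (proj1 HT)). Qed.

Lemma dual_series (g : nat -> Hr r) (u : Hr r) :
  filterlim (fun N => sum_n g N) eventually (Hr_nbhs u) -> is_Cseries (fun n => T (g n)) (T u).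
Proof.
  intros H. pose proof (filterlim_comp _ _ _ _ T _ _ _ H (proj2 HT u)) as HC.
  revert HC. apply filterlim_ext. intros N. induction N as [|N IH].
  - now rewrite !sum_O.
  - rewrite !sum_Sn, <- IH. apply dual_plus.
Qed.

(** Continuity at 0 gives a compact set and an eps on which |T| < 1; the set is enlarged to a disc,
    and homogeneity does the rest. *)
Lemma dual_bound : exists X C0, 0 < X /\ 0 < C0 /\ forall (v : Hr r) M, 0 < M ->
  (forall w, Cmod w <= X -> Cmod (v w) <= M) -> Cmod (T v) <= C0 * M.
Proof.
  assert (T0 : T (Hr_zero r) = RtoC 0).
  { replace (Hr_zero r) with (Hr_scal r 0 (Hr_zero r)) by (apply Hr_ext; intros; simpl; ring).
    rewrite dual_scal. ring. }
  assert (H : Hr_nbhs (Hr_zero r) (fun v => Cmod (T v - T (Hr_zero r)) < 1)).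
  { apply (proj2 HT (Hr_zero r) (fun y => Cmod (y - T (Hr_zero r)) < 1)).
    apply locally_Cmod. exists 1. split; [lra|auto]. }
  destruct H as [K [HK [eps HP]]].
  destruct (compact_bounded K HK) as [X [HX HKX]]. pose proof (cond_pos eps) as He.
  exists X, (2 / eps). split; [auto|split; [apply Rdiv_lt_0_compat; lra|]].
  intros v M HM Hv.
  (* Scaling by [s] brings [v] below eps / 2 on the disc, strictly inside the neighbourhood. *)
  set (s := eps / (2 * M)). assert (Hs : 0 < s) by (apply Rdiv_lt_0_compat; lra).
  assert (H1 : Cmod (T (Hr_scal r s v) - T (Hr_zero r)) < 1).
  { apply HP. intros z Hz. simpl. replace (s * v z - 0)%C with (s * v z)%C by ring.
    rewrite Cmod_mult, Cmod_R, Rabs_pos_eq by lra. specialize (Hv z (HKX z Hz)).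
    apply Rle_lt_trans with (s * M); [apply Rmult_le_compat_l; lra|].
    unfold s. replace (eps / (2 * M) * M) with (eps / 2) by (field; lra). lra. }
  rewrite T0, dual_scal in H1. replace (s * T v - 0)%C with (s * T v)%C in H1 by ring.
  rewrite Cmod_mult, Cmod_R, Rabs_pos_eq in H1 by lra.
  apply Rmult_le_reg_l with s; auto. replace (s * (2 / eps * M)) with 1 by (unfold s; field; lra). lra.
Qed.
End Dual.

Lemma Hr_eval_continuous r (v : Hr r) w :
  filterlim (fun u : Hr r => u w) (Hr_nbhs v) (locally (T := C_UniformSpace) (v w)).
Proof.
  intros P HP. apply locally_Cmod in HP. destruct HP as [eps [He HP]].
  exists (fun x => x = w). split; [apply compact_singleton|].
  exists (mkposreal eps He). intros u Hu. now apply HP, Hu.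
Qed.

(** At w = 0 this is the functional representing [L]; general w turns convergence in H_r into
    pointwise identities for [L]. *)
Lemma eval_dual r (L : Hr r -> Hr r) w : Hr_endo L -> Hr_dual (fun u => L u w).
Proof.
  intros [[Hp Hs] Hc]. split; [split|].
  - intros x y. now rewrite Hp.
  - intros k x. now rewrite Hs.
  - intros u. exact (filterlim_comp _ _ _ L (fun v : Hr r => v w) _ _ _ (Hc u) (Hr_eval_continuous r (L u) w)).
Qed.

(** * Symbols, convolutions and commutation with the hyper-Bessel operator *)

Section Main.
Variables (r : nat) (gamma : nat -> R).
Hypothesis hr : (2 <= r)%nat.
Hypothesis hgamma : forall k, (1 <= k <= r - 1)%nat -> 0 < gamma k + 1.

Local Notation al := (alpha r gamma).
Local Notation B := (hyper_bessel r gamma).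
Local Notation Bn := (hyper_bessel_iter r gamma).

Lemma monomial_ex n : exists v : Hr r, forall z, v z = (z ^ (r * n))%C.
Proof.
  set (a := fun k => if (k =? n)%nat then RtoC (al n) else RtoC 0).
  assert (Ha : coordinate_growth r gamma a).
  { intros R HR. exists (R ^ n). intros k. pose proof (alpha_pos r gamma hr hgamma k). pose proof (pow_lt R n HR).
    unfold a. destruct (Nat.eqb_spec k n) as [->|].
    - rewrite Cmod_R, Rabs_pos_eq; lra.
    - rewrite Cmod_0, Rmult_0_l. apply Rmult_le_pos; lra. }
  destruct (coordinates_build r gamma hr hgamma a Ha) as [v [[_ Hv] _]]. exists v. intros z.
  refine (is_Cseries_unique _ _ _ (Hv z) _).
  replace (z ^ (r * n))%C with (a n / al n * z ^ (r * n))%C.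
  - apply (is_Cseries_single (fun k => a k / al k * z ^ (r * k))%C). intros m Hm. unfold a.
    destruct (Nat.eqb_spec m n); [contradiction|]. unfold Cdiv. ring.
  - unfold a. rewrite Nat.eqb_refl. field. now apply al_nz.
Qed.

Definition monomial n : Hr r :=
  epsilon (inhabits (Hr_zero r)) (fun v : Hr r => forall z : C, v z = (z ^ (r * n))%C).

Lemma monomialE n (z : C) : monomial n z = (z ^ (r * n))%C.
Proof.
  apply (epsilon_spec (inhabits (Hr_zero r)) (fun v : Hr r => forall z : C, v z = (z ^ (r * n))%C)).
  apply monomial_ex.
Qed.

Lemma bessel_iter_succ_r n u : Bn n (B u) = Bn (S n) u.
Proof. unfold hyper_bessel_iter. now rewrite Nat.iter_succ_r. Qed.

Lemma bessel_series_converges (bb : nat -> C) Y C0 (u v : Hr r) : 0 < Y -> 0 <= C0 ->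
  (forall n, Cmod (bb n) <= C0 * Y ^ n) ->
  (forall z, is_Cseries (fun n => bb n / al n * Bn n u z)%C (v z)) ->
  filterlim (fun N => sum_n (fun n => Hr_scal r (bb n / al n)%C (Bn n u)) N) eventually (Hr_nbhs v).
Proof.
  intros HY HC Hb Hv. apply Hr_series_converges; [|exact Hv].
  intros X HX. exact (bessel_iter_bound r gamma hr hgamma u bb Y X C0 HY (Rlt_le _ _ HX) HC Hb).
Qed.

Lemma translation_series u (z : C) :
  filterlim (fun N => sum_n (fun n => Hr_scal r (z ^ (r * n) / al n)%C (Bn n u)) N) eventually
    (Hr_nbhs (translation r gamma z u)).
Proof.
  apply (bessel_series_converges (fun n => z ^ (r * n))%C ((Cmod z + 1) ^ r) 1).
  - apply pow_lt. pose proof (Cmod_ge_0 z). lra.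
  - lra.
  - intros n. apply Cmod_pow_le_geometric.
  - intros w. now apply translation_sym.
Qed.

Lemma taylor_series (u : Hr r) a : coordinates r gamma u a ->
  filterlim (fun N => sum_n (fun n => Hr_scal r (a n / al n)%C (monomial n)) N) eventually (Hr_nbhs u).
Proof.
  intros [Ha Hu]. apply Hr_series_converges.
  - intros X HX. assert (HX0 : 0 <= X ^ r) by (apply pow_le; lra).
    destruct (Ha (2 * (X ^ r + 1)) ltac:(lra)) as [M HM].
    exists M. split.
    { specialize (HM 0%nat). rewrite alpha_0 in HM by auto. simpl in HM. pose proof (Cmod_ge_0 (a 0%nat)). lra. }
    intros n w Hw. simpl. rewrite monomialE, Cmod_mult, Cmod_div_al, Cmod_pow by auto.
    specialize (HM n). rewrite Rpow_mult_distr in HM.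
    pose proof (alpha_pos r gamma hr hgamma n) as Pn.
    assert (Hw' : Cmod w ^ (r * n) <= (X ^ r + 1) ^ n).
    { rewrite pow_mult. apply pow_incr. split; [apply pow_le, Cmod_ge_0|].
      apply Rle_trans with (X ^ r); [|lra]. apply pow_incr. split; [apply Cmod_ge_0|auto]. }
    assert (E2 : 2 ^ n * (/ 2) ^ n = 1) by (rewrite <- Rpow_mult_distr, Rinv_r, pow1; lra).
    assert (H2 : 0 < (/ 2) ^ n) by (apply pow_lt; lra).
    apply Rmult_le_reg_r with (al n); auto.
    replace (Cmod (a n) / al n * Cmod w ^ (r * n) * al n) with (Cmod (a n) * Cmod w ^ (r * n)) by (field; lra).
    apply Rle_trans with (Cmod (a n) * (X ^ r + 1) ^ n).
    { apply Rmult_le_compat_l; [apply Cmod_ge_0|auto]. }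
    apply Rmult_le_compat_r with (r := (/ 2) ^ n) in HM; [|lra].
    replace (Cmod (a n) * (2 ^ n * (X ^ r + 1) ^ n) * (/ 2) ^ n) with (Cmod (a n) * (X ^ r + 1) ^ n * (2 ^ n * (/ 2) ^ n)) in HM by ring.
    rewrite E2 in HM. lra.
  - intros w. refine (is_Cseries_ext _ _ _ _ (Hu w)). intros n. simpl. now rewrite monomialE.
Qed.

(** Cauchy's estimate on the circle of radius n + 1 gives |b n| (n+1)^(r n) <= M e^(s (n+1)) alpha
    n, and [alpha_le_pow] cancels the power of n + 1. Hence the constants M e^s and Q e^s. *)
Lemma symbol_growth (b : nat -> C) (Phi : Hr r) : exp_symbol gamma b Phi ->
  exists C0 Y, 0 <= C0 /\ 0 < Y /\ forall n, Cmod (b n) <= C0 * Y ^ n.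
Proof.
  intros [[s [M [Hs HM]]] Hb].
  destruct (coordinates_exists r gamma hr hgamma Phi) as [a [[_ Ha] Hest]].
  assert (E : a = b) by now apply (coordinates_unique r gamma hr hgamma Phi). subst a.
  destruct (alpha_le_pow r gamma hr hgamma) as [Q [HQ HA]].
  assert (HM' : forall z, Cmod (Phi z) <= M * exp (s * Cmod z)).
  { intros z. specialize (HM z). rewrite exp_Ropp in HM. pose proof (exp_pos (s * Cmod z)).
    apply Rmult_le_reg_r with (/ exp (s * Cmod z)); [now apply Rinv_0_lt_compat|].
    rewrite (Rmult_assoc M), Rinv_r, Rmult_1_r by lra. exact HM. }
  assert (HM0 : 0 <= M).
  { specialize (HM' (RtoC 0)). rewrite Cmod_0, Rmult_0_r, exp_0 in HM'. pose proof (Cmod_ge_0 (Phi (RtoC 0))). lra. }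
  exists (M * exp s), (Q * exp s). pose proof (exp_pos s) as Hes.
  split; [apply Rmult_le_pos; lra|]. split; [now apply Rmult_lt_0_compat|]. intros n.
  assert (Hn : 0 < INR (S n)) by (apply lt_0_INR; lia).
  pose proof (Hest (INR (S n)) (M * exp (s * INR (S n))) Hn) as H.
  assert (H1 : Cmod (b n) * INR (S n) ^ (r * n) <= M * exp (s * INR (S n)) * al n).
  { apply H. intros t. eapply Rle_trans; [apply HM'|].
    rewrite Cmod_mult, Cmod_cis, Cmod_R, Rabs_pos_eq, Rmult_1_r by lra. lra. }
  assert (Hp : 0 < INR (S n) ^ (r * n)) by now apply pow_lt.
  apply Rmult_le_reg_r with (INR (S n) ^ (r * n)); auto.
  eapply Rle_trans; [exact H1|].
  replace (exp (s * INR (S n))) with (exp s * exp s ^ n).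
  2:{ rewrite exp_pow, <- exp_plus. f_equal. rewrite S_INR. ring. }
  rewrite Rpow_mult_distr.
  replace (M * exp s * (Q ^ n * exp s ^ n) * INR (S n) ^ (r * n)) with
    (M * (exp s * exp s ^ n) * (Q ^ n * INR (S n) ^ (r * n))) by ring.
  apply Rmult_le_compat_l; [|apply HA]. apply Rmult_le_pos; auto.
  apply Rmult_le_pos; [lra|apply pow_le; lra].
Qed.

(** Since Y^n x^(r n) <= ((1 + Y) x)^(r n), [alpha_exp] bounds every term by an exponential in x. *)
Lemma symbol_ex (b : nat -> C) C0 Y : 0 <= C0 -> 0 < Y -> (forall n, Cmod (b n) <= C0 * Y ^ n) ->
  exists Phi : Hr r, exp_symbol gamma b Phi.
Proof.
  intros HC HY Hb. destruct (alpha_exp r gamma hr hgamma) as [K [HK HA]].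
  assert (Hpow : forall n x, 0 <= x -> Y ^ n * x ^ (r * n) <= al n * exp (K * ((1 + Y) * x))).
  { intros n x Hx. eapply Rle_trans; [|apply HA, Rmult_le_pos; lra].
    rewrite Rpow_mult_distr. apply Rmult_le_compat_r; [now apply pow_le|].
    apply Rle_trans with ((1 + Y) ^ n); [apply pow_incr; lra|]. apply Rle_pow; [lra|nia]. }
  assert (Hg : coordinate_growth r gamma b).
  { intros R HR. exists (C0 * exp (K * ((1 + Y) * (1 + R)))). intros n.
    apply Rle_trans with (C0 * (Y ^ n * (1 + R) ^ (r * n))).
    - rewrite <- Rmult_assoc. apply Rmult_le_compat; auto using Cmod_ge_0.
      + apply pow_le; lra.
      + apply Rle_trans with ((1 + R) ^ n); [apply pow_incr; lra|]. apply Rle_pow; [lra|nia].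
    - rewrite Rmult_assoc, (Rmult_comm (exp _)). apply Rmult_le_compat_l; auto. apply Hpow; lra. }
  destruct (coordinates_build r gamma hr hgamma b Hg) as [Phi [[_ HP] _]]. exists Phi. split; [|exact HP].
  (* The bound is used at 2 |z|: the spare 2^(r n) gives the factor (1/2)^n, whose sum doubles
     C0. *)
  exists (K * ((1 + Y) * 2)), (2 * C0). split; [repeat apply Rmult_lt_0_compat; lra|].
  intros z. set (E := exp (K * ((1 + Y) * 2) * Cmod z)).
  assert (HE : 0 < E) by apply exp_pos.
  assert (HB : Cmod (Phi z) <= C0 * E / (1 - / 2)).
  { refine (is_Cseries_bound (C0 * E) (/ 2) ltac:(lra) _ _ _ (HP z)). intros n.
    rewrite Cmod_mult, Cmod_div_al, Cmod_pow by auto.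
    pose proof (alpha_pos r gamma hr hgamma n) as Pn.
    pose proof (Hpow n (2 * Cmod z) ltac:(pose proof (Cmod_ge_0 z); lra)) as P.
    replace (K * ((1 + Y) * (2 * Cmod z))) with (K * ((1 + Y) * 2) * Cmod z) in P by ring. fold E in P.
    rewrite Rpow_mult_distr in P.
    assert (H2n : 1 <= 2 ^ (r * n) * (/ 2) ^ n).
    { apply Rle_trans with (2 ^ n * (/ 2) ^ n).
      - rewrite <- Rpow_mult_distr, Rinv_r, pow1; lra.
      - apply Rmult_le_compat_r; [apply pow_le; lra|]. apply Rle_pow; [lra|nia]. }
    assert (Hzn : 0 <= Cmod z ^ (r * n)) by (apply pow_le, Cmod_ge_0).
    assert (HYn : 0 <= Y ^ n) by (apply pow_le; lra).
    assert (H2p : 0 <= (/ 2) ^ n) by (apply pow_le; lra).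
    apply Rmult_le_reg_r with (al n); auto.
    replace (Cmod (b n) / al n * Cmod z ^ (r * n) * al n) with (Cmod (b n) * Cmod z ^ (r * n)) by (field; lra).
    apply Rle_trans with (C0 * Y ^ n * Cmod z ^ (r * n)); [apply Rmult_le_compat_r; auto|].
    apply Rle_trans with (C0 * Y ^ n * Cmod z ^ (r * n) * (2 ^ (r * n) * (/ 2) ^ n)).
    { rewrite <- (Rmult_1_r (C0 * Y ^ n * Cmod z ^ (r * n))) at 1. apply Rmult_le_compat_l; auto.
      apply Rmult_le_pos; auto. now apply Rmult_le_pos. }
    replace (C0 * Y ^ n * Cmod z ^ (r * n) * (2 ^ (r * n) * (/ 2) ^ n)) with
      (C0 * (Y ^ n * (2 ^ (r * n) * Cmod z ^ (r * n))) * (/ 2) ^ n) by ring.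
    replace (C0 * E * (/ 2) ^ n * al n) with (C0 * (al n * E) * (/ 2) ^ n) by ring.
    apply Rmult_le_compat_r; auto. now apply Rmult_le_compat_l. }
  replace (C0 * E / (1 - / 2)) with (2 * C0 * E) in HB by field.
  rewrite exp_Ropp. fold E. apply Rmult_le_reg_r with E; auto.
  rewrite Rmult_assoc, Rinv_l by lra. lra.
Qed.

Variable L : Hr r -> Hr r.
Hypothesis hL : Hr_endo L.

Lemma commutes_iter : commutes L B -> forall n u, L (Bn n u) = Bn n (L u).
Proof.
  intros H n u. induction n; [reflexivity|]. simpl. now rewrite H, IHn.
Qed.

(** The functional v -> (L v)(w) applies term by term to the expansion of T_z u, and the result is
    the expansion of T_z (L u) at w. *)
Lemma commutes_translation : commutes L B -> forall z, commutes L (translation r gamma z).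
Proof.
  intros H z u. apply Hr_ext. intros w.
  pose proof (dual_series r _ (eval_dual r L w hL) _ _ (translation_series u z)) as S.
  refine (is_Cseries_unique _ _ _ S _).
  refine (is_Cseries_ext _ _ _ _ (translation_sym r gamma hr hgamma (L u) z w)).
  intros n. rewrite (dual_scal r _ (eval_dual r L w hL)). now rewrite (commutes_iter H).
Qed.

Lemma translation_convolution : (forall z, commutes L (translation r gamma z)) ->
  forall u z, L u z = gconvolution gamma (fun v => L v (RtoC 0)) u z.
Proof.
  intros H u z. unfold gconvolution. rewrite H. now rewrite translation_at_0.
Qed.

(** The coordinates of L u are T (B_r^n u). Replacing u by B_r u shifts them, which is also the
    effect of B_r on L u. *)
Lemma commutes_of_coefs (T : Hr r -> C) :
  (forall u z, is_Cseries (fun n => T (Bn n u) / al n * z ^ (r * n))%C (L u z)) -> commutes L B.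
Proof.
  intros H u.
  destruct (coordinates_exists r gamma hr hgamma (L u)) as [a [Ha _]].
  destruct (coordinates_exists r gamma hr hgamma (L (B u))) as [b [Hb _]].
  assert (Ea : a = fun n => T (Bn n u)) by (apply (coordinates_unique r gamma hr hgamma (L u)); [apply Ha|apply H]).
  assert (Eb : b = fun n => T (Bn n (B u))) by (apply (coordinates_unique r gamma hr hgamma (L (B u))); [apply Hb|apply H]).
  apply (coordinates_inj r gamma _ _ b Hb).
  pose proof (coordinates_bessel r gamma hr hgamma _ _ Ha) as HB. rewrite Ea in HB. rewrite Eb.
  replace (fun n => T (Bn n (B u))) with (fun n => T (Bn (S n) u)); [exact HB|].
  apply functional_extensionality. intros n. now rewrite bessel_iter_succ_r.
Qed.

Lemma convolution_commutes (T : Hr r -> C) : Hr_dual T ->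
  (forall u z, L u z = gconvolution gamma T u z) -> commutes L B.
Proof.
  intros HT H. apply (commutes_of_coefs T). intros u z. rewrite H.
  refine (is_Cseries_ext _ _ _ _ (dual_series r T HT _ _ (translation_series u z))).
  intros n. rewrite (dual_scal r T HT). unfold Cdiv. ring.
Qed.

(** Here T_z u is expanded in monomials in w, with coordinates B_r^n u(z), whereas
    [convolution_commutes] expands it in z. Applying T leaves T (w^(r n)) as symbol coefficients,
    which [dual_bound] bounds by C0 (X^r)^n. *)
Lemma convolution_symbol (T : Hr r -> C) : Hr_dual T ->
  (forall u z, L u z = gconvolution gamma T u z) ->
  exists (b : nat -> C) (Phi : Hr r), exp_symbol gamma b Phi /\ is_symbol_op gamma b L.
Proof.
  intros HT H. destruct (dual_bound r T HT) as [X [C0 [HX [HC Hbd]]]].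
  assert (HXr : 0 < X ^ r) by now apply pow_lt.
  destruct (symbol_ex (fun n => T (monomial n)) C0 (X ^ r)) as [Phi HPhi]; [lra|auto| |].
  - intros n. apply Hbd; [now apply pow_lt|]. intros w Hw.
    rewrite monomialE, Cmod_pow, <- pow_mult. apply pow_incr. split; [apply Cmod_ge_0|auto].
  - exists (fun n => T (monomial n)), Phi. split; auto. intros u z. rewrite H.
    pose proof (taylor_series _ _ (coordinates_translation r gamma hr hgamma u z)) as S.
    refine (is_Cseries_ext _ _ _ _ (dual_series r T HT _ _ S)).
    intros n. rewrite (dual_scal r T HT). unfold Cdiv. ring.
Qed.

(** Interchanging the sums in b n / alpha n times a (n + m) / alpha m z^(r m), the coefficient of
    z^(r m) / alpha m becomes the symbol series of B_r^m u at 0, that is L (B_r^m u)(0). *)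
Lemma symbol_commutes (b : nat -> C) (Phi : Hr r) :
  exp_symbol gamma b Phi -> is_symbol_op gamma b L -> commutes L B.
Proof.
  intros HPhi HL. destruct (symbol_growth b Phi HPhi) as [C0 [Y [HC [HY Hb]]]].
  apply (commutes_of_coefs (fun v => L v (RtoC 0))). intros u z.
  destruct (coordinates_exists r gamma hr hgamma u) as [a [Ha _]].
  destruct (double_series_bound r gamma hr hgamma a b Y (Cmod z) C0 (proj1 Ha) HY (Cmod_ge_0 z) HC Hb) as [M [HM0 HM]].
  refine (is_Cseries_swap M (/ 2) (fun n m => b n / al n * (a (n + m)%nat / al m * z ^ (r * m)))%C _ _ _ _ _ _ _ (HL u z)); try lra.
  - intros n m. apply HM; lra.
  - intros n. apply is_Cseries_mult. exact (proj2 (coordinates_bessel_iter r gamma hr hgamma u a n Ha) z).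
  - intros m.
    refine (is_Cseries_ext _ _ _ _ (eq_rect _ (fun l : C => is_Cseries _ l)
      (is_Cseries_mult (z ^ (r * m) / al m)%C _ _ (HL (Bn m u) (RtoC 0))) _ _)).
    + intros n. rewrite (bessel_iter_at_0 r gamma hr hgamma _ _ n (coordinates_bessel_iter r gamma hr hgamma u a m Ha)).
      rewrite (Nat.add_comm m n). unfold Cdiv. ring.
    + unfold Cdiv. ring.
Qed.
End Main.

Theorem proposition5p1 (r : nat) (gamma : nat -> R) (L : Hr r -> Hr r)
    (hr : (2 <= r)%nat)
    (hgamma : forall k : nat, (1 <= k <= r - 1)%nat ->
       (gamma k >= -1 + INR k / INR r)%R)
    (hL : Hr_endo L) :
  (commutes L (hyper_bessel r gamma) <->
     forall z : C, commutes L (translation r gamma z)) /\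
  (commutes L (hyper_bessel r gamma) <->
     exists! T : Hr r -> C, Hr_dual T /\
       forall (u : Hr r) (z : C), L u z = gconvolution gamma T u z) /\
  (commutes L (hyper_bessel r gamma) <->
     exists (b : nat -> C) (Phi : Hr r),
       exp_symbol gamma b Phi /\ is_symbol_op gamma b L) /\
  (forall (b : nat -> C) (Phi : Hr r),
     exp_symbol gamma b Phi -> is_symbol_op gamma b L ->
     forall u : Hr r,
       filterlim
         (fun N => sum_n (fun n => scal (b n / RtoC (alpha r gamma n))%C
                                     (hyper_bessel_iter r gamma n u)) N)
         eventually (Hr_nbhs (L u))).
Proof.
  (* Since k / r > 0, every gamma_k exceeds -1, so [Gamma] is evaluated at positive arguments. *)
  assert (hg : forall k, (1 <= k <= r - 1)%nat -> 0 < gamma k + 1).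
  { intros k Hk. specialize (hgamma k Hk).
    assert (0 < INR k / INR r) by (apply Rdiv_lt_0_compat; apply lt_0_INR; lia). lra. }
  pose proof (eval_dual r L (RtoC 0) hL) as HT0.
  pose proof (commutes_translation r gamma hr hg L hL) as H12.
  pose proof (translation_convolution r gamma hr hg L) as H23.
  pose proof (convolution_commutes r gamma hr hg L) as H31.
  split; [|split; [|split]].
  - split; [exact H12|]. intros H. exact (H31 _ HT0 (H23 H)).
  - split.
    + intros H. exists (fun v => L v (RtoC 0)). split; [split; [exact HT0|exact (H23 (H12 H))]|].
      (* At z = 0 the translation is the identity, so any representing T satisfies T u = (L
         u)(0). *)
      intros T [_ HT]. apply functional_extensionality. intros u.
      rewrite HT. unfold gconvolution. now rewrite translation_zero.
    + intros [T [[HT HL] _]]. exact (H31 T HT HL).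
  - split.
    + intros H. exact (convolution_symbol r gamma hr hg L _ HT0 (H23 (H12 H))).
    + intros [b [Phi [HPhi HL]]]. exact (symbol_commutes r gamma hr hg L b Phi HPhi HL).
  - intros b Phi HPhi HL u.
    destruct (symbol_growth r gamma hr hg b Phi HPhi) as [C0 [Y [HC [HY Hb]]]].
    exact (bessel_series_converges r gamma hr hg b Y C0 u (L u) HY HC Hb (HL u)).
Qed.
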